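(* Let $\mathbf A\in\mathbb R^{n\times d}$ (rank $d$) have a nondegenerate optimal design $\mathbf p^\star$. Then the facial condition number at the optimum satisfies $$\kappa=\frac{\widehat L_\star}{\mu_\star}\ \le\ \frac{4\binom{d+1}2d^2}{\Phi^2}\ \le\ 2\binom{d+1}2d^2\,\kappa_\Phi=O(d^4)\,\kappa_\Phi .$$ Consequently, after the same condition-dependent setup, the accelerated accuracy phase of Algorithm 1 (described in the context) improves the dependence of away-step Frank--Wolfe (whose query count is $O(\kappa_\Phi\log(1/\varepsilon))$) from linear in $\kappa_\Phi$ to $\sqrt\kappa$, with $\kappa=O(d^4)\kappa_\Phi$: up to the $\varepsilon$-independent term $C(\mathbf A)$ and a $\mathrm{poly}(d)$ factor, the query count of Algorithm 1 is never worse than that of away-step Frank--Wolfe, and is quadratically better whenever $\kappa\asymp\kappa_\Phi$.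
   Context: Design objects. $\mathbf A$ has rows $\mathbf a_1,\dots,\mathbf a_n$. For $\mathbf p\in\mathbb R^n$, $\mathbf M(\mathbf p)=\sum_ip_i\mathbf a_i\mathbf a_i^\top$; when $\mathbf M(\mathbf p)\succ0$, $v_i(\mathbf p)=\mathbf a_i^\top\mathbf M(\mathbf p)^{-1}\mathbf a_i$ and $f(\mathbf p)=-\log\det\mathbf M(\mathbf p)$. $\Delta_n$ is the probability simplex and, for $S\subseteq[n]$, $\Delta_S$ is the set of $\mathbf p\in\Delta_n$ supported on $S$. The gap is $g(\mathbf p)=\max_iv_i(\mathbf p)-d$; a $(1+\varepsilon)$-John ellipsoid is a $\mathbf p\in\Delta_n$ with $g(\mathbf p)\le\varepsilon d$. One leverage-score query at $\mathbf w$ with $\mathbf M(\mathbf w)\succ0$ returns $(v_i(\mathbf w))_{i\in[n]}$; query counts are for reaching a $(1+\varepsilon)$-John ellipsoid. An optimal design $\mathbf p^\star$ minimizes $f$ over $\Delta_n$; $f^\star=f(\mathbf p^\star)$, $\mathbf M^\star=\mathbf M(\mathbf p^\star)$, $S^\star=\{i:v_i(\mathbf p^\star)=d\}$. It is nondegenerate if (i) $\operatorname{supp}\mathbf p^\star=S^\star$ and $\gamma_{\mathrm{sc}}=\min_{i\notin S^\star}(d-v_i(\mathbf p^\star))>0$; (ii) the matrices $\{\mathbf a_i\mathbf a_i^\top\}_{i\in S^\star}$ are linearly independent. Put $p^\star_{\min}=\min_{i\in S^\star}p^\star_i$. Condition numbers. $T^\star=\{\boldsymbol\delta\in\mathbb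 R^{S^\star}:\sum_i\delta_i=0\}$; $\widehat{\mathbf H}(\mathbf p^\star)=\big((\mathbf a_i^\top(\mathbf M^\star)^{-1}\mathbf a_j)^2\big)_{i,j\in S^\star}$; $\mu_\star=\lambda_{\min}(\widehat{\mathbf H}(\mathbf p^\star)|_{T^\star})$; $\widehat L_\star=\lambda_{\max}(\widehat{\mathbf H}(\mathbf p^\star))$ (full block); $\kappa=\widehat L_\star/\mu_\star$. The facial distance $\Phi>0$ is that of the design polytope $\mathrm{conv}\{\mathbf a_i\mathbf a_i^\top:i\in[n]\}$ in the local norm $\|\mathbf H\|=\|(\mathbf M^\star)^{-1/2}\mathbf H(\mathbf M^\star)^{-1/2}\|_F$: the minimum, over its proper nonempty faces $F$, of the distance between $F$ and the convex hull of the vertices not lying on $F$. $\kappa_\Phi=1/(\mu_R\Phi^2)$, where $\mu_R\le\tfrac12$ is the local strong-convexity constant of $f$ in Zhao's analysis of away-step Frank--Wolfe. Away-step Frank--Wolfe facts (known). For this problem away-step Frank--Wolfe with exact line search has $g(\mathbf p^{(k)})\le\varepsilon d$ for all $k\ge K_{\mathrm{gap}}(\varepsilon)=O(\kappa_\Phi\log(1/\varepsilon))$, one query per step; and there is a finite $K_{\mathrm{id}}$, independent of $\varepsilon$, such that $\operatorname{supp}\mathbf p^{(k)}\subseteq S^\star$ for all $k\ge K_{\mathrm{id}}$. Constants. $L_{\mathrm{loc}}=4\widehat L_\star$, $\kappa_{\mathrm{loc}}=9\kappa$; $\bar r=\min\{\tfrac12,\gamma_{\mathrm{sc}}/(2d),\tfrac12p^\star_{\min}\sqrt{\mu_\star}\}$,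 $c_0=\bar r-\log(1+\bar r)$, $c_1=(1/126)^2$, $c=\min\{c_0,c_1/\kappa^3\}$. The algorithm is given the instance constants it uses ($c$, $\gamma_{\mathrm{sc}}$, $L_{\mathrm{loc}}$, $\kappa_{\mathrm{loc}}$). Algorithm 1, accelerated version. (Setup) Start from the Kumar--Yıldırım volumetric initialization: greedily construct $d$ (near-)orthogonal directions, take along each the two extremal rows of $\mathbf A$, and use the uniform design on these at most $2d$ rows, so that $f(\mathbf p)-f^\star=O(d\log d)$. While $g(\mathbf p)>c$ or $\min_{i:p_i>0}v_i(\mathbf p)<d-\gamma_{\mathrm{sc}}/2$: query $\mathbf v=(v_i(\mathbf p))_i$; let $j_+=\arg\max_iv_i$, $j_-=\arg\min_{i:p_i>0}v_i$. If $v_{j_+}-d\ge d-v_{j_-}$, set $\gamma=\frac{v_{j_+}-d}{d(v_{j_+}-1)}$ and $\mathbf p\leftarrow(1-\gamma)\mathbf p+\gamma\mathbf e_{j_+}$. Otherwise, with $\gamma_{\max}=p_{j_-}/(1-p_{j_-})$, set $\gamma=\min\{\frac{d-v_{j_-}}{d(v_{j_-}-1)},\gamma_{\max}\}$ if $v_{j_-}>1$ and $\gamma=\gamma_{\max}$ if $v_{j_-}\le1$, and $\mathbf p\leftarrow(1+\gamma)\mathbf p-\gamma\mathbf e_{j_-}$. (These are exact line-search away-step Frank--Wolfe steps.) The setup uses at most $C(\mathbf A)=\max\{K_{\mathrm{id}},K_{\mathrm{gap}}(c/d)\}$ queries, a number independent of $\varepsilon$ but dependent on the instance's conditioning, and exits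 with $\operatorname{supp}\mathbf p=S^\star$ and $f(\mathbf p)-f^\star\le c$. (Accelerated accuracy phase) Run restarted FISTA for $f$ on $\Delta_{S^\star}$, in cycles of $\lceil\sqrt{8\kappa_{\mathrm{loc}}}\,\rceil-1$ iterations, each cycle restarted from the last iterate of the previous one: from $\mathbf x_0$ put $\mathbf y_1=\mathbf x_0$, $t_1=1$, and iterate $\mathbf x_k=P(\mathbf y_k-\tfrac1{L_{\mathrm{loc}}}\nabla h(\mathbf y_k))$, $t_{k+1}=\tfrac12(1+\sqrt{1+4t_k^2})$, $\mathbf y_{k+1}=\mathbf x_k+\tfrac{t_k-1}{t_{k+1}}(\mathbf x_k-\mathbf x_{k-1})$, where $P$ is Euclidean projection onto $\Delta_{S^\star}$ and $\nabla h(\mathbf y)$ is the orthogonal projection onto $T^\star$ of $(-v_i(\mathbf y))_{i\in S^\star}$. Stop and return the cycle-end iterate once $g\le\varepsilon d$ there. The total query count of Algorithm 1 in this version is $C(\mathbf A)+O\big(\sqrt\kappa\,\log(\Theta_{\mathrm A}/\varepsilon)\big)$, where $\Theta_{\mathrm A}=\sqrt{L_{\mathrm{loc}}\kappa_{\mathrm{loc}}c_0}/d+2$. *)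

(* Defs.v *)
From HB Require Import structures.
From mathcomp Require Import all_boot all_order all_algebra.
From mathcomp Require Import boolp classical_sets reals exp.

Set Implicit Arguments.
Unset Strict Implicit.
Unset Printing Implicit Defensive.

Import Order.TTheory GRing.Theory Num.Theory.
Local Open Scope ring_scope.

Definition posdef (R : realType) (d : nat) (M : 'M[R]_d) : Prop :=
  M^T = M /\ forall x : 'rV[R]_d, x != 0 -> 0 < (x *m M *m x^T) 0 0.

(* a_i a_i^T; the points a_i are the rows of A *)
Definition atom (R : realType) (n d : nat) (A : 'M[R]_(n, d)) (i : 'I_n) :
    'M[R]_d :=
  (row i A)^T *m row i A.

Definition info (R : realType) (n d : nat) (A : 'M[R]_(n, d)) (p : 'rV[R]_n) :
    'M[R]_d :=
  \sum_i p 0 i *: atom A i.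

Definition lev (R : realType) (n d : nat) (A : 'M[R]_(n, d)) (p : 'rV[R]_n)
    (i : 'I_n) : R :=
  (row i A *m invmx (info A p) *m (row i A)^T) 0 0.

Definition obj (R : realType) (n d : nat) (A : 'M[R]_(n, d)) (p : 'rV[R]_n) :
    R :=
  - ln (\det (info A p)).

Definition simplex (R : realType) (n : nat) (p : 'rV[R]_n) : Prop :=
  (forall i, 0 <= p 0 i) /\ \sum_i p 0 i = 1.

Definition face_simplex (R : realType) (n : nat) (S : {set 'I_n})
    (p : 'rV[R]_n) : Prop :=
  simplex p /\ forall i, i \notin S -> p 0 i = 0.

(* Leverage scores are nonnegative when info A p is positive definite, so 0 is
   a neutral starting value for the maximum. *)
Definition gap (R : realType) (n d : nat) (A : 'M[R]_(n, d)) (p : 'rV[R]_n) :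
    R :=
  \big[Num.max/0]_i lev A p i - d%:R.

Definition john_ellipsoid (R : realType) (n d : nat) (A : 'M[R]_(n, d))
    (eps : R) (p : 'rV[R]_n) : Prop :=
  [/\ simplex p, posdef (info A p) & gap A p <= eps * d%:R].

(* obj is +oo at singular designs, whence the restriction to posdef ones. *)
Definition optimal_design (R : realType) (n d : nat) (A : 'M[R]_(n, d))
    (ps : 'rV[R]_n) : Prop :=
  [/\ simplex ps, posdef (info A ps) &
      forall p, simplex p -> posdef (info A p) -> obj A ps <= obj A p].

Definition Sstar (R : realType) (n d : nat) (A : 'M[R]_(n, d))
    (ps : 'rV[R]_n) : {set 'I_n} :=
  [set i | lev A ps i == d%:R]%SET.

(* Since 0 <= d - v_i <= d, starting the minimum at d matters only when
   Sstar is everything. In that case the minimum over the empty set should be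
   +oo, but d is as good: it leaves rbar unchanged, and gap <= c already forces
   every score to be at least d / 2, so that the setup loop is the same. *)
Definition gamma_sc (R : realType) (n d : nat) (A : 'M[R]_(n, d))
    (ps : 'rV[R]_n) : R :=
  \big[Num.min/d%:R]_(i | i \notin Sstar A ps) (d%:R - lev A ps i).

Definition nondegenerate_design (R : realType) (n d : nat) (A : 'M[R]_(n, d))
    (ps : 'rV[R]_n) : Prop :=
  [/\ forall i, (ps 0 i != 0) = (i \in Sstar A ps),
      0 < gamma_sc A ps &
      free [seq atom A i | i <- enum (Sstar A ps)]].

Definition pmin (R : realType) (n d : nat) (A : 'M[R]_(n, d))
    (ps : 'rV[R]_n) : R :=
  \big[Num.min/1]_(i in Sstar A ps) ps 0 i.

Definition Hhat (R : realType) (n d : nat) (A : 'M[R]_(n, d))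
    (ps : 'rV[R]_n) : 'M[R]_#|Sstar A ps| :=
  \matrix_(i, j) ((row (enum_val i) A *m invmx (info A ps)
                     *m (row (enum_val j) A)^T) 0 0) ^+ 2.

(* orthogonal projection onto the sum-zero hyperplane *)
Definition tangent_proj (R : realType) (s : nat) : 'M[R]_s :=
  1%:M - const_mx (s%:R^-1).

(* eigenvalues of the compression of H to T = {u : sum of u = 0} *)
Definition tangent_eigenvalue (R : realType) (s : nat) (H : 'M[R]_s) (l : R) :
    Prop :=
  exists u : 'rV[R]_s,
    [/\ u != 0, \sum_i u 0 i = 0 & u *m H *m tangent_proj R s = l *: u].

Definition mu_star (R : realType) (n d : nat) (A : 'M[R]_(n, d))
    (ps : 'rV[R]_n) : R :=
  inf [set l : R | tangent_eigenvalue (Hhat A ps) l]%classic.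

Definition L_star (R : realType) (n d : nat) (A : 'M[R]_(n, d))
    (ps : 'rV[R]_n) : R :=
  sup [set l : R | eigenvalue (Hhat A ps) l]%classic.

Definition kappa (R : realType) (n d : nat) (A : 'M[R]_(n, d))
    (ps : 'rV[R]_n) : R :=
  L_star A ps / mu_star A ps.

(* Frobenius norm; the Euclidean norm on row vectors *)
Definition fnorm (R : realType) (m n : nat) (X : 'M[R]_(m, n)) : R :=
  Num.sqrt (\sum_i \sum_j X i j ^+ 2).

(* M^(-1/2), for M positive definite *)
Definition inv_sqrtmx (R : realType) (d : nat) (M : 'M[R]_d) : 'M[R]_d :=
  xget 0 [set W : 'M[R]_d | posdef W /\ W *m W = invmx M]%classic.

Definition local_norm (R : realType) (d : nat) (M H : 'M[R]_d) : R :=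
  fnorm (inv_sqrtmx M *m H *m inv_sqrtmx M).

Definition conv_hull (R : realType) (d : nat) (X : set 'M[R]_d) :
    set 'M[R]_d :=
  [set x | exists (m : nat) (w : 'I_m -> R) (z : 'I_m -> 'M[R]_d),
     [/\ forall j, 0 <= w j, \sum_j w j = 1, forall j, X (z j) &
         x = \sum_j w j *: z j]]%classic.

Definition design_polytope (R : realType) (n d : nat) (A : 'M[R]_(n, d)) :
    set 'M[R]_d :=
  conv_hull [set atom A i | i in [set: 'I_n]]%classic.

(* Faces are cut out by valid linear inequalities. *)
Definition is_face (R : realType) (d : nat) (P F : set 'M[R]_d) : Prop :=
  exists (C : 'M[R]_d) (b : R),
    (forall X, P X -> \tr (C^T *m X) <= b) /\
    F = [set X | P X /\ \tr (C^T *m X) = b]%classic.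

(* An atom need not be a vertex: it may be a convex combination of others. *)
Definition vertices (R : realType) (d : nat) (P : set 'M[R]_d) :
    set 'M[R]_d :=
  [set X | is_face P [set X]]%classic.

Definition proper_face (R : realType) (d : nat) (P F : set 'M[R]_d) : Prop :=
  [/\ is_face P F, (F !=set0)%classic & F <> P].

Definition local_dist (R : realType) (d : nat) (M : 'M[R]_d)
    (F G : set 'M[R]_d) : R :=
  inf [set r : R | exists X Y, [/\ F X, G Y & r = local_norm M (X - Y)]]%classic.

Definition facial_distance (R : realType) (n d : nat) (A : 'M[R]_(n, d))
    (ps : 'rV[R]_n) : R :=
  let P := design_polytope A in
  inf [set r : R | exists F, proper_face P F /\
         r = local_dist (info A ps) F (conv_hull (vertices P `\` F))]%classic.

Definition kappa_Phi (R : realType) (n d : nat) (A : 'M[R]_(n, d))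
    (ps : 'rV[R]_n) (muR : R) : R :=
  (muR * facial_distance A ps ^+ 2)^-1.

Definition L_loc (R : realType) (n d : nat) (A : 'M[R]_(n, d))
    (ps : 'rV[R]_n) : R := 4 * L_star A ps.

Definition kappa_loc (R : realType) (n d : nat) (A : 'M[R]_(n, d))
    (ps : 'rV[R]_n) : R := 9 * kappa A ps.

Definition rbar (R : realType) (n d : nat) (A : 'M[R]_(n, d))
    (ps : 'rV[R]_n) : R :=
  Num.min (2^-1)
    (Num.min (gamma_sc A ps / (2 * d%:R))
             (2^-1 * pmin A ps * Num.sqrt (mu_star A ps))).

Definition cst_c0 (R : realType) (n d : nat) (A : 'M[R]_(n, d))
    (ps : 'rV[R]_n) : R :=
  rbar A ps - ln (1 + rbar A ps).

Definition cst_c (R : realType) (n d : nat) (A : 'M[R]_(n, d))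
    (ps : 'rV[R]_n) : R :=
  Num.min (cst_c0 A ps) ((126^-1) ^+ 2 / kappa A ps ^+ 3).

Definition Theta_A (R : realType) (n d : nat) (A : 'M[R]_(n, d))
    (ps : 'rV[R]_n) : R :=
  Num.sqrt (L_loc A ps * kappa_loc A ps * cst_c0 A ps) / d%:R + 2.

(* Uniform design on the rows that are extremal along d directions. The
   directions are only required to be linearly independent: this covers every
   greedy (near-)orthogonal choice of them. *)
Definition volumetric_init (R : realType) (n d : nat) (A : 'M[R]_(n, d))
    (p : 'rV[R]_n) : Prop :=
  exists (B : 'M[R]_d) (hi lo : 'I_d -> 'I_n),
    let along i k := (row i A *m (row k B)^T) 0 0 in
    let J := (hi @: [set: 'I_d] :|: lo @: [set: 'I_d])%SET in
    [/\ B \in unitmx,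
        forall k i, along (lo k) k <= along i k <= along (hi k) k,
        p = \row_i (if i \in J then #|J|%:R^-1 else 0) &
        posdef (info A p)].

(* One exact line-search step; ties in the two arg max / arg min are broken
   arbitrarily. *)
Definition afw_step (R : realType) (n d : nat) (A : 'M[R]_(n, d))
    (p p' : 'rV[R]_n) : Prop :=
  exists jp jm : 'I_n,
    let v := lev A p in
    let e j : 'rV[R]_n := delta_mx 0 j in
    [/\ forall i, v i <= v jp,
        0 < p 0 jm,
        forall i, 0 < p 0 i -> v jm <= v i &
        p' = if d%:R - v jm <= v jp - d%:R then
               let g := (v jp - d%:R) / (d%:R * (v jp - 1)) in
               (1 - g) *: p + g *: e jp
             else
               let gmax := p 0 jm / (1 - p 0 jm) in
               let g := if 1 < v jm then
                          Num.min ((d%:R - v jm) / (d%:R * (v jm - 1))) gmax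
                        else gmax in
               (1 + g) *: p - g *: e jm].

Definition afw_run (R : realType) (n d : nat) (A : 'M[R]_(n, d))
    (p : nat -> 'rV[R]_n) : Prop :=
  volumetric_init A (p 0%N) /\ forall k, afw_step A (p k) (p k.+1).

(* Known convergence guarantees of away-step Frank-Wolfe: linear rate of the
   gap (Kgap, with constant CZ in the O) and finite face identification (Kid). *)
Definition afw_guarantees (R : realType) (n d : nat) (A : 'M[R]_(n, d))
    (ps : 'rV[R]_n) (muR : R) (p : nat -> 'rV[R]_n)
    (Kid : nat) (Kgap : R -> nat) (CZ : R) : Prop :=
  [/\ forall eps, 0 < eps -> forall k, (Kgap eps <= k)%N ->
        gap A (p k) <= eps * d%:R,
      forall eps, 0 < eps <= 2^-1 ->
        (Kgap eps)%:R <= CZ * kappa_Phi A ps muR * ln (eps^-1) &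
      forall k, (Kid <= k)%N -> forall i, p k 0 i != 0 -> i \in Sstar A ps].

Definition setup_continue (R : realType) (n d : nat) (A : 'M[R]_(n, d))
    (ps p : 'rV[R]_n) : Prop :=
  cst_c A ps < gap A p \/
  exists i, 0 < p 0 i /\ lev A p i < d%:R - gamma_sc A ps / 2.

(* Kgap is evaluated at c / d, for which its guarantee reads gap <= c. *)
Definition C_setup (R : realType) (n d : nat) (A : 'M[R]_(n, d))
    (ps : 'rV[R]_n) (Kid : nat) (Kgap : R -> nat) : nat :=
  maxn Kid (Kgap (cst_c A ps / d%:R)).

(* Vectors indexed by Sstar are kept as vectors of 'rV_n that vanish off
   Sstar. *)

Definition face_proj (R : realType) (n : nat) (S : {set 'I_n})
    (y : 'rV[R]_n) : 'rV[R]_n :=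
  xget 0 [set x : 'rV[R]_n | face_simplex S x /\
            forall z, face_simplex S z -> fnorm (y - x) <= fnorm (y - z)]%classic.

(* orthogonal projection of (- v_i)_(i in S) onto the sum-zero hyperplane *)
Definition face_grad (R : realType) (n d : nat) (A : 'M[R]_(n, d))
    (S : {set 'I_n}) (y : 'rV[R]_n) : 'rV[R]_n :=
  \row_i (if i \in S then
            - lev A y i + (\sum_(j in S) lev A y j) / #|S|%:R
          else 0).

(* The state after k iterations is (x_k, y_(k+1), t_(k+1)). *)
Definition fista_step (R : realType) (n d : nat) (A : 'M[R]_(n, d))
    (ps : 'rV[R]_n) (st : 'rV[R]_n * 'rV[R]_n * R) :
    'rV[R]_n * 'rV[R]_n * R :=
  let: (x, y, t) := st in
  let S := Sstar A ps in
  let x' := face_proj S (y - (L_loc A ps)^-1 *: face_grad A S y) in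
  let t' := (1 + Num.sqrt (1 + 4 * t ^+ 2)) / 2 in
  (x', x' + ((t - 1) / t') *: (x' - x), t').

Definition fista_state (R : realType) (n d : nat) (A : 'M[R]_(n, d))
    (ps x0 : 'rV[R]_n) (k : nat) : 'rV[R]_n * 'rV[R]_n * R :=
  iter k (fista_step A ps) (x0, x0, 1).

Definition cycle_length (R : realType) (n d : nat) (A : 'M[R]_(n, d))
    (ps : 'rV[R]_n) : nat :=
  (`|Num.ceil (Num.sqrt (8 * kappa_loc A ps))|%N).-1.

Definition cycle_end (R : realType) (n d : nat) (A : 'M[R]_(n, d))
    (ps x0 : 'rV[R]_n) (j : nat) : 'rV[R]_n :=
  iter j (fun x => (fista_state A ps x (cycle_length A ps)).1.1) x0.

Definition setup_exit (R : realType) (n d : nat) (A : 'M[R]_(n, d))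
    (ps : 'rV[R]_n) (p : nat -> 'rV[R]_n) (k0 : nat) : Prop :=
  (forall k, (k < k0)%N -> setup_continue A ps (p k)) /\
  ~ setup_continue A ps (p k0).

Definition accel_stop (R : realType) (n d : nat) (A : 'M[R]_(n, d))
    (ps : 'rV[R]_n) (eps : R) (x0 : 'rV[R]_n) (T : nat) : Prop :=
  [/\ (0 < T)%N,
      forall j, (0 < j < T)%N -> eps * d%:R < gap A (cycle_end A ps x0 j) &
      gap A (cycle_end A ps x0 T) <= eps * d%:R].

(* All points queried by a run: the setup iterates (including the one at which
   the loop test fails), then for each cycle the points y_1, ..., y_m and the
   cycle end at which the gap is tested. *)
Definition alg1_queries (R : realType) (n d : nat) (A : 'M[R]_(n, d))
    (ps : 'rV[R]_n) (p : nat -> 'rV[R]_n) (k0 T : nat) : seq 'rV[R]_n :=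
  [seq p k | k <- iota 0 k0.+1] ++
  flatten [seq rcons [seq (fista_state A ps (cycle_end A ps (p k0) j) k).1.2
                     | k <- iota 0 (cycle_length A ps)]
                     (cycle_end A ps (p k0) j.+1)
          | j <- iota 0 T].

(* Main.v *)
(** Whitening the rows of A by M(ps)^(-1/2) turns the Hessian block into the
    Gram matrix of the whitened atoms, so that mu and L bound the squared local
    norm of M(q) by multiples of |q|^2. By the optimality conditions and the
    linear independence of the active atoms, every subset of the active atoms
    spans a face of the design polytope. The positive and negative parts of a
    tangent vector q are then, up to scale, a point of such a face and a point of
    the hull of the remaining vertices, whence mu >= Phi^2 / 4, while
    L <= |S| d^2 with |S| <= d (d + 1) / 2.

    A small gap makes the design close to ps in the self-concordant sense, which
    forces the support at the exit of the setup phase. From there on all FISTA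
    points remain in a Euclidean ball around ps inside the relative interior of
    the optimal face: the gradient step does not increase the distance to ps, and
    the extrapolated points are convex combinations of earlier points with the
    auxiliary sequence z of the Lyapunov function. Hence the projection never
    acts, the objective is smooth and strongly convex there, and each cycle halves
    the squared distance to ps. Finally (min p) L <= d bounds Theta by an
    absolute constant, so that the logarithms involving it are absorbed in
    log (1 / eps). *)
From HB Require Import structures.
Require Import Defs.
From mathcomp Require Import all_boot all_order all_algebra.
From mathcomp Require Import boolp classical_sets reals exp.
From mathcomp Require Import topology normedtype sequences derive.
From mathcomp Require Import ring lra.

Set Implicit Arguments.
Unset Strict Implicit.
Unset Printing Implicit Defensive.

Import Order.TTheory GRing.Theory Num.Theory.
Local Open Scope ring_scope.

(** * Frobenius inner product and symmetric matrices *)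

(** Smoothness and strong convexity of the log-determinant objective degenerate at singular designs,
    so the accelerated phase needs an invariant region. It has to be Euclidean, because gradient
    step, projection and momentum are Euclidean, whereas self-concordance controls the local norm.
    This exchange of norms explains the power of [kappa] in [cst_c]: if [D] is the squared Euclidean
    distance to [ps], a gap of at most [c] gives mu D <= 3 c, hence L D = kappa mu D <= 3 c1 /
    kappa^2, and the whitened information matrix stays within 1/8 of the identity. The objective is
    never differentiated. Its gradient inequality is a duality inequality for log det, and the
    smoothness estimates come from resolvent identities for the inverse information matrix. The
    facial bound does double duty: it is also what makes [mu_star] positive, and [rbar], [cst_c] and
    [kappa] are meaningful only then. Compactness is avoided: eigenvalues arise from infima, and the
    facial distance is positive because only finitely many faces exist. *)

Definition frob (R : realType) (m n : nat) (X Y : 'M[R]_(m, n)) : R :=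
  \tr (X *m Y^T).

Section Frobenius.
Variable R : realType.

Lemma frobE m n (X Y : 'M[R]_(m, n)) : frob X Y = \sum_i \sum_j X i j * Y i j.
Proof.
by apply: eq_bigr => i _; rewrite mxE; apply: eq_bigr => j _; rewrite mxE.
Qed.

Lemma frob_rowE n (x y : 'rV[R]_n) : frob x y = \sum_j x 0 j * y 0 j.
Proof. by rewrite frobE big_ord1. Qed.

Lemma frobC m n (X Y : 'M[R]_(m, n)) : frob X Y = frob Y X.
Proof. by rewrite /frob -mxtrace_tr trmx_mul trmxK. Qed.

Lemma frobDl m n (X Y Z : 'M[R]_(m, n)) : frob (X + Y) Z = frob X Z + frob Y Z.
Proof. by rewrite /frob mulmxDl mxtraceD. Qed.

Lemma frobZl m n a (X Y : 'M[R]_(m, n)) : frob (a *: X) Y = a * frob X Y.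
Proof. by rewrite /frob -scalemxAl mxtraceZ. Qed.

Lemma frobDr m n (X Y Z : 'M[R]_(m, n)) : frob X (Y + Z) = frob X Y + frob X Z.
Proof. by rewrite frobC frobDl !(frobC X). Qed.

Lemma frobZr m n a (X Y : 'M[R]_(m, n)) : frob X (a *: Y) = a * frob X Y.
Proof. by rewrite frobC frobZl frobC. Qed.

Lemma frobNl m n (X Y : 'M[R]_(m, n)) : frob (- X) Y = - frob X Y.
Proof. by rewrite -scaleN1r frobZl mulN1r. Qed.

Lemma frobNr m n (X Y : 'M[R]_(m, n)) : frob X (- Y) = - frob X Y.
Proof. by rewrite frobC frobNl frobC. Qed.

Lemma frob0l m n (Y : 'M[R]_(m, n)) : frob 0 Y = 0.
Proof. by rewrite -(scale0r 0) frobZl mul0r. Qed.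

Lemma frob_suml m n I r (P : pred I) (F : I -> 'M[R]_(m, n)) Y :
  frob (\sum_(i <- r | P i) F i) Y = \sum_(i <- r | P i) frob (F i) Y.
Proof. by apply: (big_morph (fun X => frob X Y)) => [X Z|]; rewrite ?frobDl ?frob0l. Qed.

Lemma frob_ge0 m n (X : 'M[R]_(m, n)) : 0 <= frob X X.
Proof. by rewrite frobE; do 2 (apply: sumr_ge0 => ? _); rewrite -expr2 sqr_ge0. Qed.

Lemma frob_eq0 m n (X : 'M[R]_(m, n)) : (frob X X == 0) = (X == 0).
Proof.
apply/eqP/eqP => [X0|->]; last exact: frob0l.
apply/matrixP => i j; rewrite mxE; apply/eqP; rewrite -sqrf_eq0 expr2.
move/eqP: X0; rewrite frobE psumr_eq0; last first.
  by move=> k _; apply: sumr_ge0 => l _; rewrite -expr2 sqr_ge0.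
move=> /allP/(_ i (mem_index_enum i))/=; rewrite psumr_eq0; last first.
  by move=> l _; rewrite -expr2 sqr_ge0.
by move=> /allP/(_ j (mem_index_enum j)).
Qed.

Lemma frob_gt0 m n (X : 'M[R]_(m, n)) : X != 0 -> 0 < frob X X.
Proof. by move=> X0; rewrite lt_def frob_ge0 frob_eq0 X0. Qed.

Lemma fnormE m n (X : 'M[R]_(m, n)) : fnorm X = Num.sqrt (frob X X).
Proof. by rewrite /fnorm frobE. Qed.

Lemma frob_mull m n p (A : 'M[R]_(m, p)) (X : 'M[R]_(p, n)) Y :
  frob (A *m X) Y = frob X (A^T *m Y).
Proof. by rewrite /frob trmx_mul trmxK mulmxA -mulmxA mxtrace_mulC. Qed.

Lemma frob_mulr m n p (A : 'M[R]_(p, n)) (X : 'M[R]_(m, p)) Y :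
  frob (X *m A) Y = frob X (Y *m A^T).
Proof. by rewrite /frob trmx_mul trmxK mulmxA. Qed.

Lemma frob_rows m n (X Y : 'M[R]_(m, n)) :
  frob X Y = \sum_i frob (row i X) (row i Y).
Proof.
rewrite frobE; apply: eq_bigr => i _; rewrite frob_rowE.
by apply: eq_bigr => j _; rewrite !mxE.
Qed.

(** An abstract semidefinite form, because three instances are needed: the Frobenius product, the
    form of a semidefinite matrix, and the form [frob (X *m N) Y] on matrices in the cocoercivity
    estimate. *)
Lemma cauchy_schwarz_form (V : lmodType R) (b : V -> V -> R) :
  (forall x, 0 <= b x x) -> (forall x y, b x y = b y x) ->
  (forall a x y z, b (a *: x + y) z = a * b x z + b y z) ->
  forall x y, b x y ^+ 2 <= b x x * b y y.
Proof.
move=> b0 bC bl x y.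
have q t : 0 <= t ^+ 2 * b x x + 2 * t * b x y + b y y.
  have := b0 (t *: x + y).
  by rewrite bl ![b _ (t *: x + y)]bC !bl (bC y x); move=> /le_trans; apply; lra.
have [bx0|bxN0] := eqVneq (b x x) 0.
  rewrite bx0 mul0r; have [->|bxyN0] := eqVneq (b x y) 0; first by rewrite expr0n.
  (* With [b x x = 0] the quadratic is affine in [t]; this choice gives it the value -1. *)
  have := q (- (b y y + 1) / (2 * b x y)); rewrite bx0 mulr0 add0r.
  have -> : 2 * (- (b y y + 1) / (2 * b x y)) * b x y = - (b y y + 1) by field.
  by move=> h; exfalso; lra.
have bx_gt0 : 0 < b x x by rewrite lt_def bxN0 b0.
have := q (- b x y / b x x).
have -> : (- b x y / b x x) ^+ 2 * b x x + 2 * (- b x y / b x x) * b x y + b y y =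
  (b x x * b y y - b x y ^+ 2) / b x x by field.
by rewrite pmulr_lge0 ?invr_gt0// subr_ge0.
Qed.

Lemma frob_CS m n (X Y : 'M[R]_(m, n)) : frob X Y ^+ 2 <= frob X X * frob Y Y.
Proof.
apply: cauchy_schwarz_form; [exact: frob_ge0|exact: frobC|].
by move=> a x y z; rewrite frobDl frobZl.
Qed.

Lemma quad_scale n (M : 'M[R]_n) a (x : 'rV_n) :
  frob (a *: x *m M) (a *: x) = a ^+ 2 * frob (x *m M) x.
Proof. by rewrite -scalemxAl frobZl frobZr mulrA. Qed.

Lemma frob_rank1 n (M : 'M[R]_n) (x : 'rV_n) :
  frob M (x^T *m x) = frob (x *m M) x.
Proof. by rewrite frob_mull. Qed.

(** The quadratic form is the pairing of [X] with the rank-one matrix [x^T *m x], whose Frobenius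
    norm is [frob x x]. *)
Lemma quad_le_frob n (X : 'M[R]_n) (x : 'rV_n) :
  `|frob (x *m X) x| <= Num.sqrt (frob X X) * frob x x.
Proof.
rewrite -frob_rank1.
have -> : frob x x = Num.sqrt (frob (x^T *m x) (x^T *m x)).
  have -> : frob (x^T *m x) (x^T *m x) = frob x x ^+ 2.
    rewrite frob_rank1 mulmxA [x *m x^T]mx11_scalar mul_scalar_mx frobZl.
    by rewrite -trace_mx11.
  by rewrite sqrtr_sqr ger0_norm// frob_ge0.
by rewrite -sqrtrM ?frob_ge0// -sqrtr_sqr ler_wsqrtr// frob_CS.
Qed.

End Frobenius.

(** * Spectral theorem for real symmetric matrices *)

Definition psd (R : realType) (n : nat) (M : 'M[R]_n) : Prop :=
  M^T = M /\ forall x : 'rV[R]_n, 0 <= frob (x *m M) x.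

Section Spectral.
Variable R : realType.

Lemma posdef_frob n (M : 'M[R]_n) :
  posdef M <-> M^T = M /\ forall x : 'rV[R]_n, x != 0 -> 0 < frob (x *m M) x.
Proof.
by split=> -[MT M0]; split=> // x /M0; rewrite /frob trace_mx11.
Qed.

Lemma frob_delta n (x : 'rV[R]_n) j : frob (delta_mx 0 j) x = x 0 j.
Proof.
rewrite frob_rowE (bigD1 j)//= big1 ?addr0 ?mxE ?eqxx ?mul1r// => k kj.
by rewrite mxE (negPf kj) andbF mul0r.
Qed.

Lemma sum_delta_row n (j : 'I_n) : \sum_i (delta_mx 0 j : 'rV[R]_n) 0 i = 1.
Proof.
rewrite (bigD1 j)//= big1 ?mxE ?eqxx ?addr0// => k kj.
by rewrite mxE (negPf kj) andbF.
Qed.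

Lemma posdef_psd n (M : 'M[R]_n) : posdef M -> psd M.
Proof.
move=> /posdef_frob[MT M0]; split=> // x; have [->|/M0/ltW//] := eqVneq x 0.
by rewrite mul0mx frob0l.
Qed.

Lemma psd_CS n (M : 'M[R]_n) : psd M -> forall x y : 'rV[R]_n,
  frob (x *m M) y ^+ 2 <= frob (x *m M) x * frob (y *m M) y.
Proof.
move=> [MT M0]; apply: (cauchy_schwarz_form (b := fun x y => frob (x *m M) y)).
- exact: M0.
- by move=> x y; rewrite frob_mulr MT frobC.
- by move=> a x y z; rewrite mulmxDl -scalemxAl frobDl frobZl.
Qed.

(* The matrix shifted by the infimum of the Rayleigh quotient is positive
   semidefinite; were it invertible, Cauchy-Schwarz for its quadratic form
   would push the quotient away from the infimum. *)
Lemma min_eigenvector n (H : 'M[R]_n.+1) : H^T = H -> exists l (u : 'rV[R]_n.+1),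
  [/\ u != 0, u *m H = l *: u & forall x : 'rV[R]_n.+1, l * frob x x <= frob (x *m H) x].
Proof.
move=> HT; pose S := [set r : R | exists x : 'rV[R]_n.+1,
  frob x x = 1 /\ r = frob (x *m H) x]%classic.
have S0 : (S !=set0)%classic.
  pose e : 'rV[R]_n.+1 := delta_mx 0 0.
  by exists (frob (e *m H) e), e; split=> //; rewrite frob_delta mxE !eqxx.
have Slb : has_lbound S.
  exists (- Num.sqrt (frob H H)) => _ [x [x1 ->]].
  by have := quad_le_frob H x; rewrite x1 mulr1 ler_norml => /andP[].
pose m := inf S; pose G := H - m%:M.
have GT : G^T = G by rewrite linearB/= HT tr_scalar_mx.
have GE (x : 'rV[R]_n.+1) : frob (x *m G) x = frob (x *m H) x - m * frob x x.
  by rewrite mulmxBr mul_mx_scalar frobDl frobNl frobZl.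
have Hm (x : 'rV[R]_n.+1) : m * frob x x <= frob (x *m H) x.
  have [->|x0] := eqVneq x 0; first by rewrite mul0mx !frob0l mulr0.
  have xx := frob_gt0 x0; rewrite -ler_pdivlMr//.
  apply: ge_inf => //; exists ((Num.sqrt (frob x x))^-1 *: x); split.
    by rewrite frobZl frobZr mulrA -expr2 exprVn sqr_sqrtr ?(ltW xx)// mulVf// gt_eqF.
  by rewrite quad_scale exprVn sqr_sqrtr ?(ltW xx)// mulrC.
have Gpsd : psd G by split=> // x; rewrite GE subr_ge0.
have [/eqP G0|/negP G0] := eqVneq (\det G) 0.
  have [u u0 uG] := det0P G0; exists m, u; split=> //.
  by move/eqP: uG; rewrite mulmxBr mul_mx_scalar subr_eq0 => /eqP.
exfalso; have Gu : G \in unitmx by rewrite unitmxE unitfE; apply/negP.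
pose K := Num.sqrt (frob (invmx G) (invmx G)) + 1.
have K0 : 0 < K by rewrite ltr_wpDl ?sqrtr_ge0.
have : m + K^-1 <= m; last by rewrite gerDl invr_le0 leNgt K0.
apply: lb_le_inf => // _ [x [x1 ->]].
have := psd_CS Gpsd x (x *m invmx G).
rewrite frob_mulr -mulmxA GT mulVmx// mulmx1 x1 mulmxKV// expr1n => h.
have := quad_le_frob (invmx G) x; rewrite x1 mulr1 frobC => /ler_normlW hK.
rewrite -lerBrDl -[m]mulr1 -x1 -GE.
rewrite -div1r ler_pdivrMr//; apply: le_trans h _.
by rewrite ler_wpM2l ?Gpsd.2// (le_trans hK)// lerDl.
Qed.

Lemma householder n (u : 'rV[R]_n.+1) : frob u u = 1 ->
  exists Q : 'M[R]_n.+1, Q *m Q^T = 1%:M /\ delta_mx 0 0 *m Q = u.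
Proof.
move=> u1; pose e : 'rV[R]_n.+1 := delta_mx 0 0; pose w := u - e.
pose s := frob w w; pose P := w^T *m w.
have e1 : frob e e = 1 by rewrite frob_delta mxE !eqxx.
have ew : frob e w = - (s / 2).
  rewrite /s /w frobDr frobNr frobDl !frobDr !frobNl !frobNr u1 e1 [frob u e]frobC.
  by field.
have PP : P *m P = s *: P.
  rewrite /P mulmxA -[w^T *m w *m w^T]mulmxA [w *m w^T]mx11_scalar -trace_mx11.
  by rewrite -/(frob w w) mul_mx_scalar -scalemxAl.
have PT : P^T = P by rewrite trmx_mul trmxK.
have eP : e *m P = - (s / 2) *: w.
  rewrite /P mulmxA [e *m w^T]mx11_scalar -trace_mx11 -/(frob e w) ew.
  by rewrite mul_scalar_mx.
(* The reflection along [w = u - e], which exchanges the unit vectors [e] and [u]. If [u = e], then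
   [s] is 0, so is [2 / s], and the reflection becomes the identity. *)
exists (1%:M - (2 / s) *: P); split.
  have -> : (1%:M - (2 / s) *: P)^T = 1%:M - (2 / s) *: P.
    by apply/matrixP => i j; rewrite -{2}PT !mxE eq_sym.
  set c := 2 / s; have cc : c * c * s = c + c.
    rewrite /c; have [->|s0] := eqVneq s 0; first by rewrite invr0 !mulr0 addr0.
    by field.
  rewrite mulmxBl mul1mx mulmxBr mulmx1 -scalemxAl -scalemxAr PP !scalerA cc.
  by apply/matrixP => i j; rewrite !mxE; ring.
rewrite mulmxBr mulmx1 -scalemxAr eP scalerA -/e.
have [s0|s0] := eqVneq s 0.
  have w0 : w = 0 by apply/eqP; rewrite -frob_eq0 -/s s0.
  by rewrite w0 scaler0 subr0; apply/esym/eqP; rewrite -subr_eq0 -/w w0.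
rewrite (_ : 2 / s * - (s / 2) = -1); last by field.
by rewrite scaleN1r opprK /w addrC subrK.
Qed.

(** Deflation: conjugating by an orthogonal matrix that sends the first basis vector to a unit
    eigenvector leaves one entry in the first row; symmetry clears the first column, and induction
    treats the remaining block. *)
Lemma spectral n (H : 'M[R]_n) : H^T = H -> exists (Q : 'M[R]_n) (D : 'rV[R]_n),
  Q *m Q^T = 1%:M /\ H = Q^T *m diag_mx D *m Q.
Proof.
elim: n H => [|n IH] H HT.
  by exists 1%:M, 0; split; apply/matrixP => -[].
have [l [u [u0 uH _]]] := min_eigenvector HT.
pose u1 := (Num.sqrt (frob u u))^-1 *: u.
have uu := frob_gt0 u0.
have u11 : frob u1 u1 = 1.
  by rewrite frobZl frobZr mulrA -expr2 exprVn sqr_sqrtr ?(ltW uu)// mulVf// gt_eqF.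
have u1H : u1 *m H = l *: u1 by rewrite -scalemxAl uH !scalerA mulrC.
have [Q0 [QQ Qu]] := householder u11.
have QQ' : Q0^T *m Q0 = 1%:M by apply: mulmx1C.
pose H1 : 'M[R]_(1 + n) := Q0 *m H *m Q0^T.
have H1T : H1^T = H1 by rewrite !trmx_mul trmxK HT mulmxA.
have H1e : (delta_mx 0 0 : 'rV_(1 + n)) *m H1 = l *: delta_mx 0 0.
  by rewrite /H1 !mulmxA Qu u1H -scalemxAl -Qu -mulmxA QQ mulmx1.
have H10 j : H1 0 j = if j == 0 then l else 0.
  have := congr1 (fun M : 'rV_(1 + n) => M 0 j) H1e.
  rewrite -rowE !mxE => ->; rewrite eqxx/=; case: (j == 0); first by rewrite mulr1.
  by rewrite mulr0.
pose H' := drsubmx H1.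
have H'T : H'^T = H' by rewrite /H' trmx_drsub H1T.
have [Q' [D' [Q'1 H'E]]] := IH _ H'T.
have l0 : lshift n (0 : 'I_1) = (0 : 'I_(1 + n)) by apply/val_inj.
have H1E : H1 = block_mx l%:M 0 0 H'.
  have ur : ursubmx H1 = 0.
    apply/matrixP => i j; rewrite [LHS]mxE [LHS]mxE ord1 l0 H10 mxE.
    by case: eqP => // /(congr1 val).
  rewrite -[LHS]submxK ur; congr block_mx.
    by apply/matrixP => i j; rewrite !ord1 [LHS]mxE [LHS]mxE l0 H10 mxE !eqxx mulr1n.
  by rewrite -[dlsubmx H1]trmxK trmx_dlsub H1T ur trmx0.
pose B : 'M[R]_(1 + n) := block_mx 1%:M 0 0 Q'.
have BT : B^T = block_mx 1%:M 0 0 Q'^T by rewrite tr_block_mx !trmx0 trmx1.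
have BB : B *m B^T = 1%:M.
  rewrite BT mulmx_block !(mul1mx, mul0mx, mulmx0, addr0, add0r) Q'1.
  by rewrite -scalar_mx_block.
have BD : H1 = B^T *m diag_mx (row_mx l%:M D') *m B.
  rewrite BT H1E diag_mx_row !mulmx_block.
  rewrite !(mul1mx, mulmx1, mul0mx, mulmx0, addr0, add0r) -H'E.
  by congr block_mx; apply/matrixP => i j; rewrite !ord1 !mxE eqxx.
exists (B *m Q0), (row_mx l%:M D' : 'rV_(1 + n)); split.
  by rewrite trmx_mul mulmxA -[B *m Q0 *m Q0^T]mulmxA QQ mulmx1 BB.
rewrite trmx_mul !mulmxA -[_ *m _ *m B]mulmxA -[_ *m (_ *m B)]mulmxA [B^T *m _]mulmxA.
rewrite -BD /H1 !mulmxA QQ' mul1mx -mulmxA QQ'.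
by rewrite mulmx1.
Qed.

End Spectral.

(** * Logarithmic inequalities *)

Section ExponentialBounds.
Import numFieldNormedType.Exports.

Lemma ge0_of_derive (R : realType) (F dF : R -> R) (x : R) : F 0 = 0 ->
  (forall y : R, is_derive y 1 F (dF y)) -> (forall y, 0 <= y -> 0 <= dF y) ->
  0 <= x -> 0 <= F x.
Proof.
move=> F0 FdF dF0 x0.
have cF : {within `[0, x], continuous F}%classic.
  apply: continuous_subspaceT => y.
  by apply/differentiable_continuous/derivable1_diffP; case: (FdF y).
have [y] := MVT_segment x0 (fun y _ => FdF y) cF.
rewrite in_itv/= => /andP[y0 _]; rewrite F0 !subr0 => ->.
by rewrite mulr_ge0// dF0.
Qed.

Lemma expR_ge_quadratic (R : realType) (x : R) : 0 <= x ->
  1 + x + x ^+ 2 / 2 <= expR x.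
Proof.
move=> x0; rewrite -subr_ge0.
pose F (y : R) := expR y - (1 + y + y ^+ 2 / 2).
apply: (@ge0_of_derive R F (fun y => expR y - (1 + y))) => //.
- by rewrite /F expR0 expr0n/= mul0r !addr0 subrr.
- move=> y; rewrite /F; apply: is_derive_eq.
  by rewrite /GRing.scale/=; field.
- by move=> y y0; rewrite subr_ge0 expR_ge1Dx.
Qed.

(** This is artanh x >= x, multiplied out so that no condition x < 1 is required. *)
Lemma expR_artanh (R : realType) (x : R) : 0 <= x ->
  (1 - x) * expR x <= (1 + x) * expR (- x).
Proof.
move=> x0; rewrite -subr_ge0.
pose F (y : R) := (1 + y) * expR (- y) - (1 - y) * expR y.
apply: (@ge0_of_derive R F (fun y => y * (expR y - expR (- y)))) => //.
- by rewrite /F oppr0 expR0; ring.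
- move=> y; rewrite /F; apply: is_derive_eq.
  by rewrite /GRing.scale/=; ring.
- by move=> y y0; rewrite mulr_ge0// subr_ge0 ler_expR; lra.
Qed.

End ExponentialBounds.

(* The growth of a self-concordant function at local distance s from its
   minimizer. *)
Definition sc_gain (R : realType) (s : R) : R := s - ln (1 + s).

Section SelfConcordance.
Variable R : realType.
Implicit Types a b r s x l : R.

Lemma ln_leB1 x : 0 < x -> ln x <= x - 1.
Proof. by move=> x0; rewrite -{1}[x](subrK 1) addrC le_ln1Dx//; lra. Qed.

Lemma ln_le_expR x l : 0 < x -> (x <= expR l) = (ln x <= l).
Proof. by move=> x0; rewrite -[l in RHS]expRK ler_ln// posrE expR_gt0. Qed.

Lemma sc_gain_ge0 s : 0 <= s -> 0 <= sc_gain s.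
Proof. by move=> s0; rewrite subr_ge0 le_ln1Dx//; lra. Qed.

Lemma sc_gain_le_sqr s : 0 <= s -> sc_gain s <= s ^+ 2.
Proof.
move=> s0; have s1 : 0 < 1 + s by lra.
have : ln (1 + s)^-1 <= (1 + s)^-1 - 1 by rewrite ln_leB1// invr_gt0.
rewrite lnV ?posrE// => h; rewrite /sc_gain.
suff : s + (1 + s)^-1 - 1 <= s ^+ 2 by lra.
rewrite -subr_ge0 (_ : _ - _ = s ^+ 3 / (1 + s)); last by field; lra.
by rewrite divr_ge0 ?exprn_ge0// ltW.
Qed.

Lemma sc_gain_ge_sqr s : 0 <= s <= 2^-1 -> s ^+ 2 / 3 <= sc_gain s.
Proof.
move=> /andP[s0 s1]; rewrite /sc_gain.
suff : ln (1 + s) <= s - s ^+ 2 / 3 by lra.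
rewrite -ln_le_expR; last by lra.
have s2 : 0 <= s - s ^+ 2 / 3 by nra.
apply: le_trans (expR_ge_quadratic s2).
(* On [0, 1/2] the bracket is nonnegative because (5/6)^2 / 2 = 25/72 exceeds 1/3. *)
suff : 0 <= s ^+ 2 * ((1 - s / 3) ^+ 2 / 2 - 1 / 3) by nra.
by apply: mulr_ge0; [exact: sqr_ge0|nra].
Qed.

Lemma sc_gain_inj_le r s : 0 < r -> 0 <= s -> sc_gain s <= sc_gain r -> s <= r.
Proof.
move=> r0 s0; rewrite /sc_gain => h; rewrite leNgt; apply/negP => rs.
have r1 : 0 < 1 + r by lra.
have s1 : 0 < 1 + s by lra.
have : ln ((1 + s) / (1 + r)) <= (1 + s) / (1 + r) - 1 by rewrite ln_leB1// divr_gt0.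
rewrite ln_div ?posrE//.
have -> : (1 + s) / (1 + r) - 1 = (s - r) / (1 + r) by field; lra.
move=> h2; have : s - r <= (s - r) / (1 + r) by lra.
by rewrite ler_pdivlMr//; nra.
Qed.

(** Put u = a + b - c. After exponentiation the claim is (1 + a) (1 + b) <= e^u (1 + c). Since c^2 =
    a^2 + b^2, the second-order Taylor polynomial of e^u already suffices, with surplus c u^2 /
    2. *)
Lemma sc_gain_hypot a b : 0 <= a -> 0 <= b ->
  sc_gain (Num.sqrt (a ^+ 2 + b ^+ 2)) <= sc_gain a + sc_gain b.
Proof.
move=> a0 b0; set c := Num.sqrt _.
have c0 : 0 <= c by exact: sqrtr_ge0.
have cE : c ^+ 2 = a ^+ 2 + b ^+ 2 by rewrite sqr_sqrtr// addr_ge0// sqr_ge0.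
have u0 : 0 <= a + b - c.
  by rewrite subr_ge0 -ler_sqr ?nnegrE ?addr_ge0// cE; nra.
rewrite /sc_gain.
suff : ln (1 + a) + ln (1 + b) <= (a + b - c) + ln (1 + c) by lra.
have a1 : 0 < 1 + a by lra. have b1 : 0 < 1 + b by lra. have c1 : 0 < 1 + c by lra.
rewrite -lnM ?posrE// -ln_le_expR ?mulr_gt0// expRD lnK ?posrE//.
apply: le_trans (_ : (1 + (a + b - c) + (a + b - c) ^+ 2 / 2) * (1 + c) <= _).
  rewrite -subr_ge0 (_ : _ - _ = c * (a + b - c) ^+ 2 / 2 + (a ^+ 2 + b ^+ 2 - c ^+ 2) / 2).
    by rewrite cE subrr mul0r addr0 divr_ge0// mulr_ge0// sqr_ge0.
  by field.
by rewrite ler_pM2r// expR_ge_quadratic.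
Qed.

(** For [l >= 1] this is an equality. For [l < 1], with x = 1 - l, it says that ln (1 + x) - ln (1 -
    x) is at least 2 x. *)
Lemma sc_gain_log l : 0 < l -> sc_gain `|l - 1| <= l - 1 - ln l.
Proof.
move=> l0; rewrite /sc_gain; have [l1|l1] := leP 1 l.
  by rewrite ger0_norm ?subr_ge0// (_ : 1 + (l - 1) = l)//; ring.
rewrite ltr0_norm ?subr_lt0// opprB.
have := @expR_artanh R (1 - l); rewrite (_ : 1 - (1 - l) = l); last by ring.
move=> /(_ ltac:(lra)) h.
suff : ln l + (1 - l) <= ln (1 + (1 - l)) - (1 - l) by lra.
have l2 : 0 < 1 + (1 - l) by lra.
rewrite -ler_expR expRD lnK ?posrE// (le_trans h)//.
by rewrite expRD lnK ?posrE.
Qed.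

Lemma sc_gain_norm (n : nat) (x : 'I_n -> R) :
  sc_gain (Num.sqrt (\sum_i x i ^+ 2)) <= \sum_i sc_gain `|x i|.
Proof.
elim: n x => [|n IH] x.
  by rewrite !big_ord0 sqrtr0 /sc_gain addr0 ln1 subr0.
rewrite !big_ord_recr/=; set S := \sum_i x _ ^+ 2.
have S0 : 0 <= S by apply: sumr_ge0 => i _; rewrite sqr_ge0.
rewrite -[S]sqr_sqrtr// -[x ord_max ^+ 2]real_normK ?num_real//.
apply: le_trans (sc_gain_hypot _ _) _; rewrite ?sqrtr_ge0//.
by rewrite lerD2r IH.
Qed.

Lemma sum_sc_gain_log (n : nat) (l : 'I_n -> R) : (forall i, 0 < l i) ->
  sc_gain (Num.sqrt (\sum_i (l i - 1) ^+ 2)) <=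
    \sum_i l i - n%:R - ln (\prod_i l i).
Proof.
move=> l0; apply: le_trans (sc_gain_norm _) _.
have -> : ln (\prod_i l i) = \sum_i ln (l i).
  elim: n l l0 => [|n IH] l l0; first by rewrite !big_ord0 ln1.
  rewrite !big_ord_recr/= lnM ?posrE ?prodr_gt0// IH//.
have -> : n%:R = \sum_(i < n) 1 :> R by rewrite sumr_const card_ord.
rewrite -!sumrB; apply: ler_sum => i _; exact: sc_gain_log.
Qed.

End SelfConcordance.

(** * Positive definite matrices: square roots, log det, bounds on inverses *)

Section PositiveDefinite.
Variable R : realType.

Lemma frob_orth n (Q X : 'M[R]_n) : Q *m Q^T = 1%:M ->
  frob (Q^T *m X *m Q) (Q^T *m X *m Q) = frob X X.
Proof.
move=> QQ; rewrite frob_mulr -!mulmxA QQ mulmx1 frob_mull trmxK mulmxA QQ.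
by rewrite mul1mx.
Qed.

Lemma posdef_spectral n (E : 'M[R]_n) : posdef E ->
  exists (Q : 'M[R]_n) (D : 'rV[R]_n),
  [/\ Q *m Q^T = 1%:M, E = Q^T *m diag_mx D *m Q & forall i, 0 < D 0 i].
Proof.
move=> /posdef_frob[ET E0]; have [Q [D [QQ EE]]] := spectral ET.
exists Q, D; split=> // i.
have q0 : row i Q != 0.
  apply/eqP => q0; have := congr1 (fun M => row i M) QQ.
  rewrite row_mul q0 mul0mx => /matrixP/(_ 0 i); rewrite !mxE eqxx => /esym/eqP.
  by rewrite oner_eq0.
have := E0 _ q0; rewrite EE.
have qQ : row i Q *m Q^T = delta_mx 0 i by rewrite -row_mul QQ row1.
by rewrite !mulmxA qQ frob_mulr qQ frobC frob_delta -rowE !mxE eqxx.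
Qed.

Lemma posdef_det_gt0 n (E : 'M[R]_n) : posdef E -> 0 < \det E.
Proof.
move=> /posdef_spectral[Q [D [QQ -> D0]]].
rewrite !det_mulmx mulrAC -det_mulmx (mulmx1C QQ) det1 mul1r det_diag.
by apply: prodr_gt0 => i _.
Qed.

Lemma posdef_unit n (E : 'M[R]_n) : posdef E -> E \in unitmx.
Proof. by move=> /posdef_det_gt0 d0; rewrite unitmxE unitfE gt_eqF. Qed.

Lemma posdef_conj n (E V : 'M[R]_n) : posdef E -> V \in unitmx ->
  posdef (V *m E *m V^T).
Proof.
move=> /posdef_frob[ET E0] Vu; apply/posdef_frob; split.
  by rewrite !trmx_mul trmxK ET mulmxA.
move=> x x0; rewrite !mulmxA frob_mulr trmxK; apply: E0.
by apply: contra x0 => /eqP h; rewrite -(mulmxK Vu x) h mul0mx.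
Qed.

Lemma posdef_inv n (E : 'M[R]_n) : posdef E -> posdef (invmx E).
Proof.
move=> pE; have Eu := posdef_unit pE; have [ET _] := pE.
have := posdef_conj pE (V := invmx E); rewrite unitmx_inv => /(_ Eu).
by rewrite mulVmx// mul1mx trmx_inv ET.
Qed.

Lemma posdef_sqrt n (E : 'M[R]_n) : posdef E -> exists W : 'M[R]_n,
  posdef W /\ W *m W = E.
Proof.
move=> /posdef_spectral[Q [D [QQ EE D0]]].
pose S := diag_mx (map_mx Num.sqrt D); exists (Q^T *m S *m Q); split; last first.
  rewrite EE -!mulmxA; congr (_ *m _); rewrite !mulmxA; congr (_ *m _).
  rewrite -[S *m Q *m _]mulmxA QQ mulmx1 mulmx_diag; congr diag_mx.
  by apply/rowP => i; rewrite !mxE -expr2 sqr_sqrtr// ltW.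
rewrite -{2}[Q]trmxK; apply: posdef_conj; last first.
  by rewrite unitmx_tr; case/mulmx1_unit: QQ.
apply/posdef_frob; split; first by rewrite tr_diag_mx.
move=> x x0; rewrite frob_rowE.
have /rV0Pn[i xi] := x0.
rewrite (bigD1 i)//= ltr_wpDr//.
  apply: sumr_ge0 => j _; rewrite mul_mx_diag !mxE mulrAC.
  by rewrite mulr_ge0 ?sqrtr_ge0// -expr2 sqr_ge0.
by rewrite mul_mx_diag !mxE mulrAC mulr_gt0 ?sqrtr_gt0// -expr2 exprn_even_gt0.
Qed.

Lemma inv_sqrtmxP n (M : 'M[R]_n) : posdef M ->
  posdef (inv_sqrtmx M) /\ inv_sqrtmx M *m inv_sqrtmx M = invmx M.
Proof.
move=> /posdef_inv/posdef_sqrt[W h].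
by rewrite /inv_sqrtmx; case: xgetP => [V -> []//|/(_ W)].
Qed.

(** In an eigenbasis the right side is a sum of terms l - 1 - ln l and the norm on the left is that
    of the vector of the l - 1. This is the self-concordant growth of - log det at the identity; it
    later turns an objective gap into a distance. *)
Lemma logdet_gain n (E : 'M[R]_n) : posdef E ->
  sc_gain (Num.sqrt (frob (E - 1%:M) (E - 1%:M))) <= \tr E - n%:R - ln (\det E).
Proof.
move=> /posdef_spectral[Q [D [QQ EE D0]]].
have QQ' := mulmx1C QQ.
have E1 : E - 1%:M = Q^T *m (diag_mx D - 1%:M) *m Q.
  by rewrite mulmxBr mulmxBl mulmx1 QQ' EE.
rewrite E1 frob_orth// {1 2}EE mxtrace_mulC mulmxA QQ mul1mx.
rewrite !det_mulmx mulrAC -det_mulmx QQ' det1 mul1r det_diag.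
have -> : frob (diag_mx D - 1%:M) (diag_mx D - 1%:M) = \sum_i (D 0 i - 1) ^+ 2.
  rewrite frobE; apply: eq_bigr => i _; rewrite (bigD1 i)//= big1.
    by rewrite addr0 !mxE eqxx expr2.
  by move=> j ji; rewrite !mxE eq_sym (negPf ji) subrr mul0r.
have -> : \tr (diag_mx D) = \sum_i D 0 i.
  by apply: eq_bigr => i _; rewrite mxE eqxx.
exact: sum_sc_gain_log.
Qed.

(** With [W *m W = N] this is the nonnegativity of tr F - n - ln det F at F = W E W. *)
Lemma logdet_pair n (N E : 'M[R]_n) : posdef N -> posdef E ->
  ln (\det N) + ln (\det E) <= \tr (N *m E) - n%:R.
Proof.
move=> pN pE; have [W [pW WW]] := posdef_sqrt pN.
have [WT _] := pW.
have pF : posdef (W *m E *m W) by rewrite -{2}WT; apply/posdef_conj/posdef_unit.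
have := le_trans (sc_gain_ge0 (sqrtr_ge0 _)) (logdet_gain pF).
rewrite mxtrace_mulC mulmxA WW.
have -> : \det (W *m E *m W) = \det N * \det E.
  by rewrite -WW !det_mulmx mulrAC.
by rewrite lnM ?posrE ?posdef_det_gt0// subr_ge0.
Qed.

(* For symmetric X, these control the trace forms tr (X N X) and
   tr (N1 X N2 X) by the Frobenius norm of X. *)
Lemma frob_quad_ge0 m n (N : 'M[R]_n) (X : 'M[R]_(m, n)) : psd N ->
  0 <= frob (X *m N) X.
Proof.
by move=> [_ N0]; rewrite frob_rows; apply: sumr_ge0 => i _; rewrite row_mul.
Qed.

Lemma frob_quad_le m n c (N : 'M[R]_n) (X : 'M[R]_(m, n)) :
  (forall x : 'rV[R]_n, frob (x *m N) x <= c * frob x x) ->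
  frob (X *m N) X <= c * frob X X.
Proof.
move=> Nc; rewrite frob_rows [frob X X]frob_rows mulr_sumr; apply: ler_sum => i _.
by rewrite row_mul.
Qed.

Lemma frob_quad2_le n c (N1 N2 X : 'M[R]_n) : 0 <= c -> posdef N1 ->
  (forall x : 'rV[R]_n, frob (x *m N1) x <= c * frob x x) ->
  (forall x : 'rV[R]_n, frob (x *m N2) x <= c * frob x x) ->
  X^T = X -> \tr (N1 *m X *m N2 *m X) <= c ^+ 2 * frob X X.
Proof.
move=> c0 /posdef_sqrt[W [pW <-]] h1 h2 XT; have [WT _] := pW.
have -> : \tr (W *m W *m X *m N2 *m X) = frob (W *m X *m N2) (W *m X).
  rewrite /frob trmx_mul XT WT [RHS]mxtrace_mulC !mulmxA.
  by rewrite [LHS]mxtrace_mulC !mulmxA.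
apply: le_trans (frob_quad_le _ h2) _; rewrite expr2 -mulrA ler_wpM2l//.
apply: le_trans (frob_quad_le X h1).
by rewrite /frob trmx_mul XT WT !mulmxA mxtrace_mulC !mulmxA mxtrace_mulC !mulmxA.
Qed.

(** With [y = x *m invmx E] the hypothesis bounds c |y|^2 by <x, y>, while Cauchy-Schwarz bounds <x,
    y>^2 by |x|^2 |y|^2. *)
Lemma inv_quad_le n c (E : 'M[R]_n) (x : 'rV[R]_n) : 0 < c -> posdef E ->
  (forall y : 'rV[R]_n, c * frob y y <= frob (y *m E) y) ->
  frob (x *m invmx E) x <= frob x x / c.
Proof.
move=> c0 pE Ec; have Eu := posdef_unit pE; rewrite ler_pdivlMr//.
pose y := x *m invmx E; have := Ec y.
rewrite {1}/y mulmxKV// [frob x y]frobC => h.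
have := frob_CS y x; rewrite expr2; set q := frob y x in h *.
have := frob_ge0 y; have := frob_ge0 x => x0 y0 h2.
have q0 : 0 <= q by apply: le_trans h; rewrite mulr_ge0// ltW.
rewrite -/q; have [->|qN0] := eqVneq q 0; first by rewrite mul0r.
have qp : 0 < q by rewrite lt_def qN0.
rewrite -(ler_pM2l qp); nra.
Qed.

Lemma inv_quad_ge n c (E : 'M[R]_n) (x : 'rV[R]_n) : 0 < c -> posdef E ->
  (forall y : 'rV[R]_n, frob (y *m E) y <= c * frob y y) ->
  frob x x / c <= frob (x *m invmx E) x.
Proof.
move=> c0 pE Ec; have Eu := posdef_unit pE; rewrite ler_pdivrMr//.
have [->|x0] := eqVneq x 0; first by rewrite mul0mx !frob0l mul0r.
have xx := frob_gt0 x0.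
have := psd_CS (posdef_psd (posdef_inv pE)) x (x *m E).
rewrite mulmxK// frob_mulr.
have [ET _] := pE; rewrite trmx_inv ET mulmxK// => h.
have := Ec x; rewrite [frob (x *m E) x]frobC => h2.
have := (posdef_psd (posdef_inv pE)).2 x => q0.
rewrite -(ler_pM2l xx) -expr2; nra.
Qed.

Lemma near_id_quad n (E : 'M[R]_n) rho (x : 'rV[R]_n) : 0 <= rho ->
  frob (E - 1%:M) (E - 1%:M) <= rho ^+ 2 ->
  (1 - rho) * frob x x <= frob (x *m E) x <= (1 + rho) * frob x x.
Proof.
move=> r0 Er; have h := quad_le_frob (E - 1%:M) x.
have h2 : Num.sqrt (frob (E - 1%:M) (E - 1%:M)) <= rho.
  by rewrite -[rho]ger0_norm// -sqrtr_sqr ler_wsqrtr.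
have := le_trans h (ler_wpM2r (frob_ge0 x) h2).
by rewrite mulmxBr mulmx1 frobDl frobNl ler_norml => /andP[]; lra.
Qed.

Lemma near_id_posdef n (E : 'M[R]_n) rho : 0 <= rho < 1 -> E^T = E ->
  frob (E - 1%:M) (E - 1%:M) <= rho ^+ 2 -> posdef E.
Proof.
move=> /andP[r0 r1] ET Er; apply/posdef_frob; split=> // x x0.
have /andP[h _] := near_id_quad x r0 Er; apply: lt_le_trans h.
by rewrite mulr_gt0 ?frob_gt0// subr_gt0.
Qed.

End PositiveDefinite.

(** * Designs, leverage scores and the optimality conditions *)

Section Designs.
Variables (R : realType) (n d : nat).
Implicit Types (A : 'M[R]_(n, d)) (p q : 'rV[R]_n).

Lemma info_is_linear A : linear (info A).
Proof.
move=> a p q; rewrite /info scaler_sumr -big_split/=; apply: eq_bigr => i _.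
by rewrite !mxE scalerDl scalerA.
Qed.
HB.instance Definition _ A :=
  GRing.isLinear.Build R 'rV[R]_n 'M[R]_d _ (info A) (info_is_linear A).

Lemma info_delta A i : info A (delta_mx 0 i) = atom A i.
Proof.
rewrite /info (bigD1 i)//= big1 ?addr0 ?mxE ?eqxx ?scale1r// => j ji.
by rewrite mxE (negPf ji) andbF scale0r.
Qed.

Lemma atom_sym A i : (atom A i)^T = atom A i.
Proof. by rewrite /atom trmx_mul trmxK. Qed.

Lemma info_sym A p : (info A p)^T = info A p.
Proof. by rewrite /info linear_sum/=; apply: eq_bigr => i _; rewrite linearZ/= atom_sym. Qed.

Lemma frob_atom A i (M : 'M[R]_d) : frob M (atom A i) = frob (row i A *m M) (row i A).
Proof. exact: frob_rank1. Qed.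

Lemma frob_info A p (M : 'M[R]_d) :
  frob M (info A p) = \sum_i p 0 i * frob M (atom A i).
Proof. by rewrite frobC frob_suml; apply: eq_bigr => i _; rewrite frobZl frobC. Qed.

Lemma quad_atom A i (x : 'rV[R]_d) :
  frob (x *m atom A i) x = frob x (row i A) ^+ 2.
Proof.
rewrite -frob_rank1 frobC frob_atom mulmxA [row i A *m x^T]mx11_scalar.
by rewrite -trace_mx11 -/(frob _ _) mul_scalar_mx frobZl frobC -expr2 frobC.
Qed.

Lemma quad_info A p (x : 'rV[R]_d) :
  frob (x *m info A p) x = \sum_i p 0 i * frob x (row i A) ^+ 2.
Proof.
rewrite -frob_rank1 frobC frob_info; apply: eq_bigr => i _.
by rewrite frobC -quad_atom -frob_rank1 frobC.
Qed.

Lemma lev_frob A p i : lev A p i = frob (invmx (info A p)) (atom A i).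
Proof. by rewrite frob_atom /lev /frob trace_mx11. Qed.

Lemma lev_sum A p q :
  \sum_i q 0 i * lev A p i = frob (invmx (info A p)) (info A q).
Proof. by rewrite frob_info; apply: eq_bigr => i _; rewrite lev_frob. Qed.

Lemma lev_sum_self A p : posdef (info A p) -> \sum_i p 0 i * lev A p i = d%:R.
Proof.
move=> /posdef_unit pu; rewrite lev_sum /frob info_sym mulVmx//.
by rewrite mxtrace1.
Qed.

Lemma lev_le_gap A p i : lev A p i <= gap A p + d%:R.
Proof. by rewrite subrK; apply: le_bigmax. Qed.

Lemma gap_le A p r : 0 <= d%:R + r -> (forall i, lev A p i <= d%:R + r) ->
  gap A p <= r.
Proof. by move=> r0 h; rewrite lerBlDl; apply/bigmax_leP; split=> [|i _]. Qed.

Lemma sum_lev_le_gap A p q : simplex q ->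
  \sum_i q 0 i * lev A p i <= gap A p + d%:R.
Proof.
move=> [q0 q1]; rewrite -[leRHS]mul1r -[X in X * _]q1 mulr_suml.
apply: ler_sum => i _.
by rewrite ler_wpM2l// lev_le_gap.
Qed.

(** The gradient inequality at [p]: the gradient of [obj] is minus the vector of scores, and the
    scores at [p] average to [d] under [p]. *)
Lemma obj_convex A p q : posdef (info A p) -> posdef (info A q) ->
  obj A p - obj A q <= \sum_i q 0 i * lev A p i - d%:R.
Proof.
move=> pp pq; have := logdet_pair (posdef_inv pp) pq.
rewrite det_inv lnV ?posrE ?posdef_det_gt0//.
by rewrite lev_sum /frob info_sym /obj; lra.
Qed.

Lemma obj_le_gap A p q : simplex q -> posdef (info A p) -> posdef (info A q) ->
  obj A p - obj A q <= gap A p.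
Proof.
move=> sq pp pq; apply: le_trans (obj_convex pp pq) _.
by rewrite lerBlDr sum_lev_le_gap.
Qed.

Lemma atom_psd A i : psd (atom A i).
Proof.
split=> [|x]; first exact: atom_sym.
rewrite -info_delta quad_info; apply: sumr_ge0 => j _.
by rewrite mulr_ge0 ?sqr_ge0// mxE; case: andP.
Qed.

Lemma posdef_add A p i a b : 0 < a -> 0 <= b -> posdef (info A p) ->
  posdef (a *: info A p + b *: atom A i).
Proof.
move=> a0 b0 /posdef_frob[pT p0]; apply/posdef_frob; split.
  by rewrite linearD !linearZ/= atom_sym pT.
move=> x x0; rewrite mulmxDr frobDl -!scalemxAr !frobZl ltr_pwDl//.
  by rewrite mulr_gt0// p0.
by rewrite mulr_ge0//; apply: (atom_psd A i).2.
Qed.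

(* For M positive definite, a a^T <= v M with v = a^T M^-1 a. *)
Lemma posdef_sub A p i a b : 0 <= b -> b * lev A p i < a -> posdef (info A p) ->
  posdef (a *: info A p - b *: atom A i).
Proof.
move=> b0 ba pp; have pu := posdef_unit pp; have /posdef_frob[pT p0] := pp.
apply/posdef_frob; split.
  by rewrite linearB !linearZ/= atom_sym pT.
move=> x x0; rewrite mulmxBr frobDl frobNl -!scalemxAr !frobZl subr_gt0.
have xx := p0 _ x0.
have h : frob (x *m atom A i) x <= lev A p i * frob (x *m info A p) x.
  rewrite quad_atom.
  have := psd_CS (posdef_psd pp) (row i A *m invmx (info A p)) x.
  by rewrite mulmxKV// frobC [frob (row i A) _]frobC lev_frob frob_atom.
apply: le_lt_trans (_ : b * (lev A p i * frob (x *m info A p) x) < _).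
  by rewrite ler_wpM2l.
by rewrite mulrA ltr_pM2r.
Qed.

Lemma info_mulr A (V : 'M[R]_d) p : info (A *m V) p = V^T *m info A p *m V.
Proof.
rewrite /info mulmx_sumr mulmx_suml; apply: eq_bigr => i _.
by rewrite /atom row_mul trmx_mul -scalemxAr -scalemxAl !mulmxA.
Qed.

Lemma lev_mulr A (V : 'M[R]_d) p i : V \in unitmx -> info A p \in unitmx ->
  lev (A *m V) p i = lev A p i.
Proof.
move=> Vu Au; rewrite /lev info_mulr row_mul.
have VTu : V^T \in unitmx by rewrite unitmx_tr.
have -> : invmx (V^T *m info A p *m V) = invmx V *m invmx (info A p) *m invmx V^T.
  apply: (can_inj (mulmxK (_ : V^T *m info A p *m V \in unitmx))).
    by rewrite !unitmx_mul VTu Au.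
  rewrite mulVmx ?unitmx_mul ?VTu ?Au// !mulmxA mulmxKV// mulmxKV//.
  by rewrite mulVmx.
by rewrite trmx_mul !mulmxA mulmxK// mulmxKV.
Qed.

Lemma posdef_info_mulr A (V : 'M[R]_d) p : V \in unitmx ->
  posdef (info A p) -> posdef (info (A *m V) p).
Proof.
move=> Vu pp; rewrite info_mulr -{2}[V]trmxK; apply: posdef_conj => //.
by rewrite unitmx_tr.
Qed.

Lemma obj_mulr A (V : 'M[R]_d) p : V \in unitmx -> posdef (info A p) ->
  obj (A *m V) p = obj A p - ln (\det V ^+ 2).
Proof.
move=> Vu pp; rewrite /obj info_mulr !det_mulmx det_tr mulrAC -expr2 -opprD.
by rewrite lnM ?posrE ?posdef_det_gt0 1?addrC// exprn_even_gt0//= -unitfE -unitmxE.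
Qed.

Lemma combine_sum a b p (j : 'I_n) : \sum_i p 0 i = 1 ->
  \sum_i (a *: p + b *: delta_mx 0 j : 'rV[R]_n) 0 i = a + b.
Proof.
move=> p1; rewrite -[a in RHS]mulr1 -p1 -[b in RHS]mulr1 -(sum_delta_row R j).
by rewrite !mulr_sumr -big_split/=; apply: eq_bigr => i _; rewrite !mxE.
Qed.

(* Moving from the optimal p towards the vertex e_i must not decrease the
   objective; by convexity this bounds v_i at the new design q, where
   a_i^T M(q)^-1 is an explicit multiple of a_i^T M(p)^-1. *)
Lemma optimal_lev_le A p i : optimal_design A p -> (0 < d)%N -> lev A p i <= d%:R.
Proof.
move=> [sp pp opt] d0; rewrite leNgt; apply/negP => vd.
have d1 : 1 <= d%:R :> R by rewrite ler1n.
set v := lev A p i in vd.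
(* So small that the score at the new design, v / (1 - g + g v), still exceeds d: this requires d g
   (v - 1) < v - d, and here d g v is half of v - d. *)
pose g : R := (v - d%:R) / (2 * (d%:R * v)).
have v0 : 0 < v by lra.
have dv : 0 < d%:R * v by rewrite mulr_gt0// ltr0n.
have g0 : 0 < g by rewrite divr_gt0 ?subr_gt0// mulr_gt0.
have g1 : g < 1.
  have h : 0 < 2 * (d%:R * v) by rewrite mulr_gt0.
  by rewrite /g ltr_pdivrMr//; nra.
pose q := (1 - g) *: p + g *: delta_mx 0 i.
have iq : info A q = (1 - g) *: info A p + g *: atom A i.
  by rewrite linearD !linearZ/= info_delta.
have pq : posdef (info A q).
  by rewrite iq; apply: posdef_add => //; rewrite ?subr_gt0// ltW.
have sq : simplex q.
  case: sp => p0 p1; split=> [j|].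
    by rewrite !mxE addr_ge0// mulr_ge0 ?ler0n ?subr_ge0 ?(ltW g1) ?(ltW g0).
  by rewrite combine_sum//; ring.
have qu := posdef_unit pq; have pu := posdef_unit pp.
have h1 := obj_convex pq pp; have h2 := opt _ sq pq.
have h3 := lev_sum_self pq.
have h4 : \sum_j q 0 j * lev A q j =
    (1 - g) * \sum_j p 0 j * lev A q j + g * lev A q i.
  rewrite !lev_sum lev_frob -!frobZr -frobDr.
  by congr frob.
have h5 : lev A q i <= d%:R.
  have : d%:R <= \sum_j p 0 j * lev A q j by lra.
  by nra.
have h6 : lev A q i = v / (1 - g + g * v).
  have c0 : 0 < 1 - g + g * v by nra.
  rewrite /lev; have -> : row i A *m invmx (info A q) =
      (1 - g + g * v)^-1 *: (row i A *m invmx (info A p)).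
    apply: (can_inj (mulmxK qu)); rewrite mulmxKV// -scalemxAl iq mulmxDr.
    rewrite -!scalemxAr mulmxKV// /atom mulmxA.
    rewrite [row i A *m _ *m _^T]mx11_scalar -/(lev A p i) -/v mul_scalar_mx.
    rewrite scalerA -scalerDl scalerA mulVf ?scale1r//; lra.
  by rewrite -scalemxAl mxE -/(lev A p i) -/v mulrC.
have c0 : 0 < 1 - g + g * v by nra.
move: h5; rewrite h6 ler_pdivrMr// => h7.
have : g * (2 * (d%:R * v)) = v - d%:R by rewrite divfK// gt_eqF// mulr_gt0.
nra.
Qed.

End Designs.

(** * Extremal eigenvalues, on the whole space and on the sum-zero hyperplane *)

Section ExtremalEigenvalues.
Variable R : realType.

Lemma max_eigenvalue n (H : 'M[R]_n) : H^T = H -> (0 < n)%N ->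
  exists l, eigenvalue H l /\
    forall x : 'rV[R]_n, frob (x *m H) x <= l * frob x x.
Proof.
case: n H => // n H HT _.
have [|l [u [u0 uH lm]]] := @min_eigenvector R n (- H).
  by rewrite linearN/= HT.
exists (- l); split.
  apply/eigenvalueP; exists u => //.
  by rewrite scaleNr -uH mulmxN opprK.
move=> x; have := lm x; rewrite mulmxN frobNl; lra.
Qed.

(** Read the eigenvector equation at a coordinate of largest modulus. Eigenvectors are rows, hence
    the sums down the columns. *)
Lemma eigenvalue_le_row_sum n (H : 'M[R]_n) l c : eigenvalue H l ->
  (forall i j, 0 <= H i j) -> (forall j, \sum_i H i j <= c) -> l <= c.
Proof.
case: n H => [|n] H /eigenvalueP[u uH u0] H0 Hc.
  by case/negP: u0; apply/eqP/matrixP => ? [].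
pose j := [arg max_(k > 0) `|u 0 k|]%O.
have uj k : `|u 0 k| <= `|u 0 j| by rewrite /j; case: arg_maxP => // i _; apply.
have uj0 : 0 < `|u 0 j|.
  rewrite lt_def normr_ge0 andbT; apply: contra u0 => /eqP uj0; apply/eqP/rowP => k.
  by apply/eqP; rewrite mxE -normr_eq0 eq_le normr_ge0 andbT -uj0 uj.
rewrite -(ler_pM2r uj0); apply: le_trans (_ : `|l * u 0 j| <= _).
  by rewrite normrM ler_wpM2r// ler_norm.
have -> : l * u 0 j = \sum_k u 0 k * H k j.
  by have := congr1 (fun v : 'rV_n.+1 => v 0 j) uH; rewrite !mxE.
apply: le_trans (ler_norm_sum _ _ _) _.
apply: le_trans (_ : (\sum_k H k j) * `|u 0 j| <= _); last by rewrite ler_wpM2r.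
rewrite mulr_suml; apply: ler_sum => k _.
by rewrite normrM mulrC ger0_norm// ler_wpM2l.
Qed.

Lemma tangent_projE n (u : 'rV[R]_n) :
  u *m tangent_proj R n = u - const_mx (\sum_i u 0 i / n%:R).
Proof.
rewrite mulmxBr mulmx1; congr (_ - _); apply/rowP => j; rewrite !mxE.
by apply: eq_bigr => i _; rewrite mxE.
Qed.

Lemma tangent_proj_id n (u : 'rV[R]_n) :
  \sum_i u 0 i = 0 -> u *m tangent_proj R n = u.
Proof.
move=> u0; rewrite tangent_projE -mulr_suml u0 mul0r.
by apply/rowP => j; rewrite !mxE subr0.
Qed.

Lemma tangent_proj_sym n : (tangent_proj R n)^T = tangent_proj R n.
Proof. by apply/matrixP => i j; rewrite !mxE eq_sym. Qed.

Lemma tangent_eigenvalue_quad n (H : 'M[R]_n) (u : 'rV[R]_n) l :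
  \sum_i u 0 i = 0 -> u *m H *m tangent_proj R n = l *: u ->
  frob (u *m H) u = l * frob u u.
Proof.
move=> u0 uH; rewrite -frobZl -uH [RHS]frob_mulr tangent_proj_sym.
by rewrite tangent_proj_id.
Qed.

(* A large multiple of the projection onto the constants pushes the normal
   direction away from the bottom of the spectrum. *)
Lemma tangent_min_eigenvalue n (H : 'M[R]_n) : H^T = H -> (1 < n)%N ->
  exists l, tangent_eigenvalue H l /\
    forall x : 'rV[R]_n, \sum_i x 0 i = 0 -> l * frob x x <= frob (x *m H) x.
Proof.
case: n H => [|[|n]] // H HT _; set P := tangent_proj R n.+2.
pose J : 'M[R]_n.+2 := const_mx (n.+2%:R^-1).
have PE : P = 1%:M - J by [].
have JT : J^T = J by apply/matrixP => i j; rewrite !mxE.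
have PT : P^T = P by exact: tangent_proj_sym.
have n0 : n.+2%:R != 0 :> R by rewrite pnatr_eq0.
have uJ (u : 'rV[R]_n.+2) : u *m J = const_mx (\sum_i u 0 i / n.+2%:R).
  apply/rowP => j; rewrite !mxE.
  by apply: eq_bigr => i _; rewrite mxE.
have JJ : J *m J = J.
  apply/matrixP => i j; rewrite !mxE (eq_bigr (fun=> n.+2%:R^-1 / n.+2%:R)).
    by rewrite sumr_const card_ord -[_ *+ _]mulr_natr divfK.
  by move=> k _; rewrite !mxE.
have PJ : P *m J = 0 by rewrite PE mulmxBl mul1mx JJ subrr.
pose e : 'rV[R]_n.+2 := delta_mx 0 0 - delta_mx 0 1.
have e0 : e != 0.
  by apply/eqP => /rowP/(_ 0); rewrite !mxE/= subr0 => /eqP; rewrite oner_eq0.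
have es : \sum_i e 0 i = 0.
  rewrite (eq_bigr (fun i => (delta_mx 0 0 : 'rV[R]_n.+2) 0 i -
     (delta_mx 0 1 : 'rV[R]_n.+2) 0 i)); last by move=> i _; rewrite !mxE.
  by rewrite sumrB !sum_delta_row subrr.
pose c := frob (e *m H) e / frob e e + 1.
pose K := P *m H *m P + c *: J.
have KT : K^T = K by rewrite linearD linearZ/= !trmx_mul PT HT JT mulmxA.
have Kq (x : 'rV[R]_n.+2) : \sum_i x 0 i = 0 -> frob (x *m K) x = frob (x *m H) x.
  move=> x0; have xP : x *m P = x by exact: tangent_proj_id.
  rewrite mulmxDr -scalemxAr uJ -mulr_suml x0 mul0r !mulmxA xP.
  rewrite frobDl frob_mulr PT xP (_ : const_mx 0 = 0) ?scaler0 ?frob0l ?addr0//.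
have [l [u [u0 uK lm]]] := min_eigenvector KT.
have lc : l < c.
  have := lm e; rewrite Kq// -ler_pdivlMr ?frob_gt0// => h.
  by rewrite /c; lra.
have uJ0 : u *m J = 0.
  have := congr1 (mulmx^~ J) uK => /=.
  rewrite /K mulmxDr mulmxDl !mulmxA -[_ *m P *m J]mulmxA PJ mulmx0 add0r.
  rewrite -scalemxAr -!scalemxAl -mulmxA JJ => /eqP.
  by rewrite -subr_eq0 -scalerBl scaler_eq0 subr_eq0 gt_eqF//= => /eqP.
have us : \sum_i u 0 i = 0.
  move: uJ0; rewrite uJ -mulr_suml => /rowP/(_ 0); rewrite !mxE => /eqP.
  by rewrite mulf_eq0 invr_eq0 (negPf n0) orbF => /eqP.
exists l; split; last by move=> x xs; rewrite -Kq.
exists u; split=> //; rewrite -uK /K mulmxDr -scalemxAr uJ0 scaler0 addr0 !mulmxA.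
by rewrite (_ : u *m P = u)//; apply: tangent_proj_id.
Qed.

End ExtremalEigenvalues.

Lemma simplex_le1 (R : realType) (n : nat) (p : 'rV[R]_n) i : simplex p -> p 0 i <= 1.
Proof.
by move=> [p0 <-]; rewrite (bigD1 i)//= lerDl; apply: sumr_ge0 => j _.
Qed.

(** All mass on one row would make the information matrix of rank at most one. This keeps the
    maximal away step finite and forces at least two active rows. *)
Lemma posdef_weight_lt1 (R : realType) (n d : nat) (A : 'M[R]_(n, d)) p i :
  (1 < d)%N -> simplex p -> posdef (info A p) -> p 0 i < 1.
Proof.
move=> d1 sp pp; rewrite lt_neqAle simplex_le1// andbT; apply/eqP => pi1.
have [p0 p1] := sp.
have : \sum_(j | j != i) p 0 j == 0.
  by move: p1; rewrite (bigD1 i)//= pi1 => h; apply/eqP; lra.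
rewrite psumr_eq0// => /allP pj.
have iA : info A p = atom A i.
  rewrite /info (bigD1 i)//= pi1 scale1r big1 ?addr0// => j ji.
  by have := pj j (mem_index_enum j); rewrite ji => /eqP ->; rewrite scale0r.
have := posdef_unit pp; rewrite -row_full_unit iA /row_full /atom.
move=> /eqP rd; have := mxrankM_maxl (row i A)^T (row i A).
by rewrite rd => h; have := leq_trans h (rank_leq_col _); rewrite leqNgt d1.
Qed.

(** * Local geometry at the optimum *)

Definition whitened (R : realType) (n d : nat) (A : 'M[R]_(n, d)) (ps : 'rV[R]_n) :
  'M[R]_(n, d) := A *m inv_sqrtmx (info A ps).

(* Squared norm of M(q) in the local metric at ps; whitening turns it into a
   Frobenius norm. *)
Definition locsq (R : realType) (n d : nat) (A : 'M[R]_(n, d)) (ps q : 'rV[R]_n) : R :=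
  frob (info (whitened A ps) q) (info (whitened A ps) q).

Section LocalGeometry.
Variables (R : realType) (n d : nat) (A : 'M[R]_(n, d)) (ps : 'rV[R]_n).
Hypothesis d_gt1 : (1 < d)%N.
Hypothesis opt : optimal_design A ps.
Hypothesis nondeg : nondegenerate_design A ps.

Let W := inv_sqrtmx (info A ps).
Let B := whitened A ps.
Let S := Sstar A ps.
Implicit Types (p q : 'rV[R]_n) (u : 'rV[R]_#|S|).

Lemma opt_simplex : simplex ps. Proof. by case: opt. Qed.
Lemma opt_posdef : posdef (info A ps). Proof. by case: opt. Qed.

Lemma dR_gt1 : 1 < d%:R :> R. Proof. by rewrite ltr1n. Qed.

Lemma isqrt_posdef : posdef W. Proof. by case: (inv_sqrtmxP opt_posdef). Qed.

Lemma isqrt_sqr : W *m W = invmx (info A ps).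
Proof. by case: (inv_sqrtmxP opt_posdef). Qed.

Lemma isqrt_sym : W^T = W. Proof. by case: isqrt_posdef. Qed.

Lemma isqrt_unit : W \in unitmx. Proof. exact/posdef_unit/isqrt_posdef. Qed.

Lemma info_whitened q : info B q = W *m info A q *m W.
Proof. by rewrite info_mulr isqrt_sym. Qed.

Lemma info_whitened_opt : info B ps = 1%:M.
Proof.
have Wu := isqrt_unit; have pu := posdef_unit opt_posdef.
apply: (can_inj (mulmxK Wu)); rewrite info_whitened mul1mx -!mulmxA isqrt_sqr.
by rewrite mulmxV// mulmx1.
Qed.

Lemma local_norm_info q : local_norm (info A ps) (info A q) = Num.sqrt (locsq A ps q).
Proof. by rewrite /local_norm -/W -info_whitened fnormE. Qed.

Lemma locsq_ge0 q : 0 <= locsq A ps q. Proof. exact: frob_ge0. Qed.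

Lemma lev_whitened p i : posdef (info A p) -> lev B p i = lev A p i.
Proof. by move=> /posdef_unit; apply: lev_mulr; exact: isqrt_unit. Qed.

Lemma posdef_whitened p : posdef (info A p) <-> posdef (info B p).
Proof.
split=> h; first exact: posdef_info_mulr isqrt_unit h.
have Wu := isqrt_unit.
have -> : info A p = invmx W *m info B p *m (invmx W)^T.
  by rewrite trmx_inv isqrt_sym info_whitened !mulmxA mulVmx// mul1mx mulmxK.
by apply: posdef_conj h _; rewrite unitmx_inv.
Qed.

Lemma lev_opt i : lev A ps i = frob (row i B) (row i B).
Proof.
rewrite -lev_whitened; last exact: opt_posdef.
by rewrite lev_frob info_whitened_opt invmx1 frob_atom mulmx1.
Qed.

Lemma lev_opt_le i : lev A ps i <= d%:R.
Proof. by apply: (optimal_lev_le i opt); apply: ltnW. Qed.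

Lemma lev_optS i : i \in S -> lev A ps i = d%:R.
Proof. by rewrite inE => /eqP. Qed.

Lemma supp_opt i : (ps 0 i != 0) = (i \in S).
Proof. by case: nondeg. Qed.

Lemma gamma_gt0 : 0 < gamma_sc A ps.
Proof. by case: nondeg. Qed.

Lemma lev_opt_notS i : i \notin S -> lev A ps i <= d%:R - gamma_sc A ps.
Proof.
move=> iS; rewrite lerBrDr addrC -lerBrDr /gamma_sc.
exact: bigmin_le_cond.
Qed.

Lemma opt_gt0 i : i \in S -> 0 < ps 0 i.
Proof. by rewrite -supp_opt => pi; rewrite lt_def pi; case: opt_simplex => ->. Qed.

Lemma opt_notS i : i \notin S -> ps 0 i = 0.
Proof. by rewrite -supp_opt negbK => /eqP. Qed.

Lemma pmin_le i : i \in S -> pmin A ps <= ps 0 i.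
Proof. by move=> iS; exact: bigmin_le_cond. Qed.

Lemma pmin_gt0 : 0 < pmin A ps.
Proof. by rewrite /pmin; apply/bigmin_gtP; split=> // i; exact: opt_gt0. Qed.

Lemma exists_in_S : exists i, i \in S.
Proof.
have [//|h] := pselect (exists i, i \in S); exfalso.
have {}h i : i \notin S by apply/negP => iS; apply: h; exists i.
have [_] := opt_simplex; rewrite big1 => [/eqP|i _]; last exact/opt_notS/h.
by rewrite eq_sym oner_eq0.
Qed.

Lemma card_S_gt1 : (1 < #|S|)%N.
Proof.
have [i iS] := exists_in_S; rewrite ltnNge; apply/negP => S1.
have Si j : j != i -> ps 0 j = 0.
  move=> ji; apply: opt_notS; apply: contra ji => jS; apply/eqP.
  by move/card_le1_eqP: S1; apply.
have [_] := opt_simplex; rewrite (bigD1 i)//= big1 => [|j /Si//].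
have := posdef_weight_lt1 i d_gt1 opt_simplex opt_posdef.
by rewrite addr0 => /[swap] ->; rewrite ltxx.
Qed.

Lemma sum_S (F : 'I_n -> R) : (forall i, i \notin S -> F i = 0) ->
  \sum_i F i = \sum_(j < #|S|) F (enum_val j).
Proof.
move=> F0; rewrite -(big_enum_val F) [RHS]big_mkcond/=.
by apply: eq_bigr => i _; case: ifPn => // /F0.
Qed.

(** [Hhat] is indexed by ordinals below the cardinal of the active set, designs by all rows; [restr]
    and [extend] translate between the two. *)
Definition restr (q : 'rV[R]_n) : 'rV[R]_#|S| := \row_j q 0 (enum_val j).
Definition extend (u : 'rV[R]_#|S|) : 'rV[R]_n :=
  \sum_j u 0 j *: delta_mx 0 (enum_val j).

Lemma extend_notS u i : i \notin S -> extend u 0 i = 0.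
Proof.
move=> iS; rewrite summxE big1// => j _; rewrite !mxE eqxx/=.
by case: eqP iS => [->|]; rewrite ?enum_valP ?mulr0.
Qed.

Lemma extendK u : restr (extend u) = u.
Proof.
apply/rowP => j; rewrite mxE summxE (bigD1 j)//= big1 ?addr0.
  by rewrite !mxE !eqxx mulr1.
move=> k kj; rewrite !mxE eqxx/= (_ : _ == _ = false) ?mulr0//.
by apply: negbTE; apply: contra kj => /eqP/enum_val_inj ->.
Qed.

Lemma Hhat_frob i j : Hhat A ps i j =
  frob (row (enum_val i) B) (row (enum_val j) B) ^+ 2.
Proof.
rewrite mxE; congr (_ ^+ 2); rewrite /frob trace_mx11 !row_mul trmx_mul isqrt_sym.
by rewrite -/W !mulmxA -[_ *m W *m W]mulmxA isqrt_sqr.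
Qed.

Lemma Hhat_sym : (Hhat A ps)^T = Hhat A ps.
Proof. by apply/matrixP => i j; rewrite mxE !Hhat_frob frobC. Qed.

Lemma frob_atoms i j : frob (atom B i) (atom B j) = frob (row i B) (row j B) ^+ 2.
Proof. by rewrite frob_atom quad_atom frobC. Qed.

Lemma Hhat_quad q : (forall i, i \notin S -> q 0 i = 0) ->
  frob (restr q *m Hhat A ps) (restr q) = locsq A ps q.
Proof.
move=> q0; rewrite /locsq -/B frob_info sum_S => [|i /q0 ->]; last by rewrite mul0r.
rewrite frob_rowE; apply: eq_bigr => j _.
rewrite [(restr q *m _) _ _]mxE [restr q 0 j]mxE mulrC; congr (_ * _).
rewrite frobC frob_info sum_S => [|i /q0 ->]; last by rewrite mul0r.
by apply: eq_bigr => k _; rewrite Hhat_frob [restr q 0 k]mxE frobC frob_atoms.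
Qed.

Lemma frob_restr q : (forall i, i \notin S -> q 0 i = 0) ->
  frob (restr q) (restr q) = frob q q.
Proof.
move=> q0; rewrite [RHS]frob_rowE sum_S => [|i /q0 ->]; last by rewrite mul0r.
by rewrite frob_rowE; apply: eq_bigr => j _; rewrite !mxE.
Qed.

Lemma sum_restr q : (forall i, i \notin S -> q 0 i = 0) ->
  \sum_j restr q 0 j = \sum_i q 0 i.
Proof. by move=> q0; rewrite [RHS]sum_S//; apply: eq_bigr => j _; rewrite !mxE. Qed.

Lemma mu_star_tangent : tangent_eigenvalue (Hhat A ps) (mu_star A ps).
Proof.
have [l [lH lm]] := tangent_min_eigenvalue Hhat_sym card_S_gt1.
suff -> : mu_star A ps = l by [].
have ll l' : tangent_eigenvalue (Hhat A ps) l' -> l <= l'.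
  move=> [u [u0 us uH]]; have := lm u us.
  by rewrite (tangent_eigenvalue_quad us uH) ler_pM2r// frob_gt0.
apply/eqP; rewrite eq_le; apply/andP; split.
  by apply: ge_inf => //; exists l => x /ll.
by apply: lb_le_inf; [exists l|move=> x /ll].
Qed.

Lemma mu_star_le q : (forall i, i \notin S -> q 0 i = 0) -> \sum_i q 0 i = 0 ->
  mu_star A ps * frob q q <= locsq A ps q.
Proof.
move=> qS q0; have [l [lH lm]] := tangent_min_eigenvalue Hhat_sym card_S_gt1.
rewrite -frob_restr// -Hhat_quad//; apply: le_trans (lm _ _); last by rewrite sum_restr.
rewrite ler_wpM2r ?frob_ge0//; apply: ge_inf => //; exists 0 => l' [u [u0 us uH]].
have := tangent_eigenvalue_quad us uH.
rewrite -(extendK u) Hhat_quad; last exact: extend_notS.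
move=> h; have := locsq_ge0 (extend u); rewrite h extendK pmulr_lge0//.
exact: frob_gt0.
Qed.

(** The weighted sum is the quadratic form of the whitened information matrix at [ps], which is the
    identity, at a whitened active row, whose squared norm is its score [d]. *)
Lemma row_sum_Hhat j : \sum_i Hhat A ps i j * ps 0 (enum_val i) = d%:R.
Proof.
have jS := enum_valP j; rewrite -(lev_optS jS) lev_opt.
rewrite -[X in _ = frob X _]mulmx1 -info_whitened_opt quad_info sum_S.
  by apply: eq_bigr => i _; rewrite Hhat_frob mulrC frobC.
by move=> i /opt_notS ->; rewrite mul0r.
Qed.

Lemma Hhat_ge0 i j : 0 <= Hhat A ps i j.
Proof. by rewrite Hhat_frob sqr_ge0. Qed.

Lemma Hhat_le i j : Hhat A ps i j <= d%:R ^+ 2.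
Proof.
rewrite Hhat_frob (le_trans (frob_CS _ _))// expr2.
by rewrite -!lev_opt !lev_optS ?enum_valP.
Qed.

(** In the column sums weighted by [ps] every weight is at least [pmin]. The bound also makes the
    set of eigenvalues bounded, so that the supremum [L_star] is meaningful. *)
Lemma eigenvalue_Hhat_pmin l : eigenvalue (Hhat A ps) l -> l <= d%:R / pmin A ps.
Proof.
move=> /eigenvalue_le_row_sum; apply=> [|j]; first exact: Hhat_ge0.
rewrite ler_pdivlMr ?pmin_gt0// -(row_sum_Hhat j) mulr_suml; apply: ler_sum => i _.
by rewrite ler_wpM2l ?Hhat_ge0// pmin_le// enum_valP.
Qed.

Lemma L_star_ub l : eigenvalue (Hhat A ps) l -> l <= L_star A ps.
Proof.
by move=> hl; apply: ub_le_sup => //; exists (d%:R / pmin A ps) => x /eigenvalue_Hhat_pmin.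
Qed.

Lemma L_star_eigen_ub c : (forall l, eigenvalue (Hhat A ps) l -> l <= c) ->
  L_star A ps <= c.
Proof.
move=> h; have [l [lH _]] := max_eigenvalue Hhat_sym (ltnW card_S_gt1).
by apply: ge_sup => [|x /h//]; exists l.
Qed.

Lemma L_star_pmin : L_star A ps * pmin A ps <= d%:R.
Proof.
rewrite -ler_pdivlMr ?pmin_gt0//; apply: L_star_eigen_ub; exact: eigenvalue_Hhat_pmin.
Qed.

Lemma L_star_card : L_star A ps <= #|S|%:R * d%:R ^+ 2.
Proof.
apply: L_star_eigen_ub => l /eigenvalue_le_row_sum; apply=> [|j].
  exact: Hhat_ge0.
apply: le_trans (ler_sum _ (fun i _ => Hhat_le i j)) _.
by rewrite sumr_const card_ord -[leLHS]mulr_natl.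
Qed.

Lemma L_star_ge q : (forall i, i \notin S -> q 0 i = 0) ->
  locsq A ps q <= L_star A ps * frob q q.
Proof.
move=> qS; have [l [lH lm]] := max_eigenvalue Hhat_sym (ltnW card_S_gt1).
rewrite -frob_restr// -Hhat_quad//; apply: le_trans (lm _) _.
by rewrite ler_wpM2r ?frob_ge0// L_star_ub.
Qed.

Lemma mu_le_L : mu_star A ps <= L_star A ps.
Proof.
have [u [u0 us uH]] := mu_star_tangent.
have uS := @extend_notS u.
have := mu_star_le uS; rewrite -sum_restr// extendK => /(_ us) h.
have := le_trans h (L_star_ge uS); rewrite ler_pM2r//.
by rewrite -frob_restr// extendK frob_gt0.
Qed.

End LocalGeometry.

(** * Faces and vertices of the design polytope *)

Section Polytope.
Variables (R : realType) (n d : nat) (A : 'M[R]_(n, d)).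
Let P := design_polytope A.
Implicit Types (w p q : 'rV[R]_n) (C X : 'M[R]_d).

Lemma design_polytopeP X : P X <-> exists w, simplex w /\ X = info A w.
Proof.
split=> [[m [w [z [w0 w1 zA ->]]]]|[w [[w0 w1] ->]]]; last first.
  by exists n, (w 0), (atom A); split=> // j; exists j.
have zj j : exists i, atom A i = z j by case: (zA j) => i _ e; exists i.
have [s sE] := choice zj.
pose v : 'rV[R]_n := \row_i \sum_(j | s j == i) w j.
exists v; split.
  split=> [i|]; first by rewrite mxE; apply: sumr_ge0 => j _.
  rewrite (eq_bigr (fun i => \sum_(j | s j == i) w j)) => [|i _]; last by rewrite mxE.
  by rewrite -w1 [RHS](partition_big s predT).
rewrite /info (partition_big s predT)//=; apply: eq_bigr => i _.
rewrite mxE scaler_suml; apply: eq_bigr => j /eqP <-.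
by rewrite sE.
Qed.

Lemma is_faceP F : is_face P F <-> exists C b,
  (forall i, frob (atom A i) C <= b) /\ F = [set X | P X /\ frob X C = b]%classic.
Proof.
have tE C X : \tr (C^T *m X) = frob X C by rewrite /frob mxtrace_mulC.
split=> -[C [b [h ->]]]; exists C, b; split.
- move=> i; rewrite -tE; apply: h; apply/design_polytopeP; exists (delta_mx 0 i).
  rewrite info_delta; split=> //; split=> [j|]; first by rewrite mxE ler0n.
  exact: sum_delta_row.
- by apply/seteqP; split=> X /=; rewrite tE.
- move=> X /design_polytopeP[w [[w0 w1] ->]]; rewrite tE frobC frob_info.
  rewrite -[leRHS]mul1r -[X in X * _]w1 mulr_suml; apply: ler_sum => i _.
  by rewrite ler_wpM2l// frobC.
- by apply/seteqP; split=> X /=; rewrite tE.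
Qed.

Lemma atom_in_polytope i : P (atom A i).
Proof.
exists 1%N, (fun=> 1), (fun=> atom A i).
by split=> //; [rewrite big_ord1|rewrite big_ord1 scale1r].
Qed.

Lemma face_support C b w : simplex w -> (forall i, frob (atom A i) C <= b) ->
  frob (info A w) C = b <-> forall i, 0 < w 0 i -> frob (atom A i) C = b.
Proof.
move=> [w0 w1] Cb; rewrite frobC frob_info.
have e : \sum_i w 0 i * (b - frob (atom A i) C) =
    b - \sum_i w 0 i * frob C (atom A i).
  rewrite -[b in RHS]mul1r -[X in X * b]w1 mulr_suml -sumrB.
  by apply: eq_bigr => i _; rewrite mulrBr [frob C _]frobC.
have -> : (\sum_i w 0 i * frob C (atom A i) = b) <->
    \sum_i w 0 i * (b - frob (atom A i) C) = 0.
  by rewrite e; split=> [->|/eqP]; [exact: subrr|rewrite subr_eq0 => /eqP ->].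
have t0 i : 0 <= w 0 i * (b - frob (atom A i) C) by rewrite mulr_ge0// subr_ge0.
split=> [/eqP|h].
  rewrite psumr_eq0// => /allP h i wi; have := h i (mem_index_enum i).
  by rewrite mulf_eq0 gt_eqF//= subr_eq0 => /eqP.
apply: big1 => i _; have := w0 i; rewrite le_eqVlt => /orP[/eqP <-|/h ->].
  by rewrite mul0r.
by rewrite subrr mulr0.
Qed.

(* Maximize C1, and C2 to break ties, by one functional K C1 + C2. *)
Lemma lexicographic_functional C1 b1 C2 b2 :
  (forall i, frob (atom A i) C1 <= b1) ->
  (forall i, frob (atom A i) C1 = b1 -> frob (atom A i) C2 <= b2) ->
  exists C b, (forall i, frob (atom A i) C <= b) /\
    forall i, frob (atom A i) C = b <->
      frob (atom A i) C1 = b1 /\ frob (atom A i) C2 = b2.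
Proof.
move=> h1 h2.
pose K := 1 + \sum_i `|frob (atom A i) C2 - b2| / (b1 - frob (atom A i) C1).
have tK0 i : 0 <= `|frob (atom A i) C2 - b2| / (b1 - frob (atom A i) C1).
  by rewrite divr_ge0// subr_ge0.
have Klt i : frob (atom A i) C1 != b1 ->
    frob (atom A i) C2 - b2 < K * (b1 - frob (atom A i) C1).
  move=> ne; have lt : 0 < b1 - frob (atom A i) C1 by rewrite subr_gt0 lt_neqAle ne h1.
  rewrite -ltr_pdivrMr//; apply: le_lt_trans (_ : _ <=
    `|frob (atom A i) C2 - b2| / (b1 - frob (atom A i) C1)) _.
    by rewrite ler_pM2r ?invr_gt0// ler_norm.
  rewrite /K (bigD1 i)//=; apply: ltr_pwDl => //; rewrite lerDl.
  by apply: sumr_ge0.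
have CE i : frob (atom A i) (K *: C1 + C2) =
    K * frob (atom A i) C1 + frob (atom A i) C2 by rewrite frobDr frobZr.
exists (K *: C1 + C2), (K * b1 + b2); split=> i; rewrite CE.
  have [e|/Klt] := eqVneq (frob (atom A i) C1) b1; last by rewrite mulrBr; lra.
  by rewrite e lerD2l h2.
have [e|ne] := eqVneq (frob (atom A i) C1) b1.
  by rewrite e; split=> [h|[_ ->]//]; split=> //; lra.
split=> [h|[e _]]; last by rewrite e eqxx in ne.
exfalso; by have := Klt _ ne; rewrite mulrBr; lra.
Qed.

Lemma face_of_functional C b : (forall i, frob (atom A i) C <= b) ->
  is_face P [set X | P X /\ frob X C = b]%classic.
Proof. by move=> h; apply/is_faceP; exists C, b. Qed.

(** The last hypothesis compares atoms rather than indices, since rows equal up to sign have the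
    same atom. *)
Lemma vertex_of_functional C b i : (forall j, frob (atom A j) C <= b) ->
  frob (atom A i) C = b ->
  (forall j, frob (atom A j) C = b -> atom A j = atom A i) ->
  vertices P (atom A i).
Proof.
move=> h hi hj; rewrite /vertices/=.
have -> : [set atom A i]%classic = [set X | P X /\ frob X C = b]%classic.
  apply/seteqP; split=> X /=.
    by move=> ->; split=> //; exact: atom_in_polytope.
  move=> [+ +]; move=> /design_polytopeP[w [sw ->]] /(face_support sw h) ws.
  have [w0 w1] := sw; rewrite /info -[RHS]scale1r -w1 scaler_suml.
  apply: eq_bigr => j _; have := w0 j; rewrite le_eqVlt => /orP[/eqP <-|/ws/hj ->//].
  by rewrite !scale0r.
exact: face_of_functional.
Qed.

Lemma vertex_is_atom X : vertices P X -> exists i, X = atom A i.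
Proof.
move=> /is_faceP[C [b [h XE]]].
have : [set X]%classic X by [].
rewrite XE => -[/design_polytopeP[w [sw Xw]] Xb].
have [w0 w1] := sw.
have [i wi] : exists i, 0 < w 0 i.
  have [//|no] := pselect (exists i, 0 < w 0 i); exfalso.
  have : \sum_i w 0 i = 0.
    apply: big1 => i _; apply/eqP; rewrite eq_le w0 andbT leNgt; apply/negP => wi.
    by apply: no; exists i.
  by rewrite w1 => /eqP; rewrite oner_eq0.
exists i; have : [set X]%classic (atom A i).
  rewrite XE; split; first exact: atom_in_polytope.
  by rewrite Xw in Xb; move/(face_support sw h): Xb; apply.
by move=> /= ->.
Qed.

(* Among the atoms on which C is minimal, one of largest Frobenius norm is an
   exposed point. *)
Lemma vertex_off_face F : is_face P F -> F <> P ->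
  exists X, vertices P X /\ ~ F X.
Proof.
move=> /is_faceP[C [b [h FE]]] FP.
have [i0 hi0] : exists i, frob (atom A i) C < b.
  have [//|no] := pselect (exists i, frob (atom A i) C < b); exfalso; apply: FP.
  rewrite FE; apply/seteqP; split=> X /=; first by case.
  move=> PX; split=> //; have /design_polytopeP[w [sw ->]] := PX.
  apply/(face_support sw h) => i _; apply/eqP; rewrite eq_le h leNgt.
  by apply/negP => hi; apply: no; exists i.
have [i1 _ i1m] := @Order.TotalTheory.arg_minP _ _ _ i0 predT
  (fun i => frob (atom A i) C) isT.
pose m := frob (atom A i1) C; pose Q i := frob (atom A i) C == m.
have Qi1 : Q i1 by exact: eqxx.
have [i2 /eqP Qi2 i2m] := @Order.TotalTheory.arg_maxP _ _ _ i1 Q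
  (fun i => frob (atom A i) (atom A i)) Qi1.
pose b2 := frob (atom A i2) (atom A i2).
have CSi i : Q i -> frob (atom A i) (atom A i2) <= b2.
  move=> /i2m hi; rewrite -[b2]ger0_norm ?frob_ge0//.
  apply: le_trans (ler_norm _) _; rewrite -ler_sqr ?nnegrE ?normr_ge0//.
  rewrite !real_normK ?num_real// (le_trans (frob_CS _ _))// expr2.
  by rewrite ler_wpM2r// frob_ge0.
have [||C' [b' [h' e']]] := @lexicographic_functional (- C) (- m) (atom A i2) b2.
- by move=> i; rewrite frobNr lerN2; exact: i1m.
- by move=> i; rewrite frobNr => /oppr_inj e; apply: CSi; apply/eqP.
exists (atom A i2); split.
  apply: (vertex_of_functional h').
    by apply/e'; rewrite frobNr Qi2.
  move=> j /e'[]; rewrite frobNr => /oppr_inj /eqP Qj jb; apply/eqP.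
  rewrite -subr_eq0 -frob_eq0 eq_le frob_ge0 andbT.
  rewrite !(frobDl, frobDr, frobNl, frobNr) [frob (atom A i2) (atom A j)]frobC jb.
  have h2 : frob (atom A j) (atom A j) <= b2 := i2m _ Qj.
  rewrite -/b2 in jb *. lra.
rewrite FE => -[_ e]; have := i1m i0 isT.
by rewrite -[X in X <= _]Qi2 e leNgt hi0.
Qed.

End Polytope.

(** * Positivity of the facial distance and its bound on [mu_star] *)

Section FacialDistance.
Variables (R : realType) (n d : nat) (A : 'M[R]_(n, d)) (ps : 'rV[R]_n).
Hypothesis d_gt1 : (1 < d)%N.
Hypothesis opt : optimal_design A ps.
Hypothesis nondeg : nondegenerate_design A ps.

Let W := inv_sqrtmx (info A ps).
Let S := Sstar A ps.
Let P := design_polytope A.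
Let M := info A ps.
Implicit Types (w p q : 'rV[R]_n) (C X Y : 'M[R]_d).

Lemma frob_le_local_norm C X :
  frob X C <= Num.sqrt (frob (invmx W *m C *m invmx W) (invmx W *m C *m invmx W))
    * local_norm M X.
Proof.
have Wu := isqrt_unit opt; have WT := isqrt_sym opt.
have -> : frob X C = frob (W *m X *m W) (invmx W *m C *m invmx W).
  rewrite frob_mulr WT -!mulmxA mulVmx// mulmx1 frob_mull WT !mulmxA mulmxV//.
  by rewrite mul1mx.
rewrite /local_norm fnormE -sqrtrM ?frob_ge0// mulrC.
apply: le_trans (ler_norm _) _.
by rewrite -sqrtr_sqr ler_wsqrtr// mulrC [leRHS]mulrC frob_CS.
Qed.

Lemma conv_hull_functional_le (V : set 'M[R]_d) C b X :
  (forall Z, V Z -> frob Z C <= b) -> conv_hull V X -> frob X C <= b.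
Proof.
move=> h [m [w [z [w0 w1 zV ->]]]]; rewrite frob_suml.
rewrite -[leRHS]mul1r -[X in X * b]w1 mulr_suml; apply: ler_sum => i _.
by rewrite frobZl ler_wpM2l// h.
Qed.

Lemma sub_conv_hull (V : set 'M[R]_d) X : V X -> conv_hull V X.
Proof.
move=> VX; exists 1%N, (fun=> 1), (fun=> X).
by split=> //; [rewrite big_ord1|rewrite big_ord1 scale1r].
Qed.

Lemma local_dist_lb F G : has_lbound
  [set r : R | exists X Y, [/\ F X, G Y & r = local_norm M (X - Y)]]%classic.
Proof. by exists 0 => _ [X [Y [_ _ ->]]]; exact: sqrtr_ge0. Qed.

Lemma local_dist_le F G X Y : F X -> G Y -> local_dist M F G <= local_norm M (X - Y).
Proof. by move=> FX GY; apply: ge_inf; [exact: local_dist_lb|exists X, Y]. Qed.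

Lemma local_dist_ge0 F G : 0 <= local_dist M F G.
Proof.
have [h|h] := pselect ([set r : R | exists X Y,
    [/\ F X, G Y & r = local_norm M (X - Y)]] !=set0)%classic.
  by apply: lb_le_inf => // _ [X [Y [_ _ ->]]]; exact: sqrtr_ge0.
rewrite /local_dist inf_out// => -[h0 _]; exact: h.
Qed.

(** The functional that cuts out [F] equals [b] on it and, there being finitely many atoms, stays
    below [b - dl] at every vertex off [F]. Being Lipschitz in the local norm, it turns this gap
    into a distance. *)
Lemma face_dist_gt0 F : proper_face P F ->
  0 < local_dist M F (conv_hull (vertices P `\` F)).
Proof.
move=> [fF [X0 FX0] FP]; have [Y0 [vY0 nFY0]] := vertex_off_face fF FP.
have /is_faceP[C [b [h FE]]] := fF.
pose dl := \big[Num.min/1]_(i | frob (atom A i) C < b) (b - frob (atom A i) C).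
have dl0 : 0 < dl by apply/bigmin_gtP; split=> // i; rewrite subr_gt0.
pose K := Num.sqrt (frob (invmx W *m C *m invmx W) (invmx W *m C *m invmx W)) + 1.
have K0 : 0 < K by rewrite ltr_wpDl ?sqrtr_ge0.
apply: lt_le_trans (_ : dl / K <= _); first by rewrite divr_gt0.
(* The infimum of the empty set is 0, so a point of the face and a vertex off it have to be
   exhibited. *)
apply: lb_le_inf.
  by exists (local_norm M (X0 - Y0)), X0, Y0; split=> //; exact: sub_conv_hull.
move=> _ [X [Y [FX GY ->]]].
have XC : frob X C = b by move: FX; rewrite FE => -[].
have YC : frob Y C <= b - dl.
  apply: conv_hull_functional_le GY => Z [vZ nFZ].
  have [i Zi] := vertex_is_atom vZ; rewrite Zi.
  have lt : frob (atom A i) C < b.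
    rewrite lt_neqAle h andbT; apply/eqP => e; apply: nFZ; rewrite FE Zi.
    by split=> //; exact: atom_in_polytope.
  rewrite lerBrDr addrC -lerBrDr.
  exact: (bigmin_le_cond _ (fun i => b - frob (atom A i) C)).
have := frob_le_local_norm C (X - Y); rewrite frobDl frobNl XC => h2.
rewrite ler_pdivrMr// mulrC /K mulrDl mul1r.
have : 0 <= local_norm M (X - Y) by exact: sqrtr_ge0.
by lra.
Qed.

(* Linear independence of the active atoms prescribes the values of a linear
   functional on them, so every subset of them is exposed by the KKT functional
   together with a tie-breaking one. *)
Lemma active_face (I : {set 'I_n}) : I \subset S -> exists C b,
  (forall i, frob (atom A i) C <= b) /\
  forall i, frob (atom A i) C = b <-> i \in I.
Proof.
move=> IS; have [_ _ fr] := nondeg.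
set X := [seq atom A i | i <- enum S] in fr.
have sX : size X = #|S| by rewrite size_map -cardE.
pose phi (Z : 'M[R]_d) : R := \sum_(k < size X)
  (if nth false [seq i \in I | i <- enum S] k then coord (in_tuple X) k Z else 0).
(* Represents, through [frob], the sum of the dual coordinates of the atoms in [I]. *)
pose C2 : 'M[R]_d := \matrix_(i, j) phi (delta_mx i j).
have phiE Z : frob Z C2 = phi Z.
  rewrite frobE {2}[Z]matrix_sum_delta /phi.
  under eq_bigr => i _ do under eq_bigr => j _ do rewrite mxE /phi mulr_sumr.
  under eq_bigr => i _ do rewrite exchange_big/=.
  rewrite exchange_big/=; apply: eq_bigr => k _.
  case: ifP => _; last by rewrite big1// => i _; rewrite big1// => j _; rewrite mulr0.
  rewrite linear_sum/=; apply: eq_bigr => i _; rewrite linear_sum/=.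
  by apply: eq_bigr => j _; rewrite linearZ.
have C2E i : i \in S -> frob (atom A i) C2 = (i \in I)%:R.
  move=> iS; have ie : i \in enum S by rewrite mem_enum.
  have ki : (index i (enum S) < size X)%N by rewrite size_map index_mem.
  have ai : atom A i = (in_tuple X)`_(Ordinal ki).
    by rewrite /= (nth_map i) ?index_mem// nth_index.
  have cX k : coord (in_tuple X) k (atom A i) = (Ordinal ki == k)%:R.
    by rewrite ai coord_free.
  rewrite phiE /phi (bigD1 (Ordinal ki))//= big1 ?addr0.
    rewrite cX eqxx (nth_map i) ?index_mem// nth_index//.
    by case: (i \in I).
  by move=> k kN; case: ifP => // _; rewrite cX eq_sym (negPf kN).
have C1E i : frob (atom A i) (invmx M) = lev A ps i by rewrite frobC lev_frob.
have [||C [b [h e]]] := @lexicographic_functional R n d A (invmx M) d%:R C2 1.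
- by move=> i; rewrite C1E; exact: lev_opt_le.
- move=> i; rewrite C1E => vi; rewrite C2E; first by case: (i \in I).
  by rewrite inE vi.
exists C, b; split=> // i; rewrite e C1E; split=> [[vi]|iI].
  rewrite C2E; last by rewrite inE vi.
  by case: (i \in I) => // /eqP; rewrite eq_sym oner_eq0.
have iS : i \in S by exact: (fintype.subsetP IS).
by rewrite C2E// iI lev_optS.
Qed.

Lemma active_face_support (I : {set 'I_n}) C b w : simplex w ->
  (forall i, frob (atom A i) C <= b) ->
  (forall i, frob (atom A i) C = b <-> i \in I) ->
  frob (info A w) C = b <-> face_simplex I w.
Proof.
move=> sw h e; rewrite (face_support sw h); have [w0 w1] := sw; split=> [wI|[_ wI] i wi].
  split=> // i iI; have := w0 i; rewrite le_eqVlt => /orP[/eqP//|/wI/e].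
  by rewrite (negPf iI).
by apply/e; apply: contraLR wi => /wI ->; rewrite ltxx.
Qed.

Lemma active_atom_vertex i : i \in S -> vertices P (atom A i).
Proof.
move=> iS; have [|C [b [h e]]] := @active_face [set i]%SET.
  by rewrite finset.sub1set.
apply: (vertex_of_functional h); first by apply/e; rewrite inE.
by move=> j /e; rewrite inE => /eqP ->.
Qed.

Lemma face_eq_conv F : is_face P F -> exists J : {set 'I_n},
  F = [set X | exists w, face_simplex J w /\ X = info A w]%classic.
Proof.
move=> /is_faceP[C [b [h ->]]]; exists [set i | frob (atom A i) C == b]%SET.
have e i : frob (atom A i) C = b <-> i \in [set i | frob (atom A i) C == b]%SET.
  by rewrite inE; split=> /eqP.
apply/seteqP; split=> X /=.
  move=> [/design_polytopeP[w [sw ->]] /(active_face_support sw h e) fw].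
  by exists w.
move=> [w [fw ->]]; have [sw _] := fw; split.
  by apply/design_polytopeP; exists w.
exact/(active_face_support sw h e).
Qed.

Lemma active_proper_face (I : {set 'I_n}) i j : I \subset S -> i \in I ->
  j \in S -> j \notin I -> exists F, [/\ proper_face P F,
    forall w, face_simplex I w -> F (info A w) &
    forall k, k \in S -> k \notin I -> (vertices P `\` F)%classic (atom A k)].
Proof.
move=> IS iI jS jI; have [C [b [h e]]] := active_face IS.
have nF k : k \notin I -> ~ [set X | P X /\ frob X C = b]%classic (atom A k).
  by move=> kI [_ /e]; rewrite (negPf kI).
exists [set X | P X /\ frob X C = b]%classic; split.
- split; first exact: face_of_functional.
    by exists (atom A i); split; [exact: atom_in_polytope|apply/e].
  by move=> FP; apply: (nF _ jI); rewrite FP; exact: atom_in_polytope.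
- move=> w fw; have [sw _] := fw; split; first by apply/design_polytopeP; exists w.
  exact/(active_face_support sw h e).
- by move=> k kS kI; split; [exact: active_atom_vertex|exact: nF].
Qed.

Lemma facial_distance_le F : proper_face P F ->
  facial_distance A ps <= local_dist M F (conv_hull (vertices P `\` F)).
Proof.
move=> pF; apply: ge_inf; last by exists F.
by exists 0 => _ [G [_ ->]]; exact: local_dist_ge0.
Qed.

(** A face consists of the designs supported on some index set, so only finitely many distances
    occur; the least positive one bounds the infimum. *)
Lemma facial_distance_gt0 : 0 < facial_distance A ps.
Proof.
pose cv (J : {set 'I_n}) := [set X | exists w, face_simplex J w /\ X = info A w]%classic.
pose h J := local_dist M (cv J) (conv_hull (vertices P `\` cv J)).
pose beta : R := \big[Num.min/1]_(J | 0 < h J) h J.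
have b0 : 0 < beta by apply/bigmin_gtP.
apply: lt_le_trans b0 _; apply: lb_le_inf => /=.
  (* Some proper face must exist, or the infimum would be that of the empty set; one of two active
     atoms provides it. *)
  have [i [j [iS jS ij]]] : exists i j, [/\ i \in S, j \in S & i != j].
    have /card_gt1P[i [j [iS jS ij]]] := card_S_gt1 d_gt1 opt nondeg.
    by exists i, j.
  have [||||F [pF _ _]] := @active_proper_face [set i]%SET i j.
  - by rewrite finset.sub1set.
  - by rewrite inE.
  - by [].
  - by rewrite inE eq_sym.
  by exists (local_dist M F (conv_hull (vertices P `\` F))), F.
move=> _ [F [pF ->]]; have d0 := face_dist_gt0 pF.
have [fF _ _] := pF; have [J FJ] := face_eq_conv fF.
by rewrite FJ -/(cv J) in d0 *; exact: bigmin_le_cond.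
Qed.

(* The positive and negative parts of a tangent vector, normalized, are points
   of a face and of the convex hull of the other active vertices. *)
Lemma mu_star_facial : facial_distance A ps ^+ 2 / 4 <= mu_star A ps.
Proof.
have [u [u0 us uH]] := mu_star_tangent d_gt1 opt nondeg.
pose q := extend u; have qS := @extend_notS _ _ _ _ _ u.
have qu : restr A ps q = u by exact: extendK.
have qs : \sum_i q 0 i = 0 by rewrite -(sum_restr qS) qu.
have q_neq0 : q != 0.
  apply/eqP => q0; case/negP: u0; apply/eqP; rewrite -qu q0.
  by apply/rowP => j; rewrite !mxE.
have := tangent_eigenvalue_quad us uH.
rewrite -qu (Hhat_quad opt qS) (frob_restr qS) => muq.
pose qp : 'rV[R]_n := \row_i Num.max (q 0 i) 0.
pose qm : 'rV[R]_n := \row_i Num.max (- q 0 i) 0.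
have qpm : q = qp - qm.
  apply/rowP => i; rewrite !mxE; have /orP[q0|q0] := le_total 0 (q 0 i).
    by rewrite max_l// max_r ?oppr_le0// subr0.
  by rewrite max_r// max_l ?oppr_ge0// sub0r opprK.
pose t := \sum_i qp 0 i.
have tm : t = \sum_i qm 0 i.
  apply/eqP; rewrite -subr_eq0 -sumrB -[X in _ == X]qs; apply/eqP.
  by apply: eq_bigr => i _; rewrite [in RHS]qpm [in RHS]mxE [(- qm) _ _]mxE.
have qp0 i : 0 <= qp 0 i by rewrite mxE le_max lexx orbT.
have qm0 i : 0 <= qm 0 i by rewrite mxE le_max lexx orbT.
have qabs i : `|q 0 i| = qp 0 i + qm 0 i.
  rewrite !mxE; have /orP[q0|q0] := le_total 0 (q 0 i).
    by rewrite ger0_norm// max_l// max_r ?oppr_le0// addr0.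
  by rewrite ler0_norm// max_r// max_l ?oppr_ge0// add0r.
(* The Euclidean norm is at most the sum of absolute values, which is [2 * t]; hence the factor
   4. *)
have qq : frob q q <= (2 * t) ^+ 2.
  have -> : 2 * t = \sum_i `|q 0 i|.
    rewrite (eq_bigr (fun i => qp 0 i + qm 0 i)) => [|i _]; last exact: qabs.
    by rewrite big_split/= -tm -/t; ring.
  rewrite frob_rowE expr2 mulr_suml; apply: ler_sum => i _.
  rewrite -[q 0 i * q 0 i]ger0_norm -?expr2 ?sqr_ge0// normrX expr2.
  rewrite ler_wpM2l// (bigD1 i)//= lerDl; exact: sumr_ge0.
have qq0 := frob_gt0 q_neq0.
have t0 : 0 < t.
  rewrite lt_def sumr_ge0// andbT; apply/eqP => t0.
  by move: qq; rewrite t0 mulr0 expr0n leNgt qq0.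
pose I := [set i | 0 < q 0 i]%SET.
have supp (v : 'rV[R]_n) (J : {set 'I_n}) : (forall i, 0 <= v 0 i) -> \sum_i v 0 i = t ->
    (forall i, i \notin J -> v 0 i = 0) -> face_simplex J (t^-1 *: v).
  move=> v0 vt vJ; split; first split=> [i|].
  - by rewrite mxE mulr_ge0// invr_ge0 ltW.
  - rewrite (eq_bigr (fun i => t^-1 * v 0 i)) => [|i _]; last by rewrite mxE.
    by rewrite -mulr_sumr vt mulVf// gt_eqF.
  - by move=> i /vJ vi; rewrite mxE vi mulr0.
have fp : face_simplex I (t^-1 *: qp).
  apply: supp => // i; rewrite inE -leNgt mxE => qi.
  by rewrite max_r.
have fm : face_simplex (S :\: I)%SET (t^-1 *: qm).
  apply: supp => // i; rewrite !inE negb_and negbK mxE => /orP[qi|iS].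
    by rewrite max_r// oppr_le0 ltW.
  by rewrite qS ?inE// oppr0 max_r.
have IS : I \subset S.
  by apply/fintype.subsetP => i; rewrite inE; apply: contraLR => /qS ->; rewrite ltxx.
have ex (J : {set 'I_n}) (v : 'rV[R]_n) : face_simplex J v -> exists i, i \in J.
  move=> [[v0 v1] vJ]; have [//|no] := pselect (exists i, i \in J); exfalso.
  have : \sum_i v 0 i = 0.
    by apply: big1 => i _; apply: vJ; apply/negP => iJ; apply: no; exists i.
  by rewrite v1 => /eqP; rewrite oner_eq0.
have [i iI] := ex _ _ fp; have [j jI] := ex _ _ fm.
move: (jI); rewrite inE => /andP[jnI jS].
have [F [pF FI FV]] := active_proper_face IS iI jS jnI.
have h1 : facial_distance A ps <= local_norm M (info A (t^-1 *: qp) - info A (t^-1 *: qm)).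
  apply: le_trans (facial_distance_le pF) _; apply: local_dist_le; first exact: FI.
  have [[m0 m1] mI] := fm.
  exists #|(S :\: I)%SET|, (fun k => (t^-1 *: qm) 0 (enum_val k)),
    (fun k => atom A (enum_val k)); split=> [//||k|].
  - rewrite -m1 -(big_enum_val (fun i => (t^-1 *: qm) 0 i)) big_mkcond/=.
    by apply: eq_bigr => k _; case: ifPn => // /mI.
  - by have := enum_valP k; rewrite inE => /andP[kI kS]; apply: FV.
  - rewrite -(big_enum_val (fun i => (t^-1 *: qm) 0 i *: atom A i)) [RHS]big_mkcond/=.
    by apply: eq_bigr => k _; case: ifPn => // /mI ->; rewrite scale0r.
have tq : info A (t^-1 *: qp) - info A (t^-1 *: qm) = info A (t^-1 *: q).
  by rewrite -linearB -scalerBr -qpm.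
rewrite tq (local_norm_info opt) in h1.
have Phi0 := facial_distance_gt0.
have h2 : facial_distance A ps ^+ 2 <= locsq A ps (t^-1 *: q).
  rewrite -[leRHS]sqr_sqrtr ?locsq_ge0// ler_sqr ?nnegrE ?sqrtr_ge0//.
  exact: ltW.
have tt : locsq A ps (t^-1 *: q) = t ^- 2 * (mu_star A ps * frob q q).
  by rewrite /locsq linearZ/= frobZl frobZr -/(locsq A ps q) muq mulrA -exprVn expr2.
rewrite tt mulrC ler_pdivlMr ?exprn_gt0// in h2.
have mu0 : 0 <= mu_star A ps.
  rewrite -(pmulr_lge0 _ qq0) -muq; exact: locsq_ge0.
have t2 : 0 < t ^+ 2 by rewrite exprn_gt0.
rewrite ler_pdivrMr// -(ler_pM2r t2); apply: le_trans h2 _.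
apply: le_trans (ler_wpM2l mu0 qq) _.
by rewrite exprMn; lra.
Qed.

End FacialDistance.

(** * Size of the active set and the facial bound on [kappa] *)

Lemma card_ordered_pairs d :
  #|[set p : 'I_d * 'I_d | (p.1 <= p.2)%N]%SET| = 'C(d.+1, 2).
Proof.
transitivity (\sum_(i < d) \sum_(j < d) if (i <= j)%N then 1 else 0)%N.
  rewrite pair_bigA/= -sum1_card big_mkcond/=.
  by apply: eq_bigr => p _; rewrite inE.
rewrite exchange_big/= -bin2_sum big_mkord big_ord_recl add0n.
apply: eq_bigr => j _.
rewrite -big_mkcond/=; have <- := @big_ord_widen _ 0%N addn j.+1 d (fun=> 1%N) (ltn_ord j).
by rewrite sum_nat_const card_ord muln1.
Qed.

(** The matrices [E i j] with i <= j span the symmetric ones: a symmetric matrix is half the sum of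
    the [Z i j *: E i j]. *)
Lemma free_sym_size (R : realType) (d : nat) (X : seq 'M[R]_d) : free X ->
  (forall Z, Z \in X -> Z^T = Z) -> (size X <= 'C(d.+1, 2))%N.
Proof.
move=> fX XT.
pose E (i j : 'I_d) : 'M[R]_d := delta_mx i j + delta_mx j i.
pose s := [seq E p.1 p.2 | p <- enum [set p : 'I_d * 'I_d | (p.1 <= p.2)%N]%SET].
have Es i j : E i j \in <<s>>%VS.
  wlog ij : i j / (i <= j)%N.
    move=> h; have [/h//|/ltnW/h] := leqP i j.
    by rewrite /E addrC.
  apply: memv_span; apply/mapP; exists (i, j) => //.
  by rewrite mem_enum inE.
have Xs : (<<X>> <= <<s>>)%VS.
  apply/span_subvP => Z /XT ZT.
  have -> : Z = 2^-1 *: \sum_i \sum_j Z i j *: E i j.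
    under eq_bigr => i _ do under eq_bigr => j _ do rewrite scalerDr.
    under eq_bigr => i _ do rewrite big_split/=.
    rewrite big_split/= -matrix_sum_delta exchange_big/=.
    have -> : \sum_j \sum_i Z i j *: delta_mx j i = Z :> 'M[R]_d.
      rewrite [RHS]matrix_sum_delta; apply: eq_bigr => j _; apply: eq_bigr => i _.
      by rewrite -[in RHS]ZT mxE.
    by rewrite -mulr2n -scaler_nat scalerA mulVf ?scale1r// pnatr_eq0.
  by apply: memvZ; do 2 (apply: memv_suml => ? _); apply: memvZ.
move/eqP: fX => <-; apply: leq_trans (dimvS Xs) _.
apply: leq_trans (dim_span _) _; by rewrite size_map -cardE card_ordered_pairs.
Qed.

Section ConditionNumbers.
Variables (R : realType) (n d : nat) (A : 'M[R]_(n, d)) (ps : 'rV[R]_n).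
Hypothesis d_gt1 : (1 < d)%N.
Hypothesis opt : optimal_design A ps.
Hypothesis nondeg : nondegenerate_design A ps.

Let Phi := facial_distance A ps.

Lemma card_S_le : (#|Sstar A ps| <= 'C(d.+1, 2))%N.
Proof.
have [_ _ fr] := nondeg; have := free_sym_size fr; rewrite size_map -cardE; apply.
by move=> Z /mapP[i _ ->]; exact: atom_sym.
Qed.

Lemma mu_gt0 : 0 < mu_star A ps.
Proof.
apply: lt_le_trans (mu_star_facial d_gt1 opt nondeg).
by rewrite divr_gt0// exprn_gt0// facial_distance_gt0.
Qed.

Lemma L_gt0 : 0 < L_star A ps.
Proof. exact: lt_le_trans mu_gt0 (mu_le_L d_gt1 opt nondeg). Qed.

Lemma kappa_ge1 : 1 <= kappa A ps.
Proof. by rewrite ler_pdivlMr ?mu_gt0// mul1r mu_le_L. Qed.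

Lemma kappa_facial :
  kappa A ps <= 4 * 'C(d.+1, 2)%:R * d%:R ^+ 2 / Phi ^+ 2.
Proof.
have Phi0 : 0 < Phi by exact: facial_distance_gt0.
have m0 := mu_gt0; have hm := mu_star_facial d_gt1 opt nondeg.
rewrite ler_pdivrMr// mulrAC ler_pdivlMr ?exprn_gt0//.
have hL : L_star A ps <= 'C(d.+1, 2)%:R * d%:R ^+ 2.
  apply: le_trans (L_star_card d_gt1 opt nondeg) _.
  by rewrite ler_wpM2r ?sqr_ge0// ler_nat card_S_le.
apply: le_trans (ler_wpM2r (sqr_ge0 _) hL) _.
have hm' : Phi ^+ 2 <= 4 * mu_star A ps by move: hm; rewrite -/Phi; lra.
apply: le_trans (ler_wpM2l _ hm') _; first by rewrite mulr_ge0 ?sqr_ge0.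
by rewrite le_eqVlt; apply/orP; left; apply/eqP; ring.
Qed.

End ConditionNumbers.

(** * Away-step Frank-Wolfe and the setup phase *)

Section AwaySteps.
Variables (R : realType) (n d : nat) (A : 'M[R]_(n, d)).
Hypothesis d_gt1 : (1 < d)%N.
Implicit Types p : 'rV[R]_n.

Lemma volumetric_simplex p : volumetric_init A p -> simplex p.
Proof.
move=> [B [hi [lo [_ _ pE _]]]]; set J := (_ :|: _)%SET in pE.
have J0 : #|J|%:R != 0 :> R.
  rewrite pnatr_eq0 -lt0n; apply/card_gt0P; exists (hi (Ordinal (ltnW d_gt1))).
  by rewrite inE imset_f// inE.
split=> [i|]; first by rewrite pE mxE; case: ifP => // _; rewrite invr_ge0.
rewrite (eq_bigr (fun i => if i \in J then #|J|%:R^-1 else 0)); last first.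
  by move=> i _; rewrite pE mxE.
by rewrite -big_mkcond/= sumr_const -[LHS]mulr_natr mulVf.
Qed.

Lemma lev_max_ge p j : simplex p -> posdef (info A p) ->
  (forall i, lev A p i <= lev A p j) -> d%:R <= lev A p j.
Proof.
move=> [p0 p1] pp h; rewrite -(lev_sum_self pp) -[leRHS]mul1r -[X in X * _]p1 mulr_suml.
by apply: ler_sum => i _; rewrite ler_wpM2l.
Qed.

Lemma afw_step_feasible p p' : simplex p -> posdef (info A p) ->
  afw_step A p p' -> simplex p' /\ posdef (info A p').
Proof.
move=> sp pp [jp [jm [hp pm hm ->]]]; have [p0 p1] := sp.
have d1 : 1 < d%:R :> R by rewrite ltr1n.
have vp := lev_max_ge sp pp hp; have pm1 := posdef_weight_lt1 jm d_gt1 sp pp.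
cbv zeta; case: ifPn => [_|]; last rewrite -ltNge => lt.
  set v := lev A p jp in vp *; set g := _ / _.
  have dv : 0 < d%:R * (v - 1) by rewrite mulr_gt0; lra.
  have g0 : 0 <= g by rewrite divr_ge0 ?subr_ge0// ltW.
  have g1 : g < 1 by rewrite /g ltr_pdivrMr//; nra.
  split.
    split; last by rewrite combine_sum//; ring.
    move=> i; rewrite !mxE addr_ge0// mulr_ge0 ?ler0n//.
    by rewrite subr_ge0 ltW.
  by rewrite linearD !linearZ/= info_delta; apply: posdef_add; rewrite ?subr_gt0.
set v := lev A p jm in lt *; set gm := p 0 jm / _; set g := if _ then _ else _.
have gm0 : 0 < gm by rewrite divr_gt0// subr_gt0.
have gm1 : gm * (1 - p 0 jm) = p 0 jm by rewrite divfK// gt_eqF// subr_gt0.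
have ggm : g <= gm by rewrite /g; case: ifP => // _; rewrite ge_min lexx orbT.
(* This is g v < 1 + g, the condition under which subtracting [g] times the atom keeps the matrix
   positive definite, even when the weight drops to 0. *)
have [g0 gv] : 0 <= g /\ g * (v - 1) < 1.
  rewrite /g; case: ltP => v1; last by split; [exact: ltW|nra].
  have dv : 0 < d%:R * (v - 1) by rewrite mulr_gt0; lra.
  have q0 : 0 <= (d%:R - v) / (d%:R * (v - 1)).
    by rewrite divr_ge0 ?(ltW dv)//; lra.
  split; first by rewrite le_min q0 ltW.
  apply: le_lt_trans (_ : (d%:R - v) / (d%:R * (v - 1)) * (v - 1) < _).
    by rewrite ler_wpM2r ?ge_min ?lexx//; lra.
  rewrite mulrAC ltr_pdivrMr// mul1r mulrDl; nra.
rewrite -scaleNr; split.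
  split; last by rewrite combine_sum//; ring.
  move=> i; rewrite !mxE eqxx/=; have [->|ij] := eqVneq i jm; last first.
    by rewrite mulr0 addr0 mulr_ge0// addr_ge0.
  rewrite mulr1; have : 0 < 1 - p 0 jm by rewrite subr_gt0.
  nra.
rewrite linearD !linearZ/= info_delta scaleNr; apply: posdef_sub => //.
by rewrite -/v; lra.
Qed.

Lemma afw_run_feasible (p : nat -> 'rV[R]_n) k : afw_run A p ->
  simplex (p k) /\ posdef (info A (p k)).
Proof.
move=> [p0 pS]; elim: k => [|k [sp pp]]; last exact: afw_step_feasible (pS k).
by split; [exact: volumetric_simplex|case: p0 => B [hi [lo []]]].
Qed.

End AwaySteps.

(** * Closeness to the optimum and exit of the setup phase *)

Section Setup.
Variables (R : realType) (n d : nat) (A : 'M[R]_(n, d)) (ps : 'rV[R]_n).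
Hypothesis d_gt1 : (1 < d)%N.
Hypothesis opt : optimal_design A ps.
Hypothesis nondeg : nondegenerate_design A ps.

Let S := Sstar A ps.
Let B := whitened A ps.
Implicit Types p q : 'rV[R]_n.

Lemma whitened_sub p : info B p - 1%:M = info B (p - ps).
Proof. by rewrite linearB/= info_whitened_opt. Qed.

Lemma obj_gain p : simplex p -> posdef (info A p) ->
  sc_gain (Num.sqrt (locsq A ps (p - ps))) <= obj A p - obj A ps.
Proof.
move=> [p0 p1] pp; have Wu := isqrt_unit opt.
have := logdet_gain ((posdef_whitened opt p).1 pp).
rewrite whitened_sub -/(locsq A ps (p - ps)) => /le_trans; apply.
have -> : \tr (info B p) = \sum_i p 0 i * lev A ps i.
  rewrite (eq_bigr (fun i => p 0 i * lev B ps i)) => [|i _]; last first.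
    by rewrite lev_whitened//; exact: opt_posdef.
  by rewrite lev_sum info_whitened_opt// invmx1 /frob mul1mx info_sym.
have h : \sum_i p 0 i * lev A ps i <= d%:R.
  rewrite -[leRHS]mul1r -[X in X * _]p1 mulr_suml; apply: ler_sum => i _.
  by rewrite ler_wpM2l// lev_opt_le.
have e1 := obj_mulr Wu pp; have e2 := obj_mulr Wu (opt_posdef opt).
rewrite -/(whitened A ps) in e1 e2; rewrite -/B /obj info_whitened_opt// det1 ln1 in e1 e2.
by rewrite /obj; lra.
Qed.

Lemma lev_near p i r : 0 <= r < 1 -> posdef (info A p) -> locsq A ps (p - ps) <= r ^+ 2 ->
  lev A ps i / (1 + r) <= lev A p i <= lev A ps i / (1 - r).
Proof.
move=> /andP[r0 r1] pp hr; have pB := (posdef_whitened opt p).1 pp.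
rewrite (lev_opt opt) -(lev_whitened opt i pp) lev_frob frob_atom.
have hE (y : 'rV[R]_d) := @near_id_quad R d (info B p) r y r0.
rewrite whitened_sub -/(locsq A ps (p - ps)) in hE.
apply/andP; split.
  by apply: inv_quad_ge => // [|y]; [lra|case/andP: (hE y hr)].
by apply: inv_quad_le => // [|y]; [lra|case/andP: (hE y hr)].
Qed.

Lemma rbar_gt0 : 0 < rbar A ps.
Proof.
rewrite !lt_min invr_gt0 ltr0n/= divr_gt0 ?gamma_gt0//=; last first.
  by rewrite mulr_gt0// ltr0n ltnW.
by rewrite !mulr_gt0 ?invr_gt0 ?sqrtr_gt0 ?pmin_gt0 ?mu_gt0.
Qed.

Lemma rbar_le_half : rbar A ps <= 2^-1.
Proof. by rewrite ge_min lexx. Qed.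

Lemma rbar_le_gamma : rbar A ps * (2 * d%:R) <= gamma_sc A ps.
Proof.
rewrite -ler_pdivlMr; last by rewrite mulr_gt0// ltr0n ltnW.
by rewrite !ge_min lexx orbT.
Qed.

Lemma rbar_le_pmin : rbar A ps <= 2^-1 * pmin A ps * Num.sqrt (mu_star A ps).
Proof. by rewrite !ge_min lexx !orbT. Qed.

Lemma c0_gt0 : 0 < cst_c0 A ps.
Proof.
have := rbar_gt0; have := rbar_le_half => h1 h0.
apply: lt_le_trans (sc_gain_ge_sqr _); first by rewrite divr_gt0// exprn_gt0.
by rewrite (ltW h0).
Qed.

Lemma c_gt0 : 0 < cst_c A ps.
Proof.
rewrite lt_min c0_gt0/= divr_gt0// exprn_gt0 ?invr_gt0//.
exact: lt_le_trans ltr01 (kappa_ge1 d_gt1 opt nondeg).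
Qed.

Lemma gamma_le_d : gamma_sc A ps <= d%:R.
Proof. exact: bigmin_le_id. Qed.

(** The gap dominates the objective gap, and [cst_c0] is [sc_gain] at [rbar], so monotonicity bounds
    the local distance by [rbar]. As [rbar] is at most 1/2, the quadratic lower bound on [sc_gain]
    then applies as well. *)
Lemma near_opt p : simplex p -> posdef (info A p) -> gap A p <= cst_c A ps ->
  [/\ obj A p - obj A ps <= cst_c A ps, locsq A ps (p - ps) <= rbar A ps ^+ 2 &
      locsq A ps (p - ps) <= 3 * cst_c A ps].
Proof.
move=> sp pp gc; have oc : obj A p - obj A ps <= cst_c A ps.
  by apply: le_trans (obj_le_gap _ pp (opt_posdef opt)) gc; case: opt.
set s := Num.sqrt (locsq A ps (p - ps)).
have sc := le_trans (obj_gain sp pp) oc.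
have s0 : 0 <= s by exact: sqrtr_ge0.
have sr : s <= rbar A ps.
  apply: sc_gain_inj_le rbar_gt0 s0 _; apply: le_trans sc _.
  by rewrite ge_min lexx.
have sE : locsq A ps (p - ps) = s ^+ 2 by rewrite sqr_sqrtr// locsq_ge0.
split=> //; first by rewrite sE ler_sqr ?nnegrE// ltW// rbar_gt0.
have : s ^+ 2 / 3 <= sc_gain s.
  by apply: sc_gain_ge_sqr; rewrite s0 (le_trans sr)// rbar_le_half.
by move=> h3; have := le_trans h3 sc; rewrite sE; lra.
Qed.

(** Since [rbar] times [d] is at most half of [gamma_sc], the perturbation of the scores cannot
    carry them across the midpoint between active and inactive ones, which is the threshold of the
    setup loop. *)
Lemma near_opt_lev p i : posdef (info A p) -> locsq A ps (p - ps) <= rbar A ps ^+ 2 ->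
  if i \in S then d%:R - gamma_sc A ps / 2 <= lev A p i
  else lev A p i < d%:R - gamma_sc A ps / 2.
Proof.
move=> pp hr; have r0 := rbar_gt0; have r1 := rbar_le_half; have rg := rbar_le_gamma.
have g0 := gamma_gt0 nondeg; have gd := gamma_le_d; have d1 := dR_gt1 R d_gt1.
have r01 : 0 <= rbar A ps < 1 by apply/andP; split; [exact: ltW|lra].
have /andP[lo up] := lev_near i r01 pp hr.
set r := rbar A ps in r0 r1 rg r01 lo up *.
case: ifPn => iS.
  rewrite (lev_optS iS) in lo; apply: le_trans lo.
  rewrite ler_pdivlMr; last by lra.
  nra.
have vi := lev_opt_notS iS.
apply: le_lt_trans up _; rewrite ltr_pdivrMr; last by lra.
nra.
Qed.

Lemma near_opt_coord q i : (forall j, j \notin S -> q 0 j = 0) -> \sum_j q 0 j = 0 ->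
  mu_star A ps * q 0 i ^+ 2 <= locsq A ps q.
Proof.
move=> qS q0; apply: le_trans (mu_star_le d_gt1 opt nondeg qS q0).
rewrite ler_wpM2l ?(ltW (mu_gt0 d_gt1 opt nondeg))//.
rewrite frob_rowE (bigD1 i)//= -expr2 lerDl; apply: sumr_ge0 => j _.
by rewrite -expr2 sqr_ge0.
Qed.

Lemma sub_opt_sum p : simplex p -> \sum_i (p - ps) 0 i = 0.
Proof.
move=> [_ p1]; have [_ ps1] := opt_simplex opt.
rewrite (eq_bigr (fun i => p 0 i - ps 0 i)) => [|i _]; last by rewrite !mxE.
by rewrite sumrB p1 ps1 subrr.
Qed.

Lemma sub_opt_notS p : (forall i, i \notin S -> p 0 i = 0) ->
  forall i, i \notin S -> (p - ps) 0 i = 0.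
Proof. by move=> pS i iS; rewrite !mxE pS// (opt_notS nondeg iS) subrr. Qed.

(** A coordinate is at most the local norm divided by the square root of [mu_star]; the third term
    of [rbar] is made for this. *)
Lemma rbar_coord q i : (forall j, j \notin S -> q 0 j = 0) -> \sum_j q 0 j = 0 ->
  locsq A ps q <= rbar A ps ^+ 2 -> `|q 0 i| <= pmin A ps / 2.
Proof.
move=> qS q0 hr; have m0 := mu_gt0 d_gt1 opt nondeg; have r0 := rbar_gt0.
have h := le_trans (near_opt_coord i qS q0) hr.
have h2 : rbar A ps ^+ 2 <= (2^-1 * pmin A ps * Num.sqrt (mu_star A ps)) ^+ 2.
  by rewrite ler_sqr ?nnegrE ?(ltW r0)// ?rbar_le_pmin// (le_trans (ltW r0))// rbar_le_pmin.
have := le_trans h h2; rewrite exprMn sqr_sqrtr ?(ltW m0)// mulrC ler_pM2r// => h3.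
have p0 := pmin_gt0 opt nondeg.
by rewrite -ler_sqr ?nnegrE ?divr_ge0 ?(ltW p0)// real_normK ?num_real// [pmin _ _ / 2]mulrC.
Qed.

(** The second loop test removes inactive rows from the support; the distance bound keeps every
    active weight at least half of [pmin]. *)
Lemma setup_stop_support p : simplex p -> posdef (info A p) ->
  ~ setup_continue A ps p ->
  (forall i, (p 0 i != 0) = (i \in S)) /\ gap A p <= cst_c A ps.
Proof.
move=> sp pp stop.
have gc : gap A p <= cst_c A ps.
  by rewrite leNgt; apply/negP => gc; apply: stop; left.
have [_ hr _] := near_opt sp pp gc.
have pS i : i \notin S -> p 0 i = 0.
  move=> iS; have [p0 _] := sp; apply/eqP; rewrite eq_le p0 andbT leNgt.
  apply/negP => pi; apply: stop; right; exists i; split=> //.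
  by have := near_opt_lev i pp hr; rewrite (negPf iS).
split=> // i; have [iS|/pS ->] := boolP (i \in S); last by rewrite eqxx.
have := rbar_coord i (sub_opt_notS pS) (sub_opt_sum sp) hr.
rewrite !mxE ler_norml => /andP[h _].
have := pmin_le iS; have := pmin_gt0 opt nondeg => h1 h2.
by rewrite gt_eqF//; lra.
Qed.

Lemma setup_stop_criterion p : simplex p -> posdef (info A p) ->
  gap A p <= cst_c A ps -> (forall i, p 0 i != 0 -> i \in S) ->
  ~ setup_continue A ps p.
Proof.
move=> sp pp gc pS [|[i [pi]]]; first by rewrite ltNge gc.
have [_ hr _] := near_opt sp pp gc; have := near_opt_lev i pp hr.
by rewrite pS ?gt_eqF// ltNge => ->.
Qed.

(** The guarantees are needed only to make the loop test fail at index [C_setup]. The exit is the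
    first failure, and there support and gap follow from the failed test itself. *)
Lemma setup_exits (p : nat -> 'rV[R]_n) muR Kid Kgap CZ : afw_run A p ->
  afw_guarantees A ps muR p Kid Kgap CZ ->
  exists k0, [/\ setup_exit A ps p k0, (k0 <= C_setup A ps Kid Kgap)%N,
    forall i, (p k0 0 i != 0) = (i \in S) & gap A (p k0) <= cst_c A ps].
Proof.
move=> run [hgap _ hid]; set CA := C_setup A ps Kid Kgap.
have stopCA : ~ setup_continue A ps (p CA).
  have [sp pp] := afw_run_feasible d_gt1 CA run.
  apply: setup_stop_criterion => //; last by apply: hid; exact: leq_maxl.
  have d0 : 0 < d%:R :> R by rewrite ltr0n ltnW.
  have := hgap (cst_c A ps / d%:R); rewrite divr_gt0 ?c_gt0// => /(_ isT CA).
  by rewrite divfK ?gt_eqF//; apply; exact: leq_maxr.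
have ex : exists k, `[< ~ setup_continue A ps (p k) >] by exists CA; apply/asboolP.
have [k0 /asboolP stop km] := ex_minnP ex.
have [sp pp] := afw_run_feasible d_gt1 k0 run.
have [ps0 gc] := setup_stop_support sp pp stop.
exists k0; split=> //; last by apply: km; apply/asboolP.
split=> // k kk0; apply: contrapT => h.
by have := km k (asboolT h); rewrite leqNgt kk0.
Qed.

End Setup.

(** * The accelerated phase *)

Section AcceleratedPhase.
Variables (R : realType) (n d : nat) (A : 'M[R]_(n, d)) (ps : 'rV[R]_n).
Hypothesis d_gt1 : (1 < d)%N.
Hypothesis opt : optimal_design A ps.
Hypothesis nondeg : nondegenerate_design A ps.

Let S := Sstar A ps.
Let B := whitened A ps.
Let Ls := L_star A ps.
Let L := L_loc A ps.
Implicit Types p q x y z : 'rV[R]_n.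

Lemma L_star_gt0 : 0 < Ls. Proof. exact: L_gt0. Qed.

Lemma L_loc_gt0 : 0 < L. Proof. by rewrite mulr_gt0// L_star_gt0. Qed.

(** Without sign conditions, since extrapolation could leave the simplex; positivity is recovered
    from the ball. *)
Definition affine_face y := (forall i, i \notin S -> y 0 i = 0) /\ \sum_i y 0 i = 1.

Definition face_ball (D : R) y := affine_face y /\ frob (y - ps) (y - ps) <= D.

Lemma affine_tangent y z : affine_face y -> affine_face z ->
  (forall i, i \notin S -> (y - z) 0 i = 0) /\ \sum_i (y - z) 0 i = 0.
Proof.
move=> [yS y1] [zS z1]; split=> [i iS|]; first by rewrite !mxE yS// zS// subrr.
rewrite (eq_bigr (fun i => y 0 i - z 0 i)) => [|i _]; last by rewrite !mxE.
by rewrite sumrB y1 z1 subrr.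
Qed.

Lemma row_combE a x y i : (x + a *: y) 0 i = x 0 i + a * y 0 i.
Proof. by rewrite !mxE. Qed.

Lemma affine_opt : affine_face ps.
Proof. by split; [exact: opt_notS|case: (opt_simplex opt)]. Qed.

Lemma affine_comb a x y : affine_face x -> affine_face y ->
  affine_face (x + a *: (y - x)).
Proof.
move=> fx fy; have [h0 h1] := affine_tangent fy fx; have [xS x1] := fx.
split=> [i iS|]; first by rewrite row_combE h0// xS// mulr0 addr0.
rewrite (eq_bigr (fun i => x 0 i + a * (y - x) 0 i)) => [|i _]; last exact: row_combE.
by rewrite big_split/= -mulr_sumr h1 mulr0 addr0.
Qed.

Lemma face_ball_conv D a x y : 0 <= a <= 1 -> face_ball D x -> face_ball D y ->
  face_ball D (x + a *: (y - x)).
Proof.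
move=> /andP[a0 a1] [fx hx] [fy hy]; split; first exact: affine_comb.
have -> : x + a *: (y - x) - ps = (1 - a) *: (x - ps) + a *: (y - ps).
  by apply/rowP => i; rewrite !mxE; ring.
move: (x - ps) (y - ps) hx hy => u v hx hy; have := frob_ge0 (u - v).
rewrite !(frobDl, frobDr, frobNl, frobNr, frobZl, frobZr) [frob v u]frobC => h.
have : (1 - a) * a * (2 * frob u v) <= (1 - a) * a * (frob u u + frob v v).
  by apply: ler_wpM2l; [nra|lra].
nra.
Qed.

Section Ball.
Variable D : R.
Hypothesis LD : Ls * D <= 8^-1 ^+ 2.
Hypothesis pD : D <= (pmin A ps / 2) ^+ 2.

Lemma ball_locsq y : face_ball D y -> locsq A ps (y - ps) <= 8^-1 ^+ 2.
Proof.
move=> [fy hy]; have [h0 h1] := affine_tangent fy affine_opt.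
apply: le_trans (L_star_ge d_gt1 opt nondeg h0) _; apply: le_trans LD.
by rewrite ler_wpM2l// ltW// L_star_gt0.
Qed.

Lemma ball_posdefB y : face_ball D y -> posdef (info B y).
Proof.
move=> hy; apply: (@near_id_posdef _ _ _ 8^-1); first by lra.
  exact: info_sym.
by rewrite whitened_sub//; exact: ball_locsq.
Qed.

Lemma ball_posdef y : face_ball D y -> posdef (info A y).
Proof. by move=> hy; apply/(posdef_whitened opt)/ball_posdefB. Qed.

Lemma ball_gt0 y i : face_ball D y -> i \in S -> 0 < y 0 i.
Proof.
move=> [[yS _] hy] iS; have p0 := pmin_gt0 opt nondeg.
have : (y - ps) 0 i ^+ 2 <= (pmin A ps / 2) ^+ 2.
  apply: le_trans pD; apply: le_trans hy.
  rewrite frob_rowE (bigD1 i)//= -expr2 lerDl; apply: sumr_ge0 => j _.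
  by rewrite -expr2 sqr_ge0.
rewrite -real_normK ?num_real// ler_sqr ?nnegrE ?divr_ge0 ?(ltW p0)//.
by have := pmin_le iS; rewrite !mxE ler_norml => h /andP[]; lra.
Qed.

Lemma ball_simplex y : face_ball D y -> face_simplex S y.
Proof.
move=> hy; have [[yS y1] _] := hy; split=> //; split=> // i.
by have [iS|/yS ->//] := boolP (i \in S); exact/ltW/ball_gt0.
Qed.

Lemma ball_inv_le y (u : 'rV[R]_d) : face_ball D y ->
  frob (u *m invmx (info B y)) u <= 8 / 7 * frob u u.
Proof.
move=> hy; have -> : 8 / 7 * frob u u = frob u u / (1 - 8^-1) by field.
apply: inv_quad_le; [lra|exact: ball_posdefB|move=> v].
have hq : frob (info B y - 1%:M) (info B y - 1%:M) <= 8^-1 ^+ 2.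
  by rewrite whitened_sub//; exact: ball_locsq.
have r8 : 0 <= 8^-1 :> R by lra.
by case/andP: (near_id_quad v r8 hq).
Qed.

Lemma lev_sum_whitened y q : posdef (info A y) ->
  \sum_i q 0 i * lev A y i = frob (invmx (info B y)) (info B q).
Proof.
move=> py; rewrite -lev_sum; apply: eq_bigr => i _.
by rewrite (lev_whitened opt).
Qed.

Let grad y := face_grad A S y.

(** Has the same tangential part as [grad], but with [d] in place of the mean score, so that it
    vanishes at [ps] and factors through [y - ps]. *)
Let resid y : 'rV[R]_n := \row_i (if i \in S then d%:R - lev A y i else 0).

Lemma sum_supp (F : 'I_n -> R) : (forall i, i \notin S -> F i = 0) ->
  \sum_i F i = \sum_(i in S) F i.
Proof.
by move=> h; rewrite [RHS]big_mkcond; apply: eq_bigr => i _; case: ifPn => // /h.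
Qed.

Lemma grad_notS y i : i \notin S -> grad y 0 i = 0.
Proof. by move=> iS; rewrite mxE (negPf iS). Qed.

Lemma card_S_neq0 : #|S|%:R != 0 :> R.
Proof. by rewrite pnatr_eq0 -lt0n; exact: ltnW (card_S_gt1 d_gt1 opt nondeg). Qed.

Lemma grad_sum y : \sum_i grad y 0 i = 0.
Proof.
rewrite sum_supp; last exact: grad_notS.
rewrite (eq_bigr (fun i => - lev A y i + (\sum_(j in S) lev A y j) / #|S|%:R)).
  rewrite big_split/= sumr_const -[X in _ + X]mulr_natr divfK ?card_S_neq0//.
  by rewrite sumrN addNr.
by move=> i iS; rewrite mxE -/S iS.
Qed.

Lemma grad_tangent y q : (forall i, i \notin S -> q 0 i = 0) -> \sum_i q 0 i = 0 ->
  frob (grad y) q = - \sum_i q 0 i * lev A y i.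
Proof.
move=> qS q0; rewrite frob_rowE -sumrN.
set c := (\sum_(j in S) lev A y j) / #|S|%:R.
rewrite (eq_bigr (fun i => - (q 0 i * lev A y i) + c * q 0 i)).
  by rewrite big_split/= -mulr_sumr q0 mulr0 addr0.
move=> i _; have [iS|/qS ->] := boolP (i \in S); last by ring.
by rewrite mxE -/S iS -/c; ring.
Qed.

Lemma resid_tangent y q : (forall i, i \notin S -> q 0 i = 0) -> \sum_i q 0 i = 0 ->
  frob (resid y) q = frob (grad y) q.
Proof.
move=> qS q0; rewrite grad_tangent// frob_rowE -sumrN.
rewrite (eq_bigr (fun i => - (q 0 i * lev A y i) + d%:R * q 0 i)).
  by rewrite big_split/= -mulr_sumr q0 mulr0 addr0.
move=> i _; have [iS|/qS ->] := boolP (i \in S); last by ring.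
by rewrite mxE iS; ring.
Qed.

Lemma grad_le_resid y : frob (grad y) (grad y) <= frob (resid y) (resid y).
Proof.
have e := resid_tangent y (grad_notS y) (grad_sum y).
have := frob_ge0 (resid y - grad y).
by rewrite !(frobDl, frobDr, frobNl, frobNr) e [frob (grad y) (resid y)]frobC e; lra.
Qed.

(** With M the whitened information matrix at [y] and N its inverse, d - v_i pairs I - N with the
    i-th whitened atom, and I - N = (M - I) N. *)
Lemma resid_form y q : face_ball D y -> (forall i, i \notin S -> q 0 i = 0) ->
  frob (resid y) q =
  frob (info B (y - ps) *m invmx (info B y)) (info B q).
Proof.
move=> hy qS; rewrite -whitened_sub// mulmxBl mulmxV ?mul1mx; last first.
  exact/posdef_unit/ball_posdefB.
rewrite frobDl frobNl -lev_sum_whitened; last exact: ball_posdef.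
have -> : frob 1%:M (info B q) = \sum_i q 0 i * lev A ps i.
  by rewrite lev_sum_whitened ?info_whitened_opt ?invmx1//; exact: opt_posdef.
rewrite -sumrB frob_rowE; apply: eq_bigr => i _.
have [iS|/qS ->] := boolP (i \in S); last by ring.
by rewrite mxE iS (lev_optS iS); ring.
Qed.

(* The residual is G (y - ps) for a positive semidefinite G of norm at most
   2 Ls, whence |G v|^2 <= 2 Ls <G v, v>. *)
Lemma resid_cocoercive y : face_ball D y ->
  frob (resid y) (resid y) <= 2 * Ls * frob (resid y) (y - ps).
Proof.
move=> hy; have pN := posdef_psd (posdef_inv (ball_posdefB hy)).
have [NT N0] := pN; set N := invmx (info B y) in pN NT N0 *.
have rS i : i \notin S -> resid y 0 i = 0 by move=> iS; rewrite mxE (negPf iS).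
have [h0 h1] := affine_tangent hy.1 affine_opt.
pose b (X Y : 'M[R]_d) := frob (X *m N) Y.
have CS := @cauchy_schwarz_form R _ b (fun X => frob_quad_ge0 X pN).
have := CS _ _ (info B (y - ps)) (info B (resid y)).
rewrite /b -!resid_form// => h.
have {}h := h (fun X Y => _) (fun a X Y Z => _).
have {}h : frob (resid y) (resid y) ^+ 2 <=
    frob (resid y) (y - ps) * frob (info B (resid y) *m N) (info B (resid y)).
  apply: h => [X Y|a X Y Z]; first by rewrite frob_mulr NT frobC.
  by rewrite mulmxDl -scalemxAl frobDl frobZl.
have up : frob (info B (resid y) *m N) (info B (resid y)) <=
    8 / 7 * (Ls * frob (resid y) (resid y)).
  apply: le_trans (frob_quad_le _ (fun u => ball_inv_le u hy)) _.
  by rewrite ler_pM2l; [exact: (L_star_ge d_gt1 opt nondeg rS)|lra].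
have rd0 : 0 <= frob (resid y) (y - ps) by rewrite resid_form//; exact: frob_quad_ge0.
have L0 := L_star_gt0.
set r := frob (resid y) (resid y) in h up *; set w := frob (resid y) (y - ps) in h rd0 *.
have r0 : 0 <= r by exact: frob_ge0.
have [->|rN0] := eqVneq r 0; first by rewrite mulr_ge0// mulr_ge0// ltW.
have rp : 0 < r by rewrite lt_def rN0.
have h2 := le_trans h (ler_wpM2l rd0 up).
have h3 : r <= 8 / 7 * Ls * w.
  rewrite -(ler_pM2r rp) -expr2; apply: le_trans h2 _.
  by rewrite le_eqVlt; apply/orP; left; apply/eqP; ring.
by apply: le_trans h3 _; rewrite ler_wpM2r// ler_pM2r//; lra.
Qed.

Let step y := y - L^-1 *: grad y.

Lemma step_affine y : affine_face y -> affine_face (step y).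
Proof.
move=> [yS y1]; split=> [i iS|].
  by rewrite /step -scaleNr row_combE grad_notS// yS// mulr0 addr0.
rewrite (eq_bigr (fun i => y 0 i + - L^-1 * grad y 0 i)) => [|i _].
  by rewrite big_split/= -mulr_sumr grad_sum mulr0 addr0.
by rewrite /step -scaleNr row_combE.
Qed.

(** Cocoercivity with [L = 4 * Ls] gives |grad|^2 / L <= <grad, y - ps>, so in the expanded square
    the cross term outweighs |grad|^2 / L^2. *)
Lemma step_ball y : face_ball D y -> face_ball D (step y).
Proof.
move=> hy; have [fy hD] := hy; split; first exact: step_affine.
apply: le_trans hD; have [h0 h1] := affine_tangent fy affine_opt.
have -> : step y - ps = (y - ps) - L^-1 *: grad y by rewrite /step addrAC.
have co := resid_cocoercive hy; have gr := grad_le_resid y.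
rewrite (resid_tangent y h0 h1) in co.
move: (y - ps) co {h0 h1} => v co.
rewrite !(frobDl, frobDr, frobNl, frobNr, frobZl, frobZr) [frob v (grad y)]frobC.
have L0 := L_loc_gt0; have Li : 0 < L^-1 by rewrite invr_gt0.
set w := frob (grad y) v in co *; set g := frob (grad y) (grad y) in gr *.
have w0 : 0 <= w.
  by have := le_trans (frob_ge0 (resid y)) co; rewrite pmulr_rge0// mulr_gt0// L_star_gt0.
have : L^-1 * g <= w.
  rewrite mulrC ler_pdivrMr//; apply: le_trans gr _; apply: le_trans co _.
  by rewrite mulrC ler_wpM2l// /L /L_loc -/Ls; have := L_star_gt0; lra.
have g0 : 0 <= g by exact: frob_ge0.
move=> h; have : L^-1 * (L^-1 * g) <= L^-1 * w by rewrite ler_wpM2l// ltW.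
have : 0 <= L^-1 * w by rewrite mulr_ge0// ltW.
lra.
Qed.

(* The step stays in the simplex, so the projection is inactive. *)
Lemma face_proj_step y : face_ball D y -> face_proj S (step y) = step y.
Proof.
move=> hy; have sf := ball_simplex (step_ball hy); rewrite /face_proj.
case: xgetP => [x _ [fx hx]|/(_ (step y)) []]; last first.
  split=> // z _; rewrite !fnormE ler_wsqrtr//.
  by rewrite subrr frob0l frob_ge0.
have := hx _ sf; rewrite subrr !fnormE frob0l sqrtr0 => h.
have : Num.sqrt (frob (step y - x) (step y - x)) == 0 by rewrite eq_le h sqrtr_ge0.
rewrite sqrtr_eq0 => h2; apply/eqP; rewrite eq_sym -subr_eq0 -frob_eq0 eq_le h2.
exact: frob_ge0.
Qed.

(** Convexity is used at the new point. The resolvent identity N' = N - N X N' then exchanges its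
    inverse for the one at [y], at a cost quadratic in the step: (8/7)^2 / 4 of |grad|^2 / L, less
    than the half that may be spent. *)
Lemma obj_descent y : face_ball D y ->
  obj A (step y) <= obj A y - frob (grad y) (grad y) / (2 * L).
Proof.
move=> hy; have hx := step_ball hy; have L0 := L_loc_gt0.
have py := ball_posdef hy; have px := ball_posdef hx.
have pyB := ball_posdefB hy; have pxB := ball_posdefB hx.
pose X := info B (step y - y); pose N := invmx (info B y).
pose N' := invmx (info B (step y)).
have e0 : X = info B (step y) - info B y by exact: linearB.
have := obj_convex px py; rewrite lev_sum_whitened// -/N'.
have e1 : frob N' (info B y) - d%:R = - frob N' X.
  have : frob N' (info B (step y)) = d%:R.
    rewrite /frob info_sym /N' mulVmx ?mxtrace1//; exact: posdef_unit.
  by rewrite e0 frobDr frobNr => ->; ring.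
have e2 : N' = N - N *m X *m N'.
  rewrite e0 mulmxBr mulmxBl -[N *m info B y]/(invmx _ *m _).
  rewrite mulVmx ?posdef_unit// mul1mx -mulmxA mulmxV ?posdef_unit// mulmx1.
  by rewrite opprB addrC subrK.
have XT : X^T = X by exact: info_sym.
have e3 : frob N' X = frob N X - \tr (N *m X *m N' *m X).
  by rewrite {1}e2 frobDl frobNl; congr (_ - _); rewrite /frob XT.
have e4 : frob N X = frob (grad y) (grad y) / L.
  have [h0 h1] := affine_tangent (step_affine hy.1) hy.1.
  rewrite -lev_sum_whitened// -[LHS]opprK -grad_tangent//.
  by rewrite /step addrAC subrr add0r frobNr frobZr opprK mulrC.
have up : \tr (N *m X *m N' *m X) <= (8 / 7) ^+ 2 * frob X X.
  apply: frob_quad2_le => //; first by lra.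
  - exact: posdef_inv.
  - by move=> u; exact: ball_inv_le.
  - by move=> u; exact: ball_inv_le.
have XX : frob X X <= Ls * (frob (grad y) (grad y) / L ^+ 2).
  have [h0 h1] := affine_tangent (step_affine hy.1) hy.1.
  apply: le_trans (L_star_ge d_gt1 opt nondeg h0) _.
  rewrite -/Ls ler_pM2l ?L_star_gt0//.
  rewrite /step addrAC subrr add0r frobNr frobNl frobZr frobZl opprK mulrA.
  by rewrite -expr2 exprVn mulrC.
have g0 := frob_ge0 (grad y).
rewrite e1 e3 e4.
have : Ls * (frob (grad y) (grad y) / L ^+ 2) = 4^-1 * (frob (grad y) (grad y) / L).
  rewrite /L /L_loc -/Ls; have := L_star_gt0 => l0.
  by field; rewrite gt_eqF.
have -> : frob (grad y) (grad y) / (2 * L) = 2^-1 * (frob (grad y) (grad y) / L).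
  by field; rewrite gt_eqF.
have : 0 <= frob (grad y) (grad y) / L by rewrite divr_ge0// ltW.
lra.
Qed.

Lemma obj_linear_bound y z : face_ball D y -> face_ball D z ->
  obj A y - obj A z <= frob (grad y) (y - z).
Proof.
move=> hy hz; have py := ball_posdef hy; have pz := ball_posdef hz.
apply: le_trans (obj_convex py pz) _.
have [h0 h1] := affine_tangent hy.1 hz.1.
rewrite grad_tangent// -(lev_sum_self py) -sumrB -sumrN.
by apply: ler_sum => i _; rewrite [(y - z) 0 i]mxE [(- z) 0 i]mxE; lra.
Qed.

Lemma opt_in_ball : 0 <= D -> face_ball D ps.
Proof. by move=> D0; split; [exact: affine_opt|rewrite subrr frob0l]. Qed.

Lemma obj_opt_le y : face_ball D y -> obj A ps <= obj A y.
Proof.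
move=> hy; have [_ _ h] := opt; apply: h; last exact: ball_posdef.
by case: (ball_simplex hy).
Qed.

(* In a state (x, y, t), z = x + t (y - x) is the auxiliary sequence of the
   Lyapunov function; y and the next x are convex combinations involving it. *)
Definition fista_inv (st : 'rV[R]_n * 'rV[R]_n * R) : Prop :=
  let: (x, y, t) := st in
  [/\ 1 <= t, face_ball D x, affine_face y &
      2 / L * ((t ^+ 2 - t) * (obj A x - obj A ps)) +
        frob (x + t *: (y - x) - ps) (x + t *: (y - x) - ps) <= D].

Lemma fista_inv_y x y (t : R) : fista_inv (x, y, t) -> face_ball D y.
Proof.
move=> [t1 hx fy h]; have t0 : 0 < t by lra.
have hz : face_ball D (x + t *: (y - x)).
  split; first by apply: affine_comb => //; case: hx.
  apply: le_trans h; rewrite lerDr mulr_ge0//.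
    by rewrite divr_ge0// ltW// L_loc_gt0.
  by rewrite mulr_ge0 ?subr_ge0 ?obj_opt_le//; nra.
have -> : y = x + t^-1 *: ((x + t *: (y - x)) - x).
  by apply/rowP => i; rewrite !mxE; field; rewrite gt_eqF.
apply: face_ball_conv => //; rewrite invr_ge0 ltW//=.
by rewrite invf_le1.
Qed.

(** The equation makes the Lyapunov function telescope; the increment 1/2 gives the linear growth of
    [t]. *)
Lemma fista_next (t : R) : 1 <= t -> let t' := (1 + Num.sqrt (1 + 4 * t ^+ 2)) / 2 in
  t' ^+ 2 - t' = t ^+ 2 /\ t + 2^-1 <= t'.
Proof.
move=> t1 t'; have s0 : 0 <= 1 + 4 * t ^+ 2 by rewrite addr_ge0// mulr_ge0// sqr_ge0.
have sE : Num.sqrt (1 + 4 * t ^+ 2) ^+ 2 = 1 + 4 * t ^+ 2 by rewrite sqr_sqrtr.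
have ss : 2 * t <= Num.sqrt (1 + 4 * t ^+ 2).
  rewrite -ler_sqr ?nnegrE ?sqrtr_ge0//; last by lra.
  by rewrite sE exprMn; lra.
rewrite /t'; set s := Num.sqrt _ in sE ss *; split; last by lra.
have -> : ((1 + s) / 2) ^+ 2 - (1 + s) / 2 = (s ^+ 2 - 1) / 4 by field.
by rewrite sE; lra.
Qed.

Lemma fista_stepE x y (t : R) : face_ball D y -> fista_step A ps (x, y, t) =
  let t' := (1 + Num.sqrt (1 + 4 * t ^+ 2)) / 2 in
  (step y, step y + ((t - 1) / t') *: (step y - x), t').
Proof. by move=> hy; rewrite /fista_step -/S -/L (face_proj_step hy). Qed.

Lemma fista_inv_step x y (t : R) : fista_inv (x, y, t) ->
  fista_inv (fista_step A ps (x, y, t)).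
Proof.
move=> inv; have hy := fista_inv_y inv; have [t1 hx fy h] := inv.
rewrite fista_stepE//=; have [te tt] := fista_next t1.
set t' := (1 + _) / 2 in te tt *; have hx' := step_ball hy.
have t'0 : 0 < t' by lra.
split; [by lra|exact: hx'| |].
  have -> : step y + ((t - 1) / t') *: (step y - x) =
      step y + (- ((t - 1) / t')) *: (x - step y).
    by rewrite scaleNr -scalerN opprB.
  by apply: affine_comb; [case: hx'|case: hx].
rewrite te; set z := x + t *: (y - x) in h.
(* The auxiliary point moves by [t] times the gradient step. *)
have -> : step y + t' *: (step y + ((t - 1) / t') *: (step y - x) - step y) - ps =
    (z - ps) - (t / L) *: grad y.
  have tf : t' * ((t - 1) / t') = t - 1 by rewrite mulrC divfK// gt_eqF.
  rewrite [step y + _ - step y]addrAC subrr add0r scalerA tf /z /step.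
  by apply/rowP => i; rewrite !mxE; ring.
have D0 : 0 <= D by case: hx => _; apply: le_trans; exact: frob_ge0.
have c1 := obj_linear_bound hy hx.
have c2 := obj_linear_bound hy (opt_in_ball D0).
have c3 := obj_descent hy.
have L0 := L_loc_gt0.
have gz : frob (grad y) (z - ps) =
    (t - 1) * frob (grad y) (y - x) + frob (grad y) (y - ps).
  by rewrite -frobZr -frobDr; congr frob; apply/rowP => i; rewrite !mxE; ring.
move: (z - ps) h gz => v h gz.
have -> : frob (v - (t / L) *: grad y) (v - (t / L) *: grad y) =
    frob v v - 2 * (t / L) * frob (grad y) v + (t / L) ^+ 2 * frob (grad y) (grad y).
  by rewrite !(frobDl, frobDr, frobNl, frobNr, frobZl, frobZr) [frob v (grad y)]frobC; ring.
rewrite gz; apply: le_trans h.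
have Li : 0 < L^-1 by rewrite invr_gt0.
have c3' : obj A (step y) <= obj A y - frob (grad y) (grad y) * L^-1 / 2.
  by apply: le_trans c3 _; rewrite le_eqVlt; apply/orP; left; apply/eqP; field; rewrite gt_eqF.
move: c1 c2 c3' Li; move: (frob (grad y) (y - x)) (frob (grad y) (y - ps))
  (frob (grad y) (grad y)) (obj A (step y)) (obj A y) (obj A x) (obj A ps) (frob v v) (L^-1).
move=> a b gg ox' oy ox os vv k c1 c2 c3' k0.
have tk : 0 <= t * k by rewrite mulr_ge0//; lra.
(* Convexity from [y] towards [x] and towards [ps], with the weights that decompose [z - ps] in
   [gz]. *)
have i1 : (t - 1) * (oy - ox) + (oy - os) <= (t - 1) * a + b.
  by apply: lerD => //; rewrite ler_wpM2l//; lra.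
have i1' := ler_wpM2l tk i1.
have ttk : 0 <= t ^+ 2 * k by rewrite mulr_ge0 ?sqr_ge0// ltW.
have i2 := ler_wpM2l ttk c3'.
lra.
Qed.

End Ball.
End AcceleratedPhase.

(** * Contraction over one restart cycle *)

Section Cycles.
Variables (R : realType) (n d : nat) (A : 'M[R]_(n, d)) (ps : 'rV[R]_n).
Hypothesis d_gt1 : (1 < d)%N.
Hypothesis opt : optimal_design A ps.
Hypothesis nondeg : nondegenerate_design A ps.

Let Ls := L_star A ps.
Let L := L_loc A ps.
Let m := cycle_length A ps.
Implicit Types p q x y z : 'rV[R]_n.

(** The successor undoes the predecessor in [cycle_length], leaving the ceiling of the square root
    of 72 kappa. That root is at most 9 times the one of [kappa], and rounding adds at most one
    more. *)
Lemma cycle_length_bounds : 72 * kappa A ps <= m.+1%:R ^+ 2 /\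
  m.+1%:R <= 10 * Num.sqrt (kappa A ps).
Proof.
have k1 := kappa_ge1 d_gt1 opt nondeg.
rewrite /m /cycle_length /kappa_loc; set k := kappa A ps in k1 *.
set s := Num.sqrt (8 * (9 * k)).
have sE : s ^+ 2 = 72 * k by rewrite sqr_sqrtr; lra.
have s0 : 1 < s by rewrite -sqrtr1 ltr_sqrt; lra.
have k0 : 0 <= Num.sqrt k by exact: sqrtr_ge0.
have kE : Num.sqrt k ^+ 2 = k by rewrite sqr_sqrtr; lra.
have kk : 1 <= Num.sqrt k by rewrite -sqrtr1 ler_sqrt; lra.
have sk : s <= 9 * Num.sqrt k.
  by rewrite -ler_sqr ?nnegrE; [rewrite sE exprMn kE; lra|lra|lra].
have c0 : (0 < Num.ceil s)%R by rewrite ceil_gt0; lra.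
have cN : (`|Num.ceil s|%N)%:R = (Num.ceil s)%:~R :> R.
  by rewrite natr_absz gtr0_norm.
rewrite prednK; last by rewrite absz_gt0 gt_eqF.
rewrite cN; have := ceil_itv s; rewrite intrB.
set c := (Num.ceil s)%:~R => /andP[h1 h2]; split; last by lra.
by rewrite -sE ler_sqr ?nnegrE; lra.
Qed.

Lemma face_ballW D D' x : D <= D' -> face_ball A ps D x -> face_ball A ps D' x.
Proof. by move=> h [fx hx]; split=> //; exact: le_trans h. Qed.

Section Ball.
Variable D : R.
Hypothesis LD : Ls * D <= 8^-1 ^+ 2.
Hypothesis pD : D <= (pmin A ps / 2) ^+ 2.

Lemma fista_state_inv x0 k : face_ball A ps D x0 ->
  fista_inv A ps D (fista_state A ps x0 k) /\ k.+2%:R / 2 <= (fista_state A ps x0 k).2.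
Proof.
move=> h0; elim: k => [|k]; rewrite /fista_state.
  split; last by rewrite /=; lra.
  split=> //=; [by case: h0|].
  by rewrite subrr scaler0 addr0 expr1n subrr mul0r mulr0 add0r; case: h0.
rewrite -/(fista_state A ps x0 k) iterS -/(fista_state A ps x0 k).
case: (fista_state A ps x0 k) => [[x y] t] [inv tk].
have hy := fista_inv_y d_gt1 opt nondeg LD pD inv.
split; first exact: (fista_inv_step d_gt1 opt nondeg LD pD inv).
have [t1 _ _ _] := inv; have [_ h] := fista_next t1.
rewrite (fista_stepE d_gt1 opt nondeg LD pD x t hy)/=; move: tk h => /=.
rewrite -[k.+3%:R]natr1; lra.
Qed.

Lemma fista_state_ball x0 k : face_ball A ps D x0 ->
  face_ball A ps D (fista_state A ps x0 k).1.1 /\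
  face_ball A ps D (fista_state A ps x0 k).1.2.
Proof.
move=> /(fista_state_inv k)[]; case: (fista_state A ps x0 k) => [[x y] t] inv _.
split; first by case: inv.
exact: (fista_inv_y d_gt1 opt nondeg LD pD inv).
Qed.

(* After m iterations the objective gap is at most 2 L D / (m (m + 2)), which
   the growth of the objective around ps turns into a halved distance. *)
Lemma cycle_contraction x0 : face_ball A ps D x0 ->
  face_ball A ps (D / 2) (fista_state A ps x0 m).1.1.
Proof.
move=> h0; have [inv tm] := fista_state_inv m h0.
have [hx hy] := fista_state_ball m h0.
move: inv tm hx hy; case: (fista_state A ps x0 m) => [[x y] t] inv tm hx hy.
rewrite /= in hx hy tm *; have [fx _] := hx; split=> //.
have [t1 _ _ h] := inv; have L0 := L_loc_gt0 d_gt1 opt nondeg.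
have D0 : 0 <= D by case: hx => _; apply: le_trans; exact: frob_ge0.
have lx := ball_locsq d_gt1 opt nondeg LD hx.
have px := ball_posdef d_gt1 opt nondeg LD hx.
have [sx _] := ball_simplex opt nondeg pD hx.
have gain := obj_gain d_gt1 opt sx px.
set s := Num.sqrt _ in gain.
have s0 : 0 <= s by exact: sqrtr_ge0.
have sE : s ^+ 2 = locsq A ps (x - ps) by rewrite sqr_sqrtr ?locsq_ge0.
have s2 : s <= 2^-1.
  by rewrite -ler_sqr ?nnegrE ?invr_ge0// sE (le_trans lx)//; lra.
have h3 : s ^+ 2 / 3 <= obj A x - obj A ps.
  by apply: le_trans gain; apply: sc_gain_ge_sqr; rewrite s0.
have [q0 q1] := affine_tangent fx (affine_opt opt nondeg).
have mq := mu_star_le d_gt1 opt nondeg q0 q1; rewrite -sE in mq.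
have m0 := mu_gt0 d_gt1 opt nondeg; have k1 := kappa_ge1 d_gt1 opt nondeg.
have [mk _] := cycle_length_bounds.
have kE : kappa A ps * mu_star A ps = Ls by rewrite divfK// gt_eqF.
rewrite -natr1 in mk; rewrite -[m.+2%:R]natr1 -[m.+1%:R]natr1 in tm.
have mm0 : 0 <= m%:R :> R by [].
set M := m%:R in mk tm mm0.
(* From t >= (M + 2) / 2 and M (M + 2) = (M + 1)^2 - 1 >= 72 kappa - 1 >= 71 kappa. *)
have tt : 71 * kappa A ps / 4 <= t ^+ 2 - t.
  apply: (@le_trans _ _ (M * (M + 2) / 4)); nra.
have fz := frob_ge0 (x + t *: (y - x) - ps).
have h4 : 2 / L * ((t ^+ 2 - t) * (obj A x - obj A ps)) <= D by lra.
set f := obj A x - obj A ps in h3 h4.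
have f0 : 0 <= f by apply: le_trans h3; rewrite divr_ge0// sqr_ge0.
have h5 : (t ^+ 2 - t) * f <= D * L / 2.
  by move: h4; rewrite mulrAC ler_pdivrMr// mulrC; lra.
have h6 : 71 * kappa A ps / 4 * f <= D * L / 2 by apply: le_trans h5; rewrite ler_wpM2r.
rewrite /L /L_loc -/Ls -kE in h6.
set q := frob _ _ in mq *.
have h7 : mu_star A ps * q <= 3 * f by lra.
(* Combining [h6] and [h7] gives q <= (24/71) D, below D / 2. *)
have kp : 0 < kappa A ps * mu_star A ps by rewrite mulr_gt0//; lra.
rewrite -(ler_pM2l kp).
have := ler_wpM2l (_ : 0 <= kappa A ps) h7; move=> /(_ ltac:(lra)).
have : 0 <= D * (kappa A ps * mu_star A ps) by rewrite mulr_ge0// ltW.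
lra.
Qed.

(** Tested on a single active coordinate: its whitened atom has squared norm d^2. *)
Lemma L_star_ge_d2 : d%:R ^+ 2 <= Ls.
Proof.
have [i iS] := exists_in_S opt nondeg.
have := L_star_ge d_gt1 opt nondeg (q := delta_mx 0 i).
rewrite frob_delta mxE !eqxx mulr1 /locsq info_delta frob_atoms.
rewrite -(lev_opt opt) (lev_optS iS); apply=> j jS.
by rewrite mxE; have [ji|] := eqVneq j i; [move: jS; rewrite ji iS|rewrite andbF].
Qed.

(** Scores exceed [d] by at most d r / (1 - r), where r is the square root of [Ls] times the squared
    distance; [L_star_ge_d2] then absorbs the factor [d] into [Ls]. *)
Lemma ball_gap x : face_ball A ps D x ->
  gap A x <= 2 * Ls * Num.sqrt (frob (x - ps) (x - ps)).
Proof.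
move=> hx; have px := ball_posdef d_gt1 opt nondeg LD hx.
have [fx hD] := hx; have [q0 q1] := affine_tangent fx (affine_opt opt nondeg).
set q := frob _ _ in hD *; have q_ge0 : 0 <= q by exact: frob_ge0.
have L0 := L_star_gt0 d_gt1 opt nondeg; have d1 := dR_gt1 R d_gt1.
pose r := Num.sqrt Ls * Num.sqrt q.
have r0 : 0 <= r by rewrite mulr_ge0 ?sqrtr_ge0.
have rE : r ^+ 2 = Ls * q by rewrite exprMn !sqr_sqrtr// ltW.
have r8 : r <= 8^-1.
  rewrite -ler_sqr ?nnegrE//; last by lra.
  by rewrite rE; apply: le_trans LD; rewrite ler_pM2l.
have lr : locsq A ps (x - ps) <= r ^+ 2.
  by rewrite rE; exact: L_star_ge.
have dL : d%:R <= Num.sqrt Ls.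
  by rewrite -[leLHS]ger0_norm// -sqrtr_sqr ler_wsqrtr// L_star_ge_d2.
have rL : d%:R * r <= Ls * Num.sqrt q.
  rewrite /r mulrA ler_wpM2r ?sqrtr_ge0// -[leRHS]sqr_sqrtr ?(ltW L0)// expr2.
  by rewrite ler_wpM2r ?sqrtr_ge0.
apply: gap_le => [|i].
  by rewrite addr_ge0// mulr_ge0 ?sqrtr_ge0// mulr_ge0// ltW.
have r01 : 0 <= r < 1 by rewrite r0/=; lra.
have /andP[_] := lev_near opt i r01 px lr; move=> /le_trans; apply.
have vd := lev_opt_le d_gt1 opt i.
rewrite ler_pdivrMr; last by lra.
have w0 : 0 <= Ls * Num.sqrt q by rewrite mulr_ge0 ?sqrtr_ge0// ltW.
have wr := ler_wpM2l w0 r8.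
move: r0 rL wr w0; rewrite -mulrA; set w := Ls * _; clearbody r w; nra.
Qed.

Lemma ball_john eps x : face_ball A ps D x -> gap A x <= eps * d%:R ->
  john_ellipsoid A eps x.
Proof.
move=> hx g; split=> //; first by case: (ball_simplex opt nondeg pD hx).
exact: (ball_posdef d_gt1 opt nondeg LD hx).
Qed.

End Ball.

Lemma cycle_end_ball D x0 j : Ls * D <= 8^-1 ^+ 2 -> D <= (pmin A ps / 2) ^+ 2 ->
  face_ball A ps D x0 -> face_ball A ps (D / 2 ^+ j) (cycle_end A ps x0 j).
Proof.
move=> LD pD h0; elim: j => [|j IH]; first by rewrite expr0 divr1.
have D0 : 0 <= D by case: h0 => _; apply: le_trans; exact: frob_ge0.
have Dj : D / 2 ^+ j <= D.
  by rewrite ler_pdivrMr ?exprn_gt0// ler_peMr// exprn_ege1// ler1n.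
rewrite exprSr invfM mulrA [cycle_end _ _ _ _]iterS; apply: cycle_contraction => //.
- by apply: le_trans LD; rewrite ler_pM2l// L_star_gt0.
- exact: le_trans pD.
Qed.

End Cycles.

(** * Query counts *)

Section Counting.
Variables (R : realType) (n d : nat) (A : 'M[R]_(n, d)) (ps : 'rV[R]_n).
Hypothesis d_gt1 : (1 < d)%N.
Hypothesis opt : optimal_design A ps.
Hypothesis nondeg : nondegenerate_design A ps.

Let S := Sstar A ps.
Let Ls := L_star A ps.
Let mu := mu_star A ps.
Let kap := kappa A ps.
Implicit Types p q x y z : 'rV[R]_n.

Lemma kappa_mu : kap * mu = Ls.
Proof. by rewrite divfK// gt_eqF// mu_gt0. Qed.

(** The second claim rests on the [kappa ^+ 3] in [cst_c], the third on the [pmin] term of [rbar].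
    The last one lets [Theta_A] enter the count. *)
Lemma start_ball x0 : simplex x0 -> posdef (info A x0) ->
  (forall i, (x0 0 i != 0) = (i \in S)) -> gap A x0 <= cst_c A ps ->
  let D := frob (x0 - ps) (x0 - ps) in
  [/\ face_ball A ps D x0, Ls * D <= 8^-1 ^+ 2, D <= (pmin A ps / 2) ^+ 2 &
      mu * D <= 3 * cst_c0 A ps].
Proof.
move=> sx px xS gc D.
have m0 : 0 < mu by exact: mu_gt0. have k1 : 1 <= kap by exact: kappa_ge1.
have k0 : 0 < kap by lra.
have xS' i : i \notin S -> x0 0 i = 0 by rewrite -xS negbK => /eqP.
have [_ hr hc] := near_opt d_gt1 opt nondeg sx px gc.
have fx : affine_face A ps x0 by split=> //; case: sx.
have [q0 q1] := affine_tangent fx (affine_opt opt nondeg).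
have mD : mu * D <= locsq A ps (x0 - ps) by exact: mu_star_le.
have mDc := le_trans mD hc.
have D0 : 0 <= D by exact: frob_ge0.
split=> //.
- have ck : cst_c A ps <= 126^-1 ^+ 2 / kap ^+ 3 by rewrite ge_min lexx orbT.
  rewrite -kappa_mu -mulrA.
  apply: le_trans (ler_wpM2l (ltW k0) (le_trans mDc (ler_wpM2l _ ck))) _ => //.
  have -> : kap * (3 * (126^-1 ^+ 2 / kap ^+ 3)) = 3 * 126^-1 ^+ 2 / kap ^+ 2.
    by field; rewrite gt_eqF.
  rewrite ler_pdivrMr ?exprn_gt0//.
  have : 1 <= kap ^+ 2 by rewrite exprn_ege1.
  lra.
- have := le_trans mD hr.
  have r0 := rbar_gt0 d_gt1 opt nondeg; have rp := rbar_le_pmin A ps.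
  have : rbar A ps ^+ 2 <= (2^-1 * pmin A ps * Num.sqrt mu) ^+ 2.
    by rewrite ler_sqr ?nnegrE ?(ltW r0)// (le_trans (ltW r0)).
  rewrite [(_ * Num.sqrt mu) ^+ 2]exprMn sqr_sqrtr ?(ltW m0)// => h1 h2.
  rewrite -(ler_pM2l m0); apply: le_trans h2 (le_trans h1 _).
  by rewrite mulrC [pmin _ _ / 2]mulrC.
- apply: le_trans mDc _; rewrite ler_pM2l//.
  by rewrite ge_min lexx.
Qed.

Lemma Theta_ge2 : 2 <= Theta_A A ps.
Proof. by rewrite lerDr divr_ge0 ?sqrtr_ge0. Qed.

Lemma Theta_sqr : 36 * Ls * kap * cst_c0 A ps <= (Theta_A A ps * d%:R) ^+ 2.
Proof.
have d0 : 0 < d%:R :> R by rewrite ltr0n ltnW.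
have L0 : 0 < Ls by exact: L_gt0. have k1 : 1 <= kap by exact: kappa_ge1.
have c0 := c0_gt0 d_gt1 opt nondeg.
set w := 36 * Ls * kap * cst_c0 A ps.
have k0 : 0 <= kap by lra.
have Lk0 : 0 <= 36 * Ls * kap by rewrite mulr_ge0// mulr_ge0// ltW.
have w0 : 0 <= w by rewrite mulr_ge0// ltW.
have wE : L_loc A ps * kappa_loc A ps * cst_c0 A ps = w.
  by rewrite /L_loc /kappa_loc /w -/Ls -/kap; ring.
rewrite -[leLHS]sqr_sqrtr// ler_sqr ?nnegrE ?sqrtr_ge0//; last first.
  by rewrite mulr_ge0 ?(ltW d0)// (le_trans _ Theta_ge2).
by rewrite /Theta_A wE mulrDl divfK ?gt_eqF// lerDl mulr_ge0// ltW.
Qed.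

(** With c0 <= rbar^2 <= (pmin / 2)^2 mu and kappa mu = L, the radicand is at most 9 (L pmin)^2 <= 9
    d^2. This yields 5; 8 = 2^3 is kept because its logarithm is 3 ln 2. *)
Lemma Theta_le8 : Theta_A A ps <= 8.
Proof.
have d0 : 0 < d%:R :> R by rewrite ltr0n ltnW.
have L0 : 0 < Ls by exact: L_gt0.
have m0 : 0 < mu by exact: mu_gt0.
have r0 := rbar_gt0 d_gt1 opt nondeg; have rp := rbar_le_pmin A ps.
have c0r : cst_c0 A ps <= rbar A ps ^+ 2 by apply: sc_gain_le_sqr; exact: ltW.
have rm : rbar A ps ^+ 2 <= (pmin A ps / 2) ^+ 2 * mu.
  have : rbar A ps ^+ 2 <= (2^-1 * pmin A ps * Num.sqrt mu) ^+ 2.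
    by rewrite ler_sqr ?nnegrE ?(ltW r0)// (le_trans (ltW r0)).
  by rewrite [(_ * Num.sqrt mu) ^+ 2]exprMn sqr_sqrtr ?(ltW m0)// [2^-1 * _]mulrC.
have Lp := L_star_pmin d_gt1 opt nondeg; rewrite -/Ls in Lp.
have p0 := pmin_gt0 opt nondeg.
have k0 : 0 < kap by rewrite (lt_le_trans ltr01)//; exact: kappa_ge1.
have h : L_loc A ps * kappa_loc A ps * cst_c0 A ps <= (3 * d%:R) ^+ 2.
  rewrite /L_loc /kappa_loc -/Ls -/kap.
  apply: (@le_trans _ _ (4 * Ls * (9 * kap) * ((pmin A ps / 2) ^+ 2 * mu))).
    rewrite ler_wpM2l ?(le_trans c0r)//.
    by rewrite mulr_ge0// mulr_ge0// ltW.
  have -> : 4 * Ls * (9 * kap) * ((pmin A ps / 2) ^+ 2 * mu) =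
      (3 * (Ls * pmin A ps)) ^+ 2.
    by rewrite -[in RHS]kappa_mu -kappa_mu; field.
  rewrite ler_sqr ?nnegrE ?mulr_ge0 ?(ltW d0) ?(ltW L0) ?(ltW p0)//.
  by rewrite ler_pM2l.
have h2 : Num.sqrt (L_loc A ps * kappa_loc A ps * cst_c0 A ps) <= 3 * d%:R.
  rewrite -[leRHS]ger0_norm ?mulr_ge0 ?(ltW d0)// -sqrtr_sqr.
  by rewrite ler_wsqrtr.
have : Num.sqrt (L_loc A ps * kappa_loc A ps * cst_c0 A ps) / d%:R <= 3.
  by rewrite ler_pdivrMr.
rewrite /Theta_A; lra.
Qed.

Lemma ln2_ge_half : 2^-1 <= ln (2 : R).
Proof.
have h : ln (2^-1 : R) <= 2^-1 - 1 by rewrite ln_leB1// invr_gt0.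
by move: h; rewrite lnV ?posrE//; lra.
Qed.

Lemma log_Theta_ge eps : 0 < eps <= 1 -> 2^-1 <= ln (Theta_A A ps / eps).
Proof.
move=> /andP[e0 e1]; apply: le_trans ln2_ge_half _.
have Th := Theta_ge2.
rewrite ler_ln ?posrE ?divr_gt0//; last by lra.
by rewrite ler_pdivlMr//; nra.
Qed.

Lemma log_Theta_le eps : 0 < eps <= 2^-1 ->
  ln (Theta_A A ps / eps) <= 4 * ln (eps^-1).
Proof.
move=> /andP[e0 e1]; have Th := Theta_ge2.
have i0 : 0 < eps^-1 by rewrite invr_gt0.
rewrite ln_div ?posrE//; last by lra.
have l1 : ln (Theta_A A ps) <= ln (2 ^+ 3 : R).
  rewrite ler_ln ?posrE ?exprn_gt0//; last by lra.
  by apply: le_trans Theta_le8 _; rewrite -natrX.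
rewrite lnXn// in l1.
have l2 : ln (2 : R) <= ln (eps^-1).
  by rewrite ler_ln ?posrE// -[leLHS]invrK lef_pV2 ?posrE ?invr_gt0.
have e : ln (eps^-1) = - ln eps by rewrite lnV.
by move: l1; rewrite mulr_natl; lra.
Qed.

Lemma pow2_ge_expR (l : R) (j : nat) : 2 * l <= j%:R -> expR l <= 2 ^+ j.
Proof.
move=> h; apply: (@le_trans _ _ (expR (j%:R * 2^-1))); first by rewrite ler_expR; lra.
rewrite expRM_natl; apply: lerXn2r; rewrite ?nnegrE ?expR_ge0//.
rewrite -[leRHS]lnK ?posrE// ler_expR; exact: ln2_ge_half.
Qed.

Lemma stop_index_exists eps x0 : 0 < eps <= 1 ->
  let D := frob (x0 - ps) (x0 - ps) in
  face_ball A ps D x0 -> Ls * D <= 8^-1 ^+ 2 -> D <= (pmin A ps / 2) ^+ 2 ->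
  mu * D <= 3 * cst_c0 A ps ->
  exists T, accel_stop A ps eps x0 T /\ T%:R <= 6 * ln (Theta_A A ps / eps).
Proof.
move=> e01 D hx LD pD mD; have /andP[e0 e1] := e01.
have lT := log_Theta_ge e01; set lam := ln _ in lT *.
(* Halving the squared distance [j] times must gain the factor (Theta / eps)^2 = e^(2 lam), and 4
   lam halvings do because ln 2 >= 1/2. As lam >= 1/2, rounding up stays within 6 lam. *)
have [j [j_gt0 j1 j2]] : exists j : nat,
    [/\ (0 < j)%N, j%:R - 1 <= 4 * lam & 4 * lam <= j%:R].
  have c0 : 0 < Num.ceil (4 * lam) by rewrite ceil_gt0; lra.
  exists `|Num.ceil (4 * lam)|%N; rewrite absz_gt0 gt_eqF// natr_absz gtr0_norm//.
  by have := ceil_itv (4 * lam); rewrite intrB => /andP[/ltW].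
have d0 : 0 < d%:R :> R by rewrite ltr0n ltnW.
have L0 : 0 < Ls by exact: L_gt0. have k1 : 1 <= kap by exact: kappa_ge1.
have Th0 : 0 < Theta_A A ps := lt_le_trans (ltr0Sn _ 1) (Theta_ge2).
have Te : 0 < Theta_A A ps / eps := divr_gt0 Th0 e0.
have gj : gap A (cycle_end A ps x0 j) <= eps * d%:R.
  have hj := cycle_end_ball d_gt1 opt nondeg j LD pD hx.
  have D0 : 0 <= D by exact: frob_ge0.
  have Dj : D / 2 ^+ j <= D.
    by rewrite ler_pdivrMr ?exprn_gt0// ler_peMr// exprn_ege1// ler1n.
  have LDj : Ls * (D / 2 ^+ j) <= 8^-1 ^+ 2.
    by apply: le_trans LD; rewrite ler_pM2l.
  apply: le_trans (ball_gap d_gt1 opt nondeg LDj hj) _.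
  have [_ hq] := hj; set q := frob _ _ in hq *.
  rewrite -ler_sqr ?nnegrE ?mulr_ge0 ?sqrtr_ge0 ?(ltW L0) ?(ltW e0) ?(ltW d0)//.
  rewrite exprMn sqr_sqrtr ?frob_ge0//.
  have p2 : (Theta_A A ps / eps) ^+ 2 <= 2 ^+ j.
    have le : expR lam = Theta_A A ps / eps by rewrite lnK.
    rewrite expr2 -le -expRD; apply: pow2_ge_expR.
    by rewrite (_ : 2 * (lam + lam) = 4 * lam)//; ring.
  have p2' : Theta_A A ps ^+ 2 <= eps ^+ 2 * 2 ^+ j.
    by move: p2; rewrite expr_div_n ler_pdivrMr ?exprn_gt0// mulrC.
  (* The squared gap bound at the start is 4 L kappa (mu D) <= 12 L kappa c0, within the 36 L kappa
     c0 under the root in [Theta_A]. *)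
  have h1 : (2 * Ls) ^+ 2 * D <= (Theta_A A ps * d%:R) ^+ 2.
    apply: le_trans Theta_sqr.
    have -> : (2 * Ls) ^+ 2 * D = 4 * Ls * kap * (mu * D).
      by transitivity (4 * Ls * (kap * mu) * D); [rewrite kappa_mu; ring|ring].
    have k0 : 0 <= kap by lra.
    have Lk0 : 0 <= 4 * Ls * kap by rewrite mulr_ge0// mulr_ge0// ltW.
    apply: le_trans (ler_wpM2l Lk0 mD) _.
    have := c0_gt0 d_gt1 opt nondeg => c0'.
    have : 0 <= 4 * Ls * kap * cst_c0 A ps by rewrite mulr_ge0// ltW.
    lra.
  apply: (@le_trans _ _ ((2 * Ls) ^+ 2 * (D / 2 ^+ j))).
    by rewrite ler_wpM2l// sqr_ge0.
  rewrite mulrA ler_pdivrMr ?exprn_gt0//; apply: le_trans h1 _.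
  rewrite !exprMn [leRHS]mulrAC; apply: ler_wpM2r p2'.
  by rewrite sqr_ge0.
(* Index 0 is excluded because the gap is first tested at the end of the first cycle. *)
have ex : exists j, (0 < j)%N && (gap A (cycle_end A ps x0 j) <= eps * d%:R).
  by exists j; rewrite j_gt0.
have [T /andP[T0 gT] Tm] := ex_minnP ex.
exists T; split.
  split=> // i /andP[i0 iT]; rewrite ltNge; apply/negP => gi.
  by have := Tm i; rewrite i0 gi leqNgt iT => /(_ isT).
have : T%:R <= j%:R :> R by rewrite ler_nat Tm// j_gt0.
lra.
Qed.

Lemma size_flatten_map (T : Type) (f : nat -> seq T) (s : seq nat) c :
  (forall j, size (f j) = c) -> size (flatten [seq f j | j <- s]) = (size s * c)%N.
Proof. by move=> fc; elim: s => //= j s IH; rewrite size_cat IH fc. Qed.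

Lemma size_alg1_queries (p : nat -> 'rV[R]_n) k0 T :
  size (alg1_queries A ps p k0 T) = (k0.+1 + T * (cycle_length A ps).+1)%N.
Proof.
rewrite size_cat size_map size_iota (@size_flatten_map _ _ _ (cycle_length A ps).+1).
  by rewrite size_iota.
by move=> j; rewrite size_rcons size_map size_iota.
Qed.

Lemma alg1_queries_posdef (p : nat -> 'rV[R]_n) k0 T w : afw_run A p ->
  let D := frob (p k0 - ps) (p k0 - ps) in
  face_ball A ps D (p k0) -> Ls * D <= 8^-1 ^+ 2 -> D <= (pmin A ps / 2) ^+ 2 ->
  w \in alg1_queries A ps p k0 T -> posdef (info A w).
Proof.
move=> run D hx LD pD; rewrite mem_cat => /orP[/mapP[k _ ->]|].
  by case: (afw_run_feasible d_gt1 k run).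
move=> /flattenP[_ /mapP[j _ ->]].
have D0 : 0 <= D by exact: frob_ge0.
have cb i : face_ball A ps D (cycle_end A ps (p k0) i).
  apply: face_ballW (cycle_end_ball d_gt1 opt nondeg i LD pD hx).
  by rewrite ler_pdivrMr ?exprn_gt0// ler_peMr// exprn_ege1// ler1n.
have bp := ball_posdef d_gt1 opt nondeg LD.
rewrite mem_rcons inE => /orP[/eqP ->|/mapP[k _ ->]]; first exact/bp/cb.
by apply: bp; case: (fista_state_ball d_gt1 opt nondeg LD pD k (cb j)).
Qed.

(** The cycles cost 6 lam times 10 sqrt kappa. The one extra query, at which the loop test fails, is
    at most 2 sqrt kappa lam, whence 62. *)
Lemma query_count CA k0 T (lam : R) : (k0 <= CA)%N -> 2^-1 <= lam -> T%:R <= 6 * lam ->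
  (k0.+1 + T * (cycle_length A ps).+1)%N%:R <= CA%:R + 62 * Num.sqrt kap * lam.
Proof.
move=> kC l0 Tl; have [_ mk] := cycle_length_bounds d_gt1 opt nondeg.
have k1 : 1 <= kap by exact: kappa_ge1.
have kk : 1 <= Num.sqrt kap by rewrite -sqrtr1 ler_sqrt; lra.
rewrite natrD natrM -natr1.
have kC' : k0%:R <= CA%:R :> R by rewrite ler_nat.
have h : T%:R * (cycle_length A ps).+1%:R <= 6 * lam * (10 * Num.sqrt kap).
  by apply: ler_pM.
nra.
Qed.

End Counting.

Theorem theorem5p8 (R : realType) :
  exists C : R, 0 < C /\
  forall (n d : nat) (A : 'M[R]_(n, d)) (ps : 'rV[R]_n),
  (1 < d)%N -> \rank A = d -> optimal_design A ps -> nondegenerate_design A ps ->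
  forall muR : R, 0 < muR <= 2^-1 ->
  let Phi := facial_distance A ps in
  let kap := kappa A ps in
  let kPhi := kappa_Phi A ps muR in
  let binom : R := 'C(d.+1, 2)%:R in
  [/\ 0 < Phi,
      kap <= 4 * binom * d%:R ^+ 2 / Phi ^+ 2,
      4 * binom * d%:R ^+ 2 / Phi ^+ 2 <= 2 * binom * d%:R ^+ 2 * kPhi &
      2 * binom * d%:R ^+ 2 * kPhi <= C * d%:R ^+ 4 * kPhi] /\
  forall (p : nat -> 'rV[R]_n) (Kid : nat) (Kgap : R -> nat) (CZ : R),
  afw_run A p -> afw_guarantees A ps muR p Kid Kgap CZ ->
  let CA := C_setup A ps Kid Kgap in
  exists k0 : nat,
  [/\ setup_exit A ps p k0,
      (k0 <= CA)%N,
      forall i, (p k0 0 i != 0) = (i \in Sstar A ps) &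
      obj A (p k0) - obj A ps <= cst_c A ps] /\
  forall eps : R, 0 < eps <= 1 ->
  exists T : nat,
  let queries := alg1_queries A ps p k0 T in
  let N : R := (size queries)%:R in
  [/\ accel_stop A ps eps (p k0) T,
      john_ellipsoid A eps (cycle_end A ps (p k0) T),
      forall w, w \in queries -> posdef (info A w),
      N <= CA%:R + C * Num.sqrt kap * ln (Theta_A A ps / eps) &
      eps <= 2^-1 ->
      [/\ exists k : nat, john_ellipsoid A eps (p k) /\
            k%:R <= CZ * kPhi * ln (eps^-1),
          N <= CA%:R + C * d%:R ^+ 4 * (kPhi * ln (eps^-1)) &
          forall B : R, 0 < B -> kPhi / B <= kap <= B * kPhi ->
            N <= CA%:R + C * Num.sqrt B * (Num.sqrt kPhi * ln (eps^-1))]].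
Proof.
(* Covers 62 * 4 * 2 = 496: 62 from the count, 4 from replacing ln (Theta / eps) by ln (1 / eps),
   and 2 from 2 binom d^2 <= 2 d^4. *)
exists 500; split=> // n d A ps d_gt1 _ opt nondeg muR /andP[mu0 mu1] Phi kap kPhi bin.
have d1 := dR_gt1 R d_gt1.
have Phi0 : 0 < Phi by exact: facial_distance_gt0.
have kP0 : 0 < kPhi by rewrite invr_gt0 mulr_gt0// exprn_gt0.
have k1 : 1 <= kap by exact: kappa_ge1.
have binE : 2 * bin = d.+1%:R * d%:R.
  by rewrite /bin -!natrM -mul_bin_diag bin1.
have bin0 : 0 <= bin by exact: ler0n.
have b1 : kap <= 4 * bin * d%:R ^+ 2 / Phi ^+ 2 by exact: kappa_facial.
have b2 : 4 * bin * d%:R ^+ 2 / Phi ^+ 2 <= 2 * bin * d%:R ^+ 2 * kPhi.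
  have -> : 4 * bin * d%:R ^+ 2 / Phi ^+ 2 = 2 * bin * d%:R ^+ 2 * (2 / Phi ^+ 2) by ring.
  apply: ler_wpM2l; first by rewrite !mulr_ge0// sqr_ge0.
  rewrite /kPhi /kappa_Phi -/Phi [leRHS]invfM; apply: ler_wpM2r.
    by rewrite invr_ge0 sqr_ge0.
  by rewrite -[2]invrK lef_pV2 ?posrE// invr_gt0.
have b3 : 2 * bin * d%:R ^+ 2 <= 2 * d%:R ^+ 4.
  rewrite binE -natr1; have : 0 <= d%:R ^+ 3 * (d%:R - 1) :> R.
    by rewrite mulr_ge0 ?exprn_ge0//; lra.
  by rewrite !exprS expr0; lra.
have b3' : 2 * bin * d%:R ^+ 2 * kPhi <= 2 * d%:R ^+ 4 * kPhi by rewrite ler_pM2r.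
have dk : 0 <= d%:R ^+ 4 * kPhi by rewrite mulr_ge0 ?exprn_ge0// ltW.
split; first by split=> //; apply: le_trans b3' _; move: dk; rewrite -!mulrA; lra.
move=> p Kid Kgap CZ run guar CA.
have [k0 [ex k0C supp gc]] := setup_exits d_gt1 opt nondeg run guar.
have [sx px] := afw_run_feasible d_gt1 k0 run.
exists k0; split; first by split=> //; case: (near_opt d_gt1 opt nondeg sx px gc).
move=> eps e01; have /andP[e0 e1] := e01.
have [hx LD pD mD] := start_ball d_gt1 opt nondeg sx px supp gc.
have [T [stop Tl]] := stop_index_exists d_gt1 opt nondeg e01 hx LD pD mD.
have lT := log_Theta_ge A ps e01.
have H := query_count d_gt1 opt nondeg k0C lT Tl.
rewrite -(size_alg1_queries A ps p) -/CA -/kap in H.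
exists T; move=> queries N.
have sk0 : 0 <= Num.sqrt kap by exact: sqrtr_ge0.
have sl0 : 0 <= Num.sqrt kap * ln (Theta_A A ps / eps) by rewrite mulr_ge0//; lra.
split=> //.
- have D0 : 0 <= frob (p k0 - ps) (p k0 - ps) by exact: frob_ge0.
  apply: (ball_john d_gt1 opt nondeg LD pD); last by case: stop.
  apply: face_ballW (cycle_end_ball d_gt1 opt nondeg T LD pD hx).
  by rewrite ler_pdivrMr ?exprn_gt0// ler_peMr// exprn_ege1// ler1n.
- by move=> w; exact: (alg1_queries_posdef d_gt1 opt nondeg run hx LD pD).
- rewrite /N /queries; apply: le_trans H _; rewrite lerD2l -!mulrA; lra.
(* With eps <= 1/2, ln (1 / eps) is at least ln 2 and so dominates the logarithm of [Theta_A]. *)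
move=> e2; have e02 : 0 < eps <= 2^-1 by rewrite e0.
have lle := log_Theta_le d_gt1 opt nondeg e02.
set l := ln eps^-1 in lle *.
have l0 : 0 <= l by lra.
have Nl : N <= CA%:R + 248 * (Num.sqrt kap * l).
  have := ler_wpM2l sk0 lle; rewrite /N /queries; lra.
have [hgap hK _] := guar.
split.
- exists (Kgap eps); split; last exact: hK.
  by have [sk pk] := afw_run_feasible d_gt1 (Kgap eps) run; split=> //; exact: hgap.
- apply: le_trans Nl _; rewrite lerD2l mulrA -[leRHS]mulrA mulrA mulrA.
  apply: ler_wpM2r => //.
  (* Since [kap >= 1], the root may be replaced by [kap] itself, which the facial bound compares
     with d^4 [kPhi]. *)
  have : Num.sqrt kap <= kap.
    have := sqr_sqrtr (le_trans ler01 k1).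
    have : 1 <= Num.sqrt kap by rewrite -sqrtr1 ler_sqrt; lra.
    nra.
  lra.
- move=> b b0 /andP[_ kb]; apply: le_trans Nl _; rewrite lerD2l.
  have : Num.sqrt kap <= Num.sqrt b * Num.sqrt kPhi.
    by rewrite -sqrtrM ?(ltW b0)// ler_wsqrtr.
  move=> h; have := ler_wpM2r l0 h.
  have : 0 <= Num.sqrt b * Num.sqrt kPhi * l by rewrite !mulr_ge0 ?sqrtr_ge0.
  lra.
Qed.
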